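(* Let $k\ge 3$, $n=p(k-1)$, $\xi\sim\mathcal{N}_n(0,I)$, and let $\psi:\mathcal{X}\to\mathbb{S}^{p-1}$, $\Gamma\subset\mathbb{S}^{p-1}$ and $M\subset\mathbb{S}^{n-1}$ be as in the context. Assume that $\psi$ is a one-to-one map of class piecewise $C^2$ and that there do not exist $x,\tilde x\in\mathcal{X}$ with $\psi(x)=-\psi(\tilde x)$; and that $M$ is a $(k-1)$-dimensional closed piecewise $C^2$-manifold or a $(k-1)$-dimensional $C^2$-manifold with piecewise $C^2$-boundary. Suppose that $\Gamma$ has boundaries. Then $$\Pr\Bigl(\max_{u\in M}\xi^\top u\ge b\Bigr)\le\overline{P}_{\mathrm{tube}}(b)\quad\text{for all } b\ge 0,$$ where $$\overline{P}_{\mathrm{tube}}(b)=\frac{\Gamma(\frac k2)}{\sqrt{\pi}\,\Gamma(\frac{k-1}{2})}\,|\Gamma|\,\bigl\{\overline G_k(b^2)-\overline G_{k-2}(b^2)\bigr\}+\chi(\Gamma)\,\overline G_{k-1}(b^2),$$ $|\Gamma|$ is the length of $\Gamma$, and $\chi(\Gamma)$ is its Euler–Poincaré characteristic (here, the number of connected components of $\Gamma$).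
   Context: $\mathbb{S}^{m-1}$ is the unit sphere of $\mathbb{R}^m$. $\mathcal{X}\subseteq\mathbb{R}$ is an interval (finite, half-infinite, or all of $\mathbb{R}$) or a finite union of intervals. $f:\mathcal{X}\to\mathbb{R}^p$ is a regression basis vector function, $\Sigma$ a positive definite $p\times p$ matrix (the inverse information matrix of the regression model), $\Sigma^{1/2}$ satisfies $(\Sigma^{1/2})^\top\Sigma^{1/2}=\Sigma$, and $\psi(x)=\Sigma^{1/2}f(x)/\|\Sigma^{1/2}f(x)\|\in\mathbb{S}^{p-1}$. Define $$\Gamma=\overline{\{\psi(x)\mid x\in\mathcal{X}\}}\subset\mathbb{S}^{p-1},\qquad M=\overline{\{h\otimes\psi(x)\mid (x,h)\in\mathcal{X}\times\mathbb{S}^{k-2}\}}\subset\mathbb{S}^{n-1},\quad n=p(k-1),$$ with $\otimes$ the Kronecker product and bars denoting closure. $\overline G_m(\cdot)$ is the upper tail probability function of the chi-square distribution with $m$ degrees of freedom. In the formula for $\overline{P}_{\mathrm{tube}}$, $\Gamma(\cdot)$ with numerical argument is the gamma function, while $|\Gamma|$ and $\chi(\Gamma)$ refer to the curve $\Gamma$. *)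

(* Defs.v *)
From HB Require Import structures.
From mathcomp Require Import all_boot all_order all_algebra finmap.
From mathcomp Require Import all_classical all_reals all_analysis.
From mathcomp Require Import mxtens.

Set Implicit Arguments.
Unset Strict Implicit.
Unset Printing Implicit Defensive.

Import Order.TTheory GRing.Theory Num.Theory.
Import numFieldNormedType.Exports.

Local Open Scope classical_set_scope.
Local Open Scope ring_scope.

Section Euclidean.
Context {R : realType}.

Definition edot {n} (u v : 'cV[R]_n) : R := \sum_(i < n) u i 0 * v i 0.

(* The library norm on matrices is the sup norm, hence this definition; both
   norms induce the library topology. *)
Definition enorm {n} (u : 'cV[R]_n) : R := Num.sqrt (edot u u).

(* [sphere m] is the unit sphere of R^m, of dimension m - 1. *)
Definition sphere (m : nat) : set 'cV[R]_m := [set u | enorm u = 1].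

Definition posdef {p} (S : 'M[R]_p) : Prop :=
  S^T = S /\ forall v : 'cV[R]_p, v != 0 -> 0 < edot v (S *m v).

Definition finite_union_of_intervals (X : set R) : Prop :=
  exists s : seq (interval R), X = [set x | exists2 J, J \in s & x \in J].

End Euclidean.

Arguments sphere {R} m _.

Section PiecewiseC2.
Context {R : realType}.

(* On a finite-dimensional V this is the usual class C^k on the open set U. *)
Fixpoint Ck {V W : normedModType R} (k : nat) (U : set V) (f : V -> W) : Prop :=
  match k with
  | 0%N => forall x, U x -> {for x, continuous f}
  | k'.+1 => (forall x, U x -> differentiable f x) /\
             (forall v : V, Ck k' U ('D_v f))
  end.

(* On a set A that need not be open, C^2 means: A has an open neighbourhood
   carrying a C^2 extension of the restriction of f to A. *)
Definition C2_on {V W : normedModType R} (f : V -> W) (A : set V) : Prop :=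
  exists (U : set V) (g : V -> W),
    [/\ open U, A `<=` U, Ck 2 U g & {in A, g =1 f}].

Definition C2_immersion_on {V W : normedModType R} (f : V -> W) (A : set V) :
    Prop :=
  exists (U : set V) (g : V -> W),
    [/\ open U, A `<=` U, Ck 2 U g, {in A, g =1 f} &
        forall x, A x -> injective ('d g x)].

(* For V = R these are the closed intervals: R, half-lines, segments, points
   and the empty set. *)
Definition polyhedron {V : normedModType R} (Q : set V) : Prop :=
  exists (r : nat) (l : 'I_r -> {linear V -> R^o}) (c : 'I_r -> R),
    Q = [set y | forall i, l i y <= c i].

Definition piecewise {V : normedModType R} (C : set V -> Prop) (A : set V) :
    Prop :=
  exists (m : nat) (Q : 'I_m -> set V),
    [/\ forall i, polyhedron (Q i),
        A `<=` [set x | exists i, Q i x] &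
        forall i, C (A `&` Q i)].

(* The pieces are closed relatively to A, so the derivatives have one-sided
   limits at every breakpoint belonging to A. *)
Definition piecewise_C2 {V W : normedModType R} (A : set V) (f : V -> W) :
    Prop :=
  {within A, continuous f} /\ piecewise (C2_on f) A.

Definition homeomorphic_via {S T : topologicalType} (A : set S) (B : set T)
    (f : S -> T) : Prop :=
  [/\ {within A, continuous f}, f @` A = B &
      exists g : T -> S, {within B, continuous g} /\ {in A, cancel f g}].

(* "Closed" is in the sense of manifolds: compact and without boundary. *)
Definition closed_piecewise_C2_manifold (d : nat) {n} (M : set 'cV[R]_n) :
    Prop :=
  compact M /\
  forall u, M u ->
    exists (O : set 'cV[R]_n) (V : set 'cV[R]_d) (phi : 'cV[R]_d -> 'cV[R]_n),
      [/\ open O, O u, open V,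
          homeomorphic_via V (M `&` O) phi &
          piecewise (C2_immersion_on phi) V].

(* Epigraph of a piecewise C^2 function of d - 1 of the d coordinates: the
   local model of a domain with piecewise C^2 boundary. *)
Definition piecewise_C2_epigraph {d} (D : set 'cV[R]_d) : Prop :=
  exists (i : 'I_d) (g : 'cV[R]_d.-1 -> R),
    piecewise_C2 setT g /\ D = [set y | g (row' i y) <= y i 0].

(* Interior points of M are covered too: U may be contained in the interior of
   the epigraph D, and U `&` D is then open in R^d. *)
Definition C2_manifold_with_piecewise_C2_boundary (d : nat) {n}
    (M : set 'cV[R]_n) : Prop :=
  forall u, M u ->
    exists (O : set 'cV[R]_n) (U D : set 'cV[R]_d)
           (phi : 'cV[R]_d -> 'cV[R]_n),
      [/\ open O /\ O u, open U, piecewise_C2_epigraph D,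
          homeomorphic_via (U `&` D) (M `&` O) phi &
          C2_immersion_on phi (U `&` D)].

(* Boundary points of a one-dimensional G: a relative neighbourhood is
   homeomorphic to [0, 1[, the point corresponding to 0. *)
Definition curve_boundary {n} (G : set 'cV[R]_n) : set 'cV[R]_n :=
  [set u | exists (O : set 'cV[R]_n) (phi : R -> 'cV[R]_n),
     [/\ open O, O u, phi 0 = u &
         homeomorphic_via (`[0, 1[ : set R) (G `&` O) phi]].

(* [fset_set] sends infinite sets to the empty one; here the family is finite,
   G being the closure of finitely many continuous images of intervals. *)
Definition n_components {T : topologicalType} (G : set T) : nat :=
  #|` fset_set [set connected_component G u | u in G]|%fset.

(* Length of the injective curve psi on X: supremum of the lengths of inscribed
   polygonal lines. A pair of consecutive nodes contributes only if X contains
   the whole segment between them, so gaps of X are not counted. *)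
Definition curve_length {n} (X : set R) (psi : R -> 'cV[R]_n) : \bar R :=
  ereal_sup
    [set (\sum_(e <- zip s (behead s) | `[< `[e.1, e.2] `<=` X >])
            enorm (psi e.2 - psi e.1))%:E
    | s in [set s : seq R | sorted <=%R s]].

End PiecewiseC2.

Section Regression.
Context {R : realType}.

Definition regression_direction {p} (Shalf : 'M[R]_p) (f : R -> 'cV[R]_p)
    (x : R) : 'cV[R]_p :=
  (enorm (Shalf *m f x))^-1 *: (Shalf *m f x).

Definition Gamma_set {p} (X : set R) (psi : R -> 'cV[R]_p) : set 'cV[R]_p :=
  closure (psi @` X).

Definition M_set (k : nat) {p} (X : set R) (psi : R -> 'cV[R]_p) :
    set 'cV[R]_(k.-1 * p) :=
  closure [set u | exists x h,
    [/\ X x, sphere k.-1 h & u = (h *t psi x : 'cV[R]_(k.-1 * p))]].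

(* The law N_n(0, I): independent standard normal coordinates. *)
Definition std_normal_vector d (T : measurableType d) (P : probability T R) n
    (xi : T -> 'cV[R]_n) : Prop :=
  (forall i, measurable_fun [set: T] (fun w => xi w i 0 : R)) /\
  (forall B : 'I_n -> set R, (forall i, measurable (B i)) ->
     P [set w | forall i, B i (xi w i 0)] =
     (\prod_(i < n) normal_prob (0 : R) 1 (B i))%E).

Definition Gamma_fun (a : R) : R :=
  \int[lebesgue_measure]_(t in `]0, +oo[) (t `^ (a - 1) * expR (- t)).

Definition chi2_pdf (m : nat) (x : R) : R :=
  if 0 < x then
    x `^ (m%:R / 2 - 1) * expR (- x / 2) /
      (2 `^ (m%:R / 2) * Gamma_fun (m%:R / 2))
  else 0.

Definition chi2_upper (m : nat) (t : R) : R :=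
  \int[lebesgue_measure]_(x in `[t, +oo[) chi2_pdf m x.

(* Extended-real valued because the length of a curve is. *)
Definition P_tube (k : nat) (len : \bar R) (chi : nat) (b : R) : \bar R :=
  ((Gamma_fun (k%:R / 2) /
      (Num.sqrt pi * Gamma_fun ((k%:R - 1) / 2)))%:E * len *
     (chi2_upper k (b ^+ 2) - chi2_upper (k - 2) (b ^+ 2))%:E +
   (chi%:R * chi2_upper (k - 1) (b ^+ 2))%:E)%E.

End Regression.

Arguments M_set {R} k {p} X psi _.

(* Main.v *)
(* Idea. Cut xi into k - 1 blocks in R^p and let Y(x) in R^(k-1) be the vector of
   their scalar products with psi(x). The supremum over M is sup_x |Y(x)|, by the
   equality case of Cauchy-Schwarz in h. Each |Y(x)|^2 is chi-square with k - 1
   degrees of freedom, so E_x = {|Y(x)| >= b} has the same probability p0 for all x.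

   Write psi(y) = cos t psi(x) + sin t u with u orthogonal to psi(x). Then
   |Y(x)|^2 = S and the first-order term W of |Y(y)| is a standard normal variable
   independent of S (rotate block by block), whence
   P(E_y \ E_x) <= (rate + o(1)) |psi(y) - psi(x)| with rate = 2 b q(b^2) E[W^+],
   q being the chi-square density. Integration by parts identifies rate with the
   coefficient of |Gamma| in the tube formula.

   If x lies in A and y in B, then P(E_A u E_B) <= P(E_A) + P(E_B) - p0 + P(E_y \ E_x).
   Hence for a finite set of sample points carrying a graph with c connected
   components, P(union of the E_x) <= c p0 + the sum of P(E_y \ E_x) over the edges.
   Take as edges the consecutive sample points with no gap of X in between, whose
   chords sum up to at most |Gamma|, and finitely many arbitrarily short edges
   joining the intervals of X whose images have intersecting closures; then c is at
   most the number of components of Gamma. Refining the sample and letting the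
   level increase to b gives the bound. *)

Require Import Defs.
From HB Require Import structures.
From mathcomp Require Import all_boot all_order all_algebra finmap.
From mathcomp Require Import all_classical all_reals all_analysis.
From mathcomp Require Import mxtens measurable_realfun ring lra.

Set Implicit Arguments.
Unset Strict Implicit.
Unset Printing Implicit Defensive.

Import Order.TTheory GRing.Theory Num.Theory.
Import numFieldNormedType.Exports.

Local Open Scope classical_set_scope.
Local Open Scope ring_scope.

(** The delicate point is the law of (S, W). W = sum Y_i Z_i / sqrt S projects Z on the random
    direction Y / |Y|, and its independence of S is proved without conditional laws or polar
    coordinates: coordinates enter one at a time, and each step rotates two independent normal
    variables by an angle that depends on other, independent variables. Fubini and the invariance of
    the planar Gaussian law then suffice. The same planar rotations carry orthonormal vectors to
    coordinate vectors.

    The second-order term t^2 |Z|^2 of |Y + t Z|^2 is unbounded. Truncation at a level a with a^2 of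
    order 1/t makes it a small multiple of t, while the discarded tails, O(a^(-4)), are O(t^2).

    Normalising constants are never evaluated: total mass 1 determines them, and one recurrence by
    parts relates them to each other.

    The level has to be lowered because a supremum at least b over a dense sequence only guarantees
    that every b' < b is reached. The bound for a finite sample involves neither its size nor its
    mesh, which is what allows the limit. *)

Definition image_measure d1 d2 (T1 : measurableType d1) (T2 : measurableType d2)
    (R : realType) (m : {measure set T1 -> \bar R}) (f : T1 -> T2)
    (mf : measurable_fun setT f) : {measure set T2 -> \bar R} :=
  measure_function_pushforward__canonical__measure_function_Measure m mf.

(** * Rotation invariance of the Gaussian law *)

Section LebesgueAffine.
Context {R : realType}.
Notation leb := (@lebesgue_measure R).

Lemma measurable_affine (a c : R) :
  measurable_fun setT (fun x : R => a * x + c).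
Proof. by apply: measurable_funD => //; apply: measurable_funM. Qed.

(** [a] times the image of Lebesgue measure under the affine map gives every half-open interval its
    length, and these intervals determine Lebesgue measure; the rest is the change of variables for
    an image measure. *)
Lemma ge0_integral_affine (a c : R) (f : R -> \bar R) : 0 < a ->
  measurable_fun setT f -> (forall x, (0 <= f x)%E) ->
  (\int[leb]_x f (a * x + c)%R = (a^-1)%:E * \int[leb]_x f x)%E.
Proof.
move=> a0 mf f0.
have ai0 : 0 <= a^-1 by rewrite invr_ge0 ltW.
have ma : measurable_fun [set: measurableTypeR R] ((fun x => a * x + c) : measurableTypeR R -> measurableTypeR R).
  exact: measurable_affine.
rewrite -[LHS]/(\int[leb]_(x in (fun x : R => a * x + c)%R @^-1` setT) (f \o (fun x : R => a * x + c)%R) x)%E.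
rewrite -(ge0_integral_pushforward ma) //.
rewrite (_ : a^-1 = (NngNum ai0)%:num) //.
rewrite -ge0_integral_mscale //.
apply: eq_measure_integral => A mA _.
have E : a%:E != 0%E by rewrite eqe gt_eqF.
pose g : measurableTypeR R -> measurableTypeR R := fun x => a * x + c.
suff H : leb A = (a%:E * pushforward leb g A)%E.
  change (pushforward leb g A = ((a^-1)%:E * leb A)%E).
  by rewrite H muleA -EFinM mulVf ?gt_eqF // mul1e.
apply: (@lebesgue_measure_unique R (mscale (NngNum (ltW a0)) (image_measure leb ma))) => //= _ [[u v]] _ <-.
change (leb `]u, v]%classic = (a%:E * leb (g @^-1` `]u, v]%classic))%E).
rewrite (_ : g @^-1` _ = `]((u - c) / a)%R, ((v - c) / a)%R]%classic); last first.
  apply/seteqP; split => x; rewrite /g /= !in_itv /= ltr_pdivrMr // ler_pdivlMr // => /andP[h1 h2]; apply/andP; split; lra.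
rewrite !lebesgue_measure_itv/= !lte_fin ltr_pM2r ?invr_gt0// ltrD2r.
case: ifP => _; last by rewrite mule0.
rewrite -!EFinB -EFinM; congr EFin; field; lra.
Qed.

End LebesgueAffine.

Section Density.
Local Open Scope ereal_scope.
Context d (T : measurableType d) (R : realType).
Variables (mu nu : {measure set T -> \bar R}) (g : T -> R).
Hypotheses (g0 : forall x, (0 <= g x)%R) (mg : measurable_fun setT g).
Hypothesis nuE : forall A, measurable A -> nu A = \int[mu]_(x in A) (g x)%:E.

Import HBNNSimple.

(** The hypothesis [nuE] is the case of indicators; linearity extends it to simple functions and
    monotone convergence to [f]. *)
Lemma ge0_integral_density (f : T -> \bar R) :
  measurable_fun setT f -> (forall x, 0 <= f x) ->
  \int[nu]_x f x = \int[mu]_x (f x * (g x)%:E).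
Proof.
move=> mf f0.
have mE : measurable [set: T] by [].
have mgE : measurable_fun setT (EFin \o g) by exact/measurable_EFinP.
pose h := nnsfun_approx mE mf.
have -> : \int[nu]_x f x = lim (\int[nu]_x (EFin \o h n) x @[n --> \oo]).
  have fE x : setT x -> f x = lim ((EFin \o h n) x @[n --> \oo]).
    by move=> Ex; apply/esym/cvg_lim => //; exact: cvg_nnsfun_approx.
  under eq_integral => x /[!inE] /fE -> //.
  apply: monotone_convergence => //.
  - by move=> n; exact/measurable_EFinP.
  - by move=> n x Ex //=; rewrite lee_fin.
  - by move=> x Ex a b ab; rewrite lee_fin; exact/lefP/nd_nnsfun_approx.
have -> : \int[mu]_x (f x * (g x)%:E) =
    lim (\int[mu]_x ((h n x)%:E * (g x)%:E) @[n --> \oo]).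
  have fg x : setT x -> f x * (g x)%:E = lim ((h n x)%:E * (g x)%:E @[n --> \oo]).
    by move=> Ex; apply/esym/cvg_lim => //; apply: cvgeZr => //; exact: cvg_nnsfun_approx.
  under eq_integral => x /[!inE] /fg -> //.
  apply: monotone_convergence => [//| | |].
  - by move=> n; apply/emeasurable_funM => //; exact/measurable_EFinP.
  - by move=> n x Ex /=; rewrite mule_ge0 ?lee_fin.
  - by move=> x Ex a b ab/=; rewrite lee_wpmul2r ?lee_fin//; exact/lefP/nd_nnsfun_approx.
suff suf n : \int[nu]_x (EFin \o h n) x = \int[mu]_x ((h n x)%:E * (g x)%:E).
  by under eq_fun do rewrite suf.
transitivity (\int[nu]_x
   (\sum_(y \in range (h n)) (y * \1_(h n @^-1` [set y]) x)%:E)).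
  by apply: eq_integral => t tE; rewrite /= fimfunE -fsumEFin.
have indich m r : measurable_fun setT (fun x => (r * \1_(h m @^-1` [set r]) x)%:E).
  by apply: (measurable_comp measurableT) => //; exact: measurable_funM.
rewrite ge0_integral_fsum//; last by move=> m y Ey; exact: nnfun_muleindic_ge0.
transitivity (\int[mu]_x (\sum_(y \in range (h n))
    (y * \1_(h n @^-1` [set y]) x)%:E * (g x)%:E)); last first.
  under [RHS]eq_integral do rewrite fimfunE -fsumEFin //.
  apply: eq_integral => x _; rewrite ge0_mule_fsuml // => y; exact: nnfun_muleindic_ge0.
rewrite ge0_integral_fsum//; last 2 first.
  - by move=> y; apply: emeasurable_funM.
  - by move=> m y Ey; apply: mule_ge0; [exact: nnfun_muleindic_ge0|rewrite lee_fin].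
apply: eq_fsbigr => r rhn.
(* Negative values have an empty preimage; for the others the scalar may leave the integral. *)
have [r0|r0] := ltP r 0%R.
  have -> : h n @^-1` [set r] = set0.
    by apply/seteqP; split => // x /= hx; move: r0; rewrite -hx ltNge fun_ge0.
  rewrite !integral0_eq //.
    by move=> x _; rewrite indic0 mulr0 mul0e.
  by move=> x _; rewrite indic0 mulr0.
under eq_integral do rewrite EFinM.
rewrite ge0_integralZl //; last exact/measurable_EFinP/measurable_indic.
under [RHS]eq_integral do rewrite EFinM -muleA.
rewrite ge0_integralZl //; last 2 first.
- by apply: emeasurable_funM => //; exact/measurable_EFinP/measurable_indic.
- by move=> x _; rewrite mule_ge0 // lee_fin.
congr (_ * _).
rewrite integral_indic // setIT nuE //.
rewrite [LHS]integral_mkcond; apply: eq_integral => x _.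
by rewrite patchE indicE; case: ifP => _; rewrite ?mul1e ?mul0e.
Qed.

End Density.

Section Normal.
Context {R : realType}.
Notation leb := (@lebesgue_measure R).
Notation RR := (measurableTypeR R).
Notation phi := (normal_pdf (0 : R) 1).
Notation N01 := (normal_prob (0 : R) 1).

Lemma std_normal_pdfE (x : R) :
  phi x = (Num.sqrt (2 * pi))^-1 * expR (- x ^+ 2 / 2).
Proof.
rewrite normal_pdfE ?oner_eq0 // /normal_peak /normal_fun expr1n subr0.
by rewrite mul1r mulr_natl.
Qed.

Lemma ge0_integral_std_normal (f : R -> \bar R) :
  measurable_fun setT (f : RR -> \bar R) -> (forall x, (0 <= f x)%E) ->
  (\int[N01]_x f x = \int[leb]_x (f x * (phi x)%:E))%E.
Proof.
move=> mf f0; apply: ge0_integral_density => //.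
- by move=> x; exact: normal_pdf_ge0.
- exact: measurable_normal_pdf.
Qed.

Section shear.
Local Open Scope ereal_scope.
Implicit Type H : RR * RR -> \bar R.

Let leb2 H := \int[leb]_x \int[leb]_y H (x, y).

(** For fixed y the shear is a translation of x, which becomes the inner variable after Tonelli. *)
Lemma integral_shear_l (t : R) H : measurable_fun setT H -> (forall z, 0 <= H z) ->
  leb2 (fun z => H (z.1 + t * z.2, z.2)%R) = leb2 H.
Proof.
move=> mH H0; rewrite /leb2.
have mH' : measurable_fun setT (fun z : RR * RR => H (z.1 + t * z.2, z.2)%R).
  apply: measurableT_comp => //; apply: measurable_fun_pair => //.
  by apply: measurable_funD => //; apply: measurable_funM => //.
transitivity (\int[leb]_y \int[leb]_x H (x + t * y, y)%R).
  exact: (@fubini_tonelli _ _ RR RR R leb leb _ mH' (fun z => H0 _)).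
transitivity (\int[leb]_y \int[leb]_x H (x, y)); last first.
  exact/esym/(@fubini_tonelli _ _ RR RR R leb leb _ mH H0).
apply: eq_integral => y _.
transitivity (\int[leb]_x (fun x => H (x, y)) (1 * x + t * y)%R).
  by apply: eq_integral => x _; rewrite mul1r.
rewrite (@ge0_integral_affine R 1 (t * y)%R (fun x => H (x, y))) // ?invr1 ?mul1e //.
exact: measurableT_comp.
Qed.

Lemma integral_shear_r (t : R) H : measurable_fun setT H -> (forall z, 0 <= H z) ->
  leb2 (fun z => H (z.1, z.2 + t * z.1)%R) = leb2 H.
Proof.
move=> mH H0; rewrite /leb2.
apply: eq_integral => y _.
transitivity (\int[leb]_x (fun x => H (y, x)) (1 * x + t * y)%R).
  by apply: eq_integral => x _; rewrite mul1r.
rewrite (@ge0_integral_affine R 1 (t * y)%R (fun x => H (y, x))) // ?invr1 ?mul1e //.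
exact: measurableT_comp.
Qed.

(* A rotation is a product of three shears, each preserving Lebesgue measure. *)
Lemma integral_rotation (c s : R) H : (c ^+ 2 + s ^+ 2 = 1)%R -> c != (-1)%R ->
  measurable_fun setT H -> (forall z, 0 <= H z) ->
  leb2 (fun z => H (c * z.1 - s * z.2, s * z.1 + c * z.2)%R) = leb2 H.
Proof.
move=> cs c1 mH H0.
have c1' : (1 + c != 0)%R by apply: contra c1 => /eqP h; apply/eqP; lra.
(* For the angle theta with cosine [c] and sine [s] this is -tan(theta/2), the slope of the two
   horizontal shears around the vertical shear [s]; it blows up at the half-turn, which [c != -1]
   excludes. *)
pose t := (- (s / (1 + c)))%R.
have ts : (1 + s * t = c)%R.
  rewrite /t; apply: (mulIf c1'); rewrite mulrDl mul1r mulrN mulNr mulrA divfK //.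
  by rewrite -expr2; nra.
have tc : (t + c * t = - s)%R by rewrite /t; field.
pose H1 z := H (z.1 + t * z.2, z.2)%R.
pose H2 z := H1 (z.1, z.2 + s * z.1)%R.
have mH1 : measurable_fun setT H1.
  apply: measurableT_comp => //; apply: measurable_fun_pair => //.
  by apply: measurable_funD => //; apply: measurable_funM => //.
have mH2 : measurable_fun setT H2.
  apply: measurableT_comp => //; apply: measurable_fun_pair => //.
  by apply: measurable_funD => //; apply: measurable_funM => //.
transitivity (leb2 H1); last exact: (integral_shear_l t mH H0).
transitivity (leb2 H2); last by apply: (integral_shear_r s mH1) => z; exact: H0.
transitivity (leb2 (fun z => H2 (z.1 + t * z.2, z.2)%R)); last by apply: (integral_shear_l t mH2) => z; exact: H0.
congr (leb2 _); apply/funext => -[x y]; rewrite /H2 /H1 /=.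
have st1 : (s * t = c - 1)%R by rewrite -ts; ring.
have tc1 : (c * t = - s - t)%R by rewrite -tc; ring.
by congr (H (_, _)); ring: st1 tc1.
Qed.

Lemma std_normal2E (F : RR * RR -> \bar R) : measurable_fun setT F -> (forall z, 0 <= F z) ->
  \int[N01]_x \int[N01]_y F (x, y) =
  leb2 (fun z => F z * (phi z.1 * phi z.2)%:E).
Proof.
move=> mF F0.
have p0 (x : R) : 0 <= (phi x)%:E by rewrite lee_fin normal_pdf_ge0.
have mp : measurable_fun setT (EFin \o (phi : RR -> R)).
  by apply/measurable_EFinP; exact: measurable_normal_pdf.
have mFx (x : RR) : measurable_fun setT (fun y => F (x, y)) by exact: measurableT_comp.
have mG : measurable_fun setT (fun z : RR * RR => F z * (phi z.2)%:E).
  apply: emeasurable_funM => //; apply/measurable_EFinP.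
  by apply: measurableT_comp => //; exact: measurable_normal_pdf.
have G0 (z : RR * RR) : 0 <= F z * (phi z.2)%:E by exact: mule_ge0.
under eq_integral do rewrite ge0_integral_std_normal //.
rewrite ge0_integral_std_normal; last 2 first.
- exact: (measurable_fun_fubini_tonelli_F (m2 := leb) _ mG G0).
- by move=> x; apply: integral_ge0 => y _; rewrite mule_ge0.
apply: eq_integral => x _.
rewrite -ge0_integralZr //=; last exact: emeasurable_funM.
by apply: eq_integral => y _; rewrite -muleA -EFinM (mulrC (phi y)).
Qed.

(** The product density is a function of x^2 + y^2, so only the invariance of Lebesgue measure is at
    stake. *)
Lemma std_normal_rotation (c s : R) (F : RR * RR -> \bar R) :
  (c ^+ 2 + s ^+ 2 = 1)%R -> c != (-1)%R ->
  measurable_fun setT F -> (forall z, 0 <= F z) ->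
  \int[N01]_x \int[N01]_y F (c * x - s * y, s * x + c * y)%R =
  \int[N01]_x \int[N01]_y F (x, y).
Proof.
move=> cs c1 mF F0.
have mp2 : measurable_fun setT (fun z : RR * RR => (phi z.1 * phi z.2)%:E).
  apply/measurable_EFinP; apply: measurable_funM; apply: measurableT_comp => //; exact: measurable_normal_pdf.
have mrot : measurable_fun setT (fun z : RR * RR => (c * z.1 - s * z.2, s * z.1 + c * z.2)%R : RR * RR).
  apply: measurable_fun_pair.
  - by apply: measurable_funB; apply: measurable_funM.
  - by apply: measurable_funD; apply: measurable_funM.
apply: (etrans (std_normal2E (measurableT_comp mF mrot) (fun z => F0 _))).
apply: (etrans _ (esym (std_normal2E mF F0))).
have mG := emeasurable_funM mF mp2.
have G0 (z : RR * RR) : 0 <= F z * (phi z.1 * phi z.2)%:E.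
  by rewrite mule_ge0 // lee_fin mulr_ge0 // normal_pdf_ge0.
apply: (etrans _ (integral_rotation cs c1 mG G0)).
congr leb2; apply/funext => -[x y] /=; congr (_ * _%:E).
rewrite !std_normal_pdfE mulrACA [in RHS]mulrACA -!expRD; congr (_ * expR _)%R.
rewrite -!mulrDl; congr (_ / _)%R; rewrite -!opprD; congr (- _)%R.
have s2 : (s ^+ 2 = 1 - c ^+ 2)%R by rewrite -cs; ring.
by ring: s2.
Qed.

End shear.
End Normal.

(** * Product laws and independent coordinates *)

Lemma measurable_preimage d1 d2 (T1 : measurableType d1) (T2 : measurableType d2)
    (f : T1 -> T2) B : measurable_fun setT f -> measurable B -> measurable (f @^-1` B).
Proof. by move=> mf mB; rewrite -[X in measurable X]setTI; exact: mf. Qed.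

Lemma integral_indicT d1 (T1 : measurableType d1) (R : realType)
    (mu : {measure set T1 -> \bar R}) (A : set T1) : measurable A ->
  (\int[mu]_x (\1_A x)%:E = mu A)%E.
Proof. by move=> mA; rewrite integral_indic // setIT. Qed.

Section ProductProbability.
Local Open Scope ereal_scope.
Context d1 d2 (T1 : measurableType d1) (T2 : measurableType d2) (R : realType).
Variables (m1 : probability T1 R) (m2 : probability T2 R).

Let product_setT : (m1 \x m2) setT = 1.
Proof. by rewrite -setXTT product_measure1E //= [X in X * _]probability_setT [X in _ * X]probability_setT mule1. Qed.

HB.instance Definition _ :=
  Measure_isProbability.Build _ _ _ (m1 \x m2) product_setT.

Definition product_probability : probability (T1 * T2)%type R := m1 \x m2.

Lemma product_probabilityE C : measurable C ->
  product_probability C = \int[m1]_x \int[m2]_y (\1_C (x, y))%:E.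
Proof.
move=> mC; transitivity (\int[product_probability]_z (\1_C z)%:E).
  by rewrite integral_indic // setIT.
by rewrite indic_fubini_tonelli1.
Qed.

End ProductProbability.

Section JointLaw.
Local Open Scope ereal_scope.
Context d d1 d2 (T : measurableType d) (T1 : measurableType d1)
  (T2 : measurableType d2) (R : realType).
Variables (P : probability T R) (mu1 : probability T1 R) (mu2 : probability T2 R).
Variables (X : T -> T1) (Y : T -> T2) (D : set T).
Hypotheses (mX : measurable_fun setT X) (mY : measurable_fun setT Y) (mD : measurable D).
Hypothesis law_rect : forall A B, measurable A -> measurable B ->
  P (X @^-1` A `&` Y @^-1` B `&` D) = mu1 A * mu2 B * P D.

(** The event [D] carries the constraints on all other variables, so that one pair can be
    transformed while its independence of the rest is kept. It only rescales [mu1] to a finite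
    measure, and rectangles determine the product. *)
Lemma joint_law (C : set (T1 * T2)) : measurable C ->
  P ((fun w => (X w, Y w)) @^-1` C `&` D) =
  product_probability mu1 mu2 C * P D.
Proof.
move=> mC.
have mXY : measurable_fun setT (fun w => (X w, Y w)) by exact: measurable_fun_pair.
have PD : (0 <= fine (P D))%R by exact: fine_ge0.
have PDE : (fine (P D))%:E = P D by rewrite fineK // fin_num_measure.
pose nu := mscale (NngNum PD) mu1.
have H : (nu \x mu2) C = image_measure (mrestr P mD) mXY C.
  apply: product_measure_unique => // A B mA mB.
  change (P ((fun w => (X w, Y w)) @^-1` (A `*` B) `&` D) = (fine (P D))%:E * mu1 A * mu2 B).
  rewrite PDE -muleA muleC -law_rect //; congr (P (_ `&` D)).
change (image_measure (mrestr P mD) mXY C = product_probability mu1 mu2 C * P D).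
rewrite -H.
have -> : (nu \x mu2) C = \int[nu]_x (mu2 (xsection C x)) by [].
have mxs : measurable_fun setT (fun x => mu2 (xsection C x)).
  exact: measurable_fun_xsection.
transitivity (P D * \int[mu1]_x (mu2 (xsection C x))).
  rewrite -PDE; exact: (@ge0_integral_mscale _ _ _ mu1 _ measurableT (NngNum PD)).
by rewrite muleC.
Qed.

End JointLaw.

Section StdNormalVector.
Local Open Scope ereal_scope.
Context d (T : measurableType d) (R : realType) (P : probability T R).
Notation RR := (measurableTypeR R).
Notation N01 := (normal_prob (0 : R) 1).

Lemma measurable_box n (xi : T -> 'cV[R]_n) (B : 'I_n -> set R) :
  (forall i, measurable_fun setT (fun w => xi w i 0%R)) ->
  (forall i, measurable (B i)) ->
  measurable [set w | forall i, B i (xi w i 0%R)].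
Proof.
move=> mxi mB.
rewrite (_ : [set w | _] = \bigcap_(i in [set: 'I_n]) ((fun w => xi w i 0%R) @^-1` B i)); last first.
  by apply/seteqP; split => w /= h i; [move=> _|]; exact: h.
apply: fin_bigcap_measurable => //= i _.
exact: measurable_preimage.
Qed.

Definition rotate_pair n (i j : 'I_n) (c s : R) (u : 'cV[R]_n) : 'cV[R]_n :=
  (\col_a (if a == i then c * u i 0 + s * u j 0 else
           if a == j then - s * u i 0 + c * u j 0 else u a 0))%R.

Lemma std_normal2_rotation (c s : R) (A B : set R) :
  (c ^+ 2 + s ^+ 2 = 1)%R -> c != (-1)%R -> measurable A -> measurable B ->
  \int[N01]_x \int[N01]_y (\1_[set z : RR * RR | A (c * z.1 + s * z.2)%R /\
     B (- s * z.1 + c * z.2)%R] (x, y))%:E = N01 A * N01 B.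
Proof.
move=> cs c1 mA mB.
have mAB : measurable (A `*` B : set (RR * RR)) by exact: measurableX.
pose F (z : RR * RR) : \bar R := (\1_(A `*` B) z)%:E.
have mF : measurable_fun setT F by apply/measurable_EFinP; exact: measurable_indic.
have cs' : (c ^+ 2 + (- s) ^+ 2 = 1)%R by rewrite sqrrN.
transitivity (\int[N01]_x \int[N01]_y F (c * x - (- s) * y, - s * x + c * y)%R).
  apply: eq_integral => x _; apply: eq_integral => y _; rewrite /F; congr _%:E.
  have -> : (c * x - - s * y = c * x + s * y)%R by ring.
  by rewrite !indicE; congr (_ %:R); congr nat_of_bool; apply/idP/idP; rewrite !inE.
have F0 z : 0 <= F z by rewrite lee_fin.
rewrite (std_normal_rotation cs' c1 mF F0).
transitivity (product_probability N01 N01 (A `*` B)); first by rewrite product_probabilityE.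
exact: product_measure1E.
Qed.

Lemma std_normal_rotate_pair n (xi : T -> 'cV[R]_n) (i j : 'I_n) (c s : R) :
  i != j -> (c ^+ 2 + s ^+ 2 = 1)%R -> c != (-1)%R ->
  std_normal_vector P xi -> std_normal_vector P (fun w => rotate_pair i j c s (xi w)).
Proof.
move=> ij cs c1 [mxi lawxi]; have ji : j != i by rewrite eq_sym.
have mfun (a b : R) : measurable_fun setT (fun w => a * xi w i 0 + b * xi w j 0)%R.
  by apply: measurable_funD; apply: measurable_funM.
split=> [a|B mB].
  rewrite (_ : (fun w => _) = (fun w => if a == i then c * xi w i 0 + s * xi w j 0 else
           if a == j then - s * xi w i 0 + c * xi w j 0 else xi w a 0)%R); last first.
    by apply/funext => w; rewrite mxE.
  by case: (a == i) => //; case: (a == j).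
(* [B'] replaces the constraints at [i] and [j]; with [setT] at both, [D] concerns the other
   coordinates only, as [joint_law] requires. *)
pose B' A1 A2 (k : 'I_n) := if k == i then A1 else if k == j then A2 else B k.
have mB' A1 A2 : measurable A1 -> measurable A2 -> forall k, measurable (B' A1 A2 k).
  by move=> m1 m2 k; rewrite /B'; case: (k == i) => //; case: (k == j).
pose D := [set w | forall k, B' setT setT k (xi w k 0%R)].
have mD : measurable D by apply: (measurable_box mxi); apply: mB'.
pose q := \prod_(k | (k != i) && (k != j)) N01 (B k).
have prodB' A1 A2 : \prod_k N01 (B' A1 A2 k) = N01 A1 * N01 A2 * q.
  rewrite (bigD1 i) //= (bigD1 j) //=.
  rewrite /B' eqxx (negbTE ji) eqxx muleA; congr (_ * _).
  by apply: eq_bigr => k /andP[/negbTE -> /negbTE ->].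
have PD : P D = q.
  by rewrite /D lawxi ?prodB' ?probability_setT ?mul1e //; exact: mB'.
have rect A1 A2 : measurable A1 -> measurable A2 ->
    P ((fun w => xi w i 0%R) @^-1` A1 `&` (fun w => xi w j 0%R) @^-1` A2 `&` D) = N01 A1 * N01 A2 * P D.
  move=> m1 m2; rewrite PD -prodB' -lawxi; last exact: mB'.
  congr (P _); apply/seteqP; split => w /=.
    move=> [[h1 h2] h3] k; move: (h3 k); rewrite /B'.
    by case: eqP => [->//|_]; case: eqP => [->|].
  move=> h; split; first split.
  - by move: (h i); rewrite /B' eqxx.
  - by move: (h j); rewrite /B' (negbTE ji) eqxx.
  - by move=> k; move: (h k); rewrite /B'; case: eqP => // _; case: eqP.
pose C := [set z : RR * RR | B i (c * z.1 + s * z.2)%R /\ B j (- s * z.1 + c * z.2)%R].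
have mC : measurable C.
  have mf2 (a b : R) : measurable_fun setT (fun z : RR * RR => a * z.1 + b * z.2)%R.
    by apply: measurable_funD; apply: measurable_funM.
  by apply: measurableI; exact: (measurable_preimage (mf2 _ _) (mB _)).
have := joint_law (mu1 := N01) (mu2 := N01) (mxi i) (mxi j) mD rect mC.
rewrite product_probabilityE // std_normal2_rotation // PD.
have -> : \prod_(k < n) N01 (B k) = N01 (B i) * N01 (B j) * q.
  by rewrite -prodB'; apply: eq_bigr => k _; rewrite /B'; case: eqP => [->//|_]; case: eqP => [->|].
move=> <-; congr (P _); apply/seteqP; split => w /=.
- move=> h; split; first split.
  + by move: (h i); rewrite mxE eqxx.
  + by move: (h j); rewrite mxE (negbTE ji) eqxx.
  + move=> k; move: (h k); rewrite mxE /B'; case: eqP => // _; case: eqP => //.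
- move=> [[h1 h2] h3] k; move: (h3 k); rewrite mxE /B'.
  by case: eqP => [->//|_]; case: eqP => [->|].
Qed.

Lemma normal_prob_opp (A : set R) : measurable A ->
  N01 [set x | A (- x)%R] = N01 A.
Proof.
move=> mA.
have mA' : measurable [set x : RR | A (- x)%R].
  exact: (measurable_preimage (measurable_funN (@measurable_id _ RR setT)) mA).
have mphi : measurable_fun setT (fun x : RR => (normal_pdf (0 : R) 1 x)%:E).
  by apply/measurable_EFinP; exact: measurable_normal_pdf.
transitivity (\int[pushforward lebesgue_measure (-%R : RR -> RR)]_(x in A) (normal_pdf (0 : R) 1 x)%:E).
  have mopp : measurable_fun setT (-%R : RR -> RR).
    exact: (measurable_funN (@measurable_id _ RR setT)).
  apply: esym; apply: etrans.
    apply: (ge0_integral_pushforward mopp) => //.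
    - exact: measurable_funTS.
    - by move=> x _; rewrite lee_fin normal_pdf_ge0.
  apply: eq_integral => x _ /=; congr _%:E.
  by rewrite !std_normal_pdfE sqrrN.
by apply: eq_measure_integral => B mB _; exact: lebesgue_measureN.
Qed.

(** Serves the one case that the rotations leave: a vector already equal to minus a coordinate
    vector, since the half-turn is excluded. *)
Definition reflect_coord n (i : 'I_n) (u : 'cV[R]_n) : 'cV[R]_n :=
  (\col_a (if a == i then - u a 0 else u a 0))%R.

Lemma std_normal_reflect n (xi : T -> 'cV[R]_n) (i : 'I_n) :
  std_normal_vector P xi -> std_normal_vector P (fun w => reflect_coord i (xi w)).
Proof.
move=> [mxi lawxi]; split=> [a|B mB].
  rewrite (_ : (fun w => _) = (fun w => if a == i then - xi w a 0 else xi w a 0)%R); last first.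
    by apply/funext => w; rewrite mxE.
  by case: (a == i) => //; exact: measurable_funN.
pose B' k := if k == i then [set x | B k (- x)%R] else B k.
have mB' k : measurable (B' k).
  rewrite /B'; case: (k == i) => //.
  exact: (measurable_preimage (measurable_funN (@measurable_id _ RR setT)) (mB k)).
transitivity (P [set w | forall k, B' k (xi w k 0%R)]).
  congr (P _); apply/seteqP; split => w /= h k; move: (h k); rewrite mxE /B'; case: (k == i) => //.
rewrite lawxi //; apply: eq_bigr => k _; rewrite /B'; case: (k == i) => //.
exact: normal_prob_opp.
Qed.

End StdNormalVector.

(** * Orthogonal transformations of a Gaussian vector *)

Section GaussianIsometry.
Context d (T : measurableType d) (R : realType) (P : probability T R).

(** Both properties pass to compositions, so they are checked on the generators [rotate_pair] and
    [reflect_coord] only; quantifying over every [xi] is what lets the maps be chained. *)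
Definition gaussian_isometry n (g : 'cV[R]_n -> 'cV[R]_n) : Prop :=
  (forall u v, edot (g u) (g v) = edot u v) /\
  (forall xi : T -> 'cV[R]_n, std_normal_vector P xi ->
     std_normal_vector P (fun w => g (xi w))).

Lemma gaussian_isometry_comp n (g h : 'cV[R]_n -> 'cV[R]_n) :
  gaussian_isometry g -> gaussian_isometry h -> gaussian_isometry (g \o h).
Proof.
move=> [g1 g2] [h1 h2]; split; first by move=> u v /=; rewrite g1 h1.
by move=> xi hxi; apply: (g2 (fun w => h (xi w))); exact: h2.
Qed.

Lemma gaussian_isometry_id n : @gaussian_isometry n id.
Proof. by split. Qed.

Lemma gaussian_isometry_rotate n (i j : 'I_n) (c s : R) :
  i != j -> (c ^+ 2 + s ^+ 2 = 1)%R -> c != (-1)%R ->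
  gaussian_isometry (rotate_pair i j c s).
Proof.
move=> ij cs c1; split; last by move=> xi; exact: std_normal_rotate_pair.
have ji : j != i by rewrite eq_sym.
move=> u v; rewrite /edot (bigD1 i) //= (bigD1 j) //= [RHS](bigD1 i) //= [X in (_ = _ + X)%R](bigD1 j) //=.
rewrite !mxE !eqxx (negbTE ji) !addrA; congr (_ + _)%R.
  have s2 : (s ^+ 2 = 1 - c ^+ 2)%R by rewrite -cs; ring.
  by ring: s2.
by apply: eq_bigr => k /andP[/negbTE ki /negbTE kj]; rewrite !mxE ki kj.
Qed.

Lemma gaussian_isometry_reflect n (i : 'I_n) : gaussian_isometry (reflect_coord i).
Proof.
split; last by move=> xi; exact: std_normal_reflect.
by move=> u v; apply: eq_bigr => k _; rewrite !mxE; case: ifP => // _; rewrite mulrNN.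
Qed.

Lemma edot_delta n (u : 'cV[R]_n) (a : 'I_n) : edot u (delta_mx a 0%R) = u a 0%R.
Proof.
rewrite /edot (bigD1 a) //= mxE !eqxx mulr1 big1 ?addr0 // => k ka.
by rewrite mxE (negbTE ka) mulr0.
Qed.

(** Givens elimination, by induction on the number of nonzero coordinates of index above [i]: a
    rotation in the plane of [i] and [j] clears coordinate [j]. All maps used act on indices at
    least [i], hence fix the earlier coordinate vectors. *)
Lemma gaussian_isometry_to_delta n (i : 'I_n) (v : 'cV[R]_n) :
  edot v v = 1%R -> (forall a : 'I_n, (a < i)%N -> v a 0%R = 0%R) ->
  exists g : 'cV[R]_n -> 'cV[R]_n, [/\ gaussian_isometry g,
    forall a : 'I_n, (a < i)%N -> g (delta_mx a 0%R) = delta_mx a 0%R &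
    g v = delta_mx i 0%R].
Proof.
have [k] := ubnP #|[pred a : 'I_n | (i < a)%N && (v a 0%R != 0%R)]|.
elim: k v => // k IH v hk v1 v0.
have [[j /andP[ij vj]]|hno] := pselect (exists j : 'I_n, (i < j)%N && (v j 0%R != 0%R)).
  have ij' : i != j by apply: contraTneq ij => ->; rewrite ltnn.
  have ji' : j != i by rewrite eq_sym.
  pose r := Num.sqrt (v i 0 ^+ 2 + v j 0 ^+ 2).
  have r2 : (r ^+ 2 = v i 0 ^+ 2 + v j 0 ^+ 2)%R by rewrite sqr_sqrtr // addr_ge0 // sqr_ge0.
  have vj2 : (0 < v j 0 ^+ 2)%R by rewrite exprn_even_gt0.
  have r0 : (0 < r)%R by rewrite sqrtr_gt0 ltr_wpDl // sqr_ge0.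
  have rn0 : r != 0%R by rewrite gt_eqF.
  pose c := (v i 0 / r)%R; pose s := (v j 0 / r)%R.
  have cs : (c ^+ 2 + s ^+ 2 = 1)%R by rewrite !expr_div_n -mulrDl -r2 divff // expf_eq0.
  (* The sine is nonzero because [v j 0] is, so this is not the half-turn. *)
  have c1 : c != (-1)%R.
    have : (0 < s ^+ 2)%R by rewrite exprn_even_gt0 //= mulf_neq0 // invr_eq0.
    by apply: contraTneq => c1; move: cs; rewrite c1 sqrrN expr1n -leNgt; lra.
  have gr := gaussian_isometry_rotate ij' cs c1.
  pose v' := rotate_pair i j c s v.
  have v'j : (v' j 0 = 0)%R by rewrite mxE (negbTE ji') eqxx /c /s; field.
  have v'a a : a != i -> a != j -> (v' a 0 = v a 0)%R.
    by move=> ai aj; rewrite mxE (negbTE ai) (negbTE aj).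
  have [||a ai|g [g1 g2 g3]] := IH v'.
  - apply: leq_trans (_ : (#|[pred a : 'I_n | (i < a)%N && (v a 0%R != 0%R)]| <= k)%N) => //.
    apply: proper_card; apply/properP; split.
      apply/fintype.subsetP => a; rewrite !inE => /andP[ia]; rewrite ia /=.
      have ai : a != i by apply: contraTneq ia => ->; rewrite ltnn.
      by have [->|aj] := eqVneq a j; rewrite ?v'j ?eqxx // v'a.
    by exists j; rewrite !inE ij //= v'j eqxx.
  - by rewrite gr.1.
  - have nai : a != i by apply: contraTneq ai => ->; rewrite ltnn.
    have naj : a != j by apply: contraTneq (ltn_trans ai ij) => ->; rewrite ltnn.
    by rewrite v'a // v0.
  - exists (g \o rotate_pair i j c s); split => //; first exact: gaussian_isometry_comp.
    move=> a ai /=; rewrite -[RHS]g2 //; congr g.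
    have nai : a != i by apply: contraTneq ai => ->; rewrite ltnn.
    have naj : a != j by apply: contraTneq (ltn_trans ai ij) => ->; rewrite ltnn.
    apply/colP => b; rewrite !mxE !eqxx !andbT.
    rewrite ![_ == a]eq_sym (negbTE nai) (negbTE naj) !mulr0 addr0.
    by have [->|bi] := eqVneq b i; [rewrite (negbTE nai)|have [->|//] := eqVneq b j; rewrite (negbTE naj)].
have va a : a != i -> v a 0%R = 0%R.
  move=> ai; have [lt|gt|/val_inj eq] := ltngtP a i.
  - exact: v0.
  - by apply/eqP; apply/negPn/negP => va; apply: hno; exists a; rewrite gt va.
  - by rewrite eq eqxx in ai.
have vi2 : (v i 0 ^+ 2 = 1)%R.
  move: v1; rewrite /edot (bigD1 i) //= big1 ?addr0 // => a ai.
  by rewrite va // mulr0.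
have [vi|vi] : v i 0%R = 1%R \/ v i 0%R = (-1)%R.
  by move/eqP: vi2; rewrite sqrf_eq1 => /orP[] /eqP; [left|right].
- exists id; split; [exact: gaussian_isometry_id|by []|].
  apply/colP => b; rewrite !mxE eqxx andbT.
  by have [->//|bi] := eqVneq b i; rewrite va.
- exists (reflect_coord i); split; first exact: gaussian_isometry_reflect.
    move=> a ai; apply/colP => b; rewrite !mxE eqxx andbT.
    have [->|//] := eqVneq b i.
    by rewrite (_ : (i == a) = false) ?oppr0 //; apply: contraTF ai => /eqP ->; rewrite ltnn.
  apply/colP => b; rewrite !mxE eqxx andbT.
  by have [->|bi] := eqVneq b i; [rewrite vi opprK|rewrite va].
Qed.

(** One vector at a time: once the first [r] are coordinate vectors, orthogonality kills the
    coordinates below [r] of the image of the next one, and [gaussian_isometry_to_delta] leaves the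
    previous images in place. *)
Lemma gaussian_isometry_orthonormal n q (hq : (q <= n)%N) (v : 'I_q -> 'cV[R]_n) :
  (forall a b, edot (v a) (v b) = (a == b)%:R)%R ->
  exists g, gaussian_isometry g /\
    forall a, g (v a) = delta_mx (widen_ord hq a) 0%R.
Proof.
move=> vv.
suff : forall r, (r <= q)%N -> exists g, gaussian_isometry g /\
    forall a : 'I_q, (a < r)%N -> g (v a) = delta_mx (widen_ord hq a) 0%R.
  by move=> /(_ q (leqnn q))[g [g1 g2]]; exists g; split => // a; exact: g2.
elim=> [_|r IH rq]; first by exists id; split; [exact: gaussian_isometry_id|by []].
have [g [g1 g2]] := IH (ltnW rq).
pose o := Ordinal rq.
have [||h [h1 h2 h3]] := @gaussian_isometry_to_delta n (widen_ord hq o) (g (v o)).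
- by rewrite g1.1 vv eqxx.
- move=> a /= ar; have aq : (a < q)%N := ltn_trans ar rq.
  rewrite -edot_delta (_ : a = widen_ord hq (Ordinal aq)); last exact: val_inj.
  rewrite -g2 // g1.1 vv; case: eqP => // /(congr1 val) /= ra.
  by move: ar; rewrite -ra ltnn.
exists (h \o g); split; first exact: gaussian_isometry_comp.
move=> a; rewrite ltnS leq_eqVlt => /orP[/eqP ar|ar] /=.
  by rewrite (_ : a = o) //; exact: val_inj.
by rewrite g2 // h2.
Qed.

Lemma std_normal_orthonormal n q (hq : (q <= n)%N) (v : 'I_q -> 'cV[R]_n)
    (xi : T -> 'cV[R]_n) :
  (forall a b, edot (v a) (v b) = (a == b)%:R)%R ->
  std_normal_vector P xi ->
  std_normal_vector P (fun w => \col_a edot (xi w) (v a))%R.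
Proof.
move=> vv hxi; have [g [[g1 g2] g3]] := gaussian_isometry_orthonormal hq vv.
have [m law] := g2 _ hxi.
have E w a : edot (xi w) (v a) = g (xi w) (widen_ord hq a) 0%R.
  by rewrite -edot_delta -g3 g1.
split=> [a|B mB].
  rewrite (_ : (fun w => _) = (fun w => g (xi w) (widen_ord hq a) 0%R)) //.
  by apply/funext => w; rewrite mxE E.
(* Coordinates beyond the first [q] are left free and contribute factors 1. *)
pose B' (k : 'I_n) : set R := if insub (k : nat) is Some a then B a else setT.
have B'E a : B' (widen_ord hq a) = B a by rewrite /B' /= valK.
have mB' k : measurable (B' k) by rewrite /B'; case: insub.
transitivity (P [set w | forall k, B' k (g (xi w) k 0%R)]).
  congr (P _); apply/seteqP; split => w /= h k; last by rewrite mxE E -B'E.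
  rewrite /B'; case: insubP => // a _ ak.
  by move: (h a); rewrite mxE E; congr (B a (g _ _ _)); exact: val_inj.
rewrite law // (bigID (fun k : 'I_n => (k < q)%N)) /= [X in (_ * X)%E]big1 ?mule1.
  by rewrite (big_ord_narrow hq); apply: eq_bigr => a _; rewrite B'E.
move=> k kq; rewrite /B'; case: insubP => [a|_]; first by rewrite (negbTE kq).
exact: probability_setT.
Qed.

End GaussianIsometry.

Definition image_probability d1 d2 (T1 : measurableType d1) (T2 : measurableType d2)
    (R : realType) (P : probability T1 R) (f : T1 -> T2)
    (mf : measurable_fun setT f) : probability T2 R :=
  let f' : {mfun T1 >-> T2} := HB.pack f (isMeasurableFun.Build _ _ _ _ _ mf) in
  distribution P f'.

(** * Joint law of the squared norm S and of the normalised scalar product W *)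

Section Chain.
Context {R : realType}.
Notation RR := (measurableTypeR R).
Notation N01 := (normal_prob (0 : R) 1).

Lemma measurable_sqr : measurable_fun setT (fun y : RR => y ^+ 2 : RR).
Proof. exact: measurable_funX. Qed.

Lemma measurable_add_sqr : measurable_fun setT (fun z : RR * RR => z.1 + z.2 ^+ 2 : RR).
Proof. by apply: measurable_funD => //; apply: measurable_funX. Qed.

(* [sum_sqr_prob j] is the chi-square law with [j + 1] degrees of freedom. *)
Fixpoint sum_sqr_prob (j : nat) : probability RR R :=
  if j is j'.+1
  then image_probability (product_probability (sum_sqr_prob j') N01) measurable_add_sqr
  else image_probability N01 measurable_sqr.

(* Rotating (W, Z) by this angle gives (sqrt s W + y Z) / sqrt (s + y^2); outside
   the domain the angle is 0, so that rot_cos^2 + rot_sin^2 = 1 everywhere. *)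
Definition rot_cos (s y : R) : R :=
  if (0 <= s) && (0 < s + y ^+ 2) then Num.sqrt s * (s + y ^+ 2) `^ (- 2^-1) else 1.
Definition rot_sin (s y : R) : R :=
  if (0 <= s) && (0 < s + y ^+ 2) then y * (s + y ^+ 2) `^ (- 2^-1) else 0.

Lemma measurable_rot_cond : measurable_fun setT
  (fun z : RR * RR => (0 <= z.1) && (0 < z.1 + z.2 ^+ 2)).
Proof.
apply: measurable_and; first exact: measurable_fun_ler.
apply: measurable_fun_ltr => //; exact: measurable_add_sqr.
Qed.

Lemma measurable_rot_cos : measurable_fun setT (fun z : RR * RR => rot_cos z.1 z.2 : RR).
Proof.
apply: measurable_fun_ifT => //; first exact: measurable_rot_cond.
apply: measurable_funM.
  apply: measurableT_comp => //; apply: continuous_measurable_fun; exact: sqrt_continuous.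
apply: (measurableT_comp (measurable_powR _)); exact: measurable_add_sqr.
Qed.

Lemma measurable_rot_sin : measurable_fun setT (fun z : RR * RR => rot_sin z.1 z.2 : RR).
Proof.
apply: measurable_fun_ifT => //; first exact: measurable_rot_cond.
apply: measurable_funM => //.
apply: (measurableT_comp (measurable_powR _)); exact: measurable_add_sqr.
Qed.

Lemma rot_cos_sin (s y : R) : rot_cos s y ^+ 2 + rot_sin s y ^+ 2 = 1.
Proof.
rewrite /rot_cos /rot_sin; case: ifP => [/andP[s0 u0]|_]; last by rewrite expr1n expr0n addr0.
rewrite powRN powR12_sqrt ?ltW //.
rewrite [X in X + _]exprMn [X in _ + X]exprMn -mulrDl sqr_sqrtr // exprVn sqr_sqrtr ?ltW //.
by rewrite divff // gt_eqF.
Qed.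

Lemma rot_cos_ge0 (s y : R) : 0 <= rot_cos s y.
Proof. by rewrite /rot_cos; case: ifP => // _; rewrite mulr_ge0 ?powR_ge0. Qed.

(** Induction step of [chain_normalE]. Where [s + y ^+ 2] vanishes, so do [s] and [y], and both
    sides are 0 whatever the angle. *)
Lemma sqrt_rot (s y w z : R) : 0 <= s ->
  Num.sqrt (s + y ^+ 2) * (rot_cos s y * w + rot_sin s y * z) = Num.sqrt s * w + y * z.
Proof.
move=> s0; rewrite /rot_cos /rot_sin s0 /=; case: ltP => [u0|u0].
  rewrite powRN powR12_sqrt ?ltW //; field.
  by rewrite gt_eqF // sqrtr_gt0.
have y2 := sqr_ge0 y.
have [-> /eqP] : s = 0 /\ y ^+ 2 = 0 by lra.
by rewrite sqrf_eq0 => /eqP ->; rewrite expr0n addr0 sqrtr0 !mul0r addr0.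
Qed.


Section ChainStep.
Local Open Scope ereal_scope.
Context d (T : measurableType d) (P : probability T R) (mu : probability RR R).
Variables (S W Y Z : T -> RR) (D : set T).
Hypotheses (mS : measurable_fun setT S) (mW : measurable_fun setT W)
  (mY : measurable_fun setT Y) (mZ : measurable_fun setT Z) (mD : measurable D).
Hypothesis law4 : forall A B A' B', measurable A -> measurable B ->
  measurable A' -> measurable B' ->
  P ([set w | [/\ A (S w), B (W w), A' (Y w) & B' (Z w)]] `&` D) =
  mu A * N01 B * (N01 A' * N01 B') * P D.

Let muN := product_probability mu N01.
Let NN := product_probability N01 N01.

(** The independence of four variables is assembled from pairs: here (S, Y), with W and Z frozen in
    the event; in [law_SYWZ] the pair (W, Z), with (S, Y) frozen. *)
Let law_SY B B' : measurable B -> measurable B' -> forall C, measurable C ->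
  P ((fun w => (S w, Y w)) @^-1` C `&` (W @^-1` B `&` Z @^-1` B' `&` D)) =
  muN C * (N01 B * N01 B' * P D).
Proof.
move=> mB mB' C mC.
have PD1 : P (W @^-1` B `&` Z @^-1` B' `&` D) = N01 B * N01 B' * P D.
  have := law4 measurableT mB measurableT mB'.
  rewrite !probability_setT !mul1e => <-; congr (P (_ `&` _)).
  by apply/seteqP; split => w /= => [[]|[]].
rewrite -PD1; apply: joint_law => //.
  apply: measurableI => //; apply: measurableI; exact: measurable_preimage.
move=> A A' mA mA'; rewrite PD1.
transitivity (mu A * N01 B * (N01 A' * N01 B') * P D).
  rewrite -law4 //; congr (P _).
  by apply/seteqP; split => w /= => [[[h1 h2] [[h3 h4] h5]]|[[h1 h2 h3 h4] h5]].
by rewrite !muleA; congr (_ * P D); rewrite -!muleA; congr (_ * _); rewrite muleCA.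
Qed.

Let law_SYWZ C : measurable C ->
  P ((fun w => ((S w, Y w), (W w, Z w))) @^-1` C `&` D) =
  product_probability muN NN C * P D.
Proof.
move=> mC; apply: joint_law => //; try exact: measurable_fun_pair.
move=> C1 C2 mC1 mC2.
have PD2 : P ((fun w => (S w, Y w)) @^-1` C1 `&` D) = muN C1 * P D.
  have := law_SY measurableT measurableT mC1.
  by rewrite !probability_setT !mul1e !preimage_setT !setTI.
have := @joint_law _ _ _ T RR RR R P N01 N01 W Z ((fun w => (S w, Y w)) @^-1` C1 `&` D) mW mZ.
rewrite PD2 => /(_ _ _ C2 mC2) H.
rewrite [in RHS]muleAC [in RHS]muleC -/NN.
transitivity (P ((fun w => (W w, Z w)) @^-1` C2 `&` ((fun w => (S w, Y w)) @^-1` C1 `&` D))).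
  by congr (P _); rewrite setIA; congr (_ `&` _); rewrite setIC.
rewrite H //.
  apply: measurableI => //; apply: measurable_preimage => //; exact: measurable_fun_pair.
move=> B B' mB mB'.
transitivity (muN C1 * (N01 B * N01 B' * P D)); last by rewrite muleCA.
rewrite -law_SY //; congr (P _).
by apply/seteqP; split => w /=; tauto.
Qed.

(** For fixed (S, Y) the new variable is one coordinate of a rotated pair of independent normals,
    hence standard normal whatever the angle; the inner integral is a constant and leaves the
    integral over (S, Y). *)
Lemma chain_step A B : measurable A -> measurable B ->
  P ([set w | A (S w + Y w ^+ 2)%R /\
              B (rot_cos (S w) (Y w) * W w + rot_sin (S w) (Y w) * Z w)%R] `&` D) =
  muN ((fun z => z.1 + z.2 ^+ 2)%R @^-1` A) * N01 B * P D.
Proof.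
move=> mA mB.
pose C := [set z : (RR * RR) * (RR * RR) | A (z.1.1 + z.1.2 ^+ 2)%R /\
  B (rot_cos z.1.1 z.1.2 * z.2.1 + rot_sin z.1.1 z.1.2 * z.2.2)%R].
have mA2 : measurable ((fun z : RR * RR => z.1 + z.2 ^+ 2 : RR)%R @^-1` A).
  by apply: measurable_preimage => //; exact: measurable_add_sqr.
have mC : measurable C.
  apply: measurableI.
    exact: (measurable_preimage (measurable_fst : measurable_fun setT (@fst (RR * RR) (RR * RR))) mA2).
  have mf : measurable_fun setT (fun z : (RR * RR) * (RR * RR) =>
     rot_cos z.1.1 z.1.2 * z.2.1 + rot_sin z.1.1 z.1.2 * z.2.2 : RR)%R.
    apply: measurable_funD; apply: measurable_funM.
    - exact: (measurableT_comp measurable_rot_cos).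
    - exact: measurableT_comp.
    - exact: (measurableT_comp measurable_rot_sin).
    - exact: measurableT_comp.
  exact: (measurable_preimage mf mB).
transitivity (P ((fun w => ((S w, Y w), (W w, Z w))) @^-1` C `&` D)) => //.
rewrite law_SYWZ // product_probabilityE //; congr (_ * _).
transitivity (\int[muN]_x ((\1_((fun z : RR * RR => z.1 + z.2 ^+ 2)%R @^-1` A) x)%:E * N01 B)); last first.
  rewrite ge0_integralZr //; last exact/measurable_EFinP/measurable_indic.
  by congr (_ * _); exact: integral_indicT.
apply: eq_integral => -[s y] _.
have [As|nAs] := pselect (A (s + y ^+ 2)%R); last first.
  rewrite indicE memNset // mul0e integral0_eq // => z _.
  by rewrite indicE memNset // => -[].
rewrite indicE mem_set // mul1e.
transitivity (\int[NN]_z (\1_[set z : RR * RR | B (rot_cos s y * z.1 + rot_sin s y * z.2)%R /\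
    setT (- rot_sin s y * z.1 + rot_cos s y * z.2)%R] z)%:E).
  apply: eq_integral => z _; congr _%:E; rewrite !indicE; congr (_ %:R); congr nat_of_bool.
  by apply/idP/idP; rewrite !inE /C /= => -[].
have mf2 (a b : R) : measurable_fun setT (fun z : RR * RR => a * z.1 + b * z.2 : RR)%R.
  by apply: measurable_funD; apply: measurable_funM.
have mE : measurable [set z : RR * RR | B (rot_cos s y * z.1 + rot_sin s y * z.2)%R /\
    setT (- rot_sin s y * z.1 + rot_cos s y * z.2)%R].
  by apply: measurableI; exact: (measurable_preimage (mf2 _ _)).
apply: (etrans (integral_indicT _ mE)); apply: (etrans (product_probabilityE N01 N01 mE)).
rewrite std_normal2_rotation //.
- by rewrite probability_setT mule1.
- exact: rot_cos_sin.
- by rewrite gt_eqF // (lt_le_trans _ (rot_cos_ge0 s y)) // oppr_lt0.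
Qed.


End ChainStep.
End Chain.

Section ChainLaw.
Local Open Scope ereal_scope.
Context d (T : measurableType d) (R : realType) (P : probability T R).
Notation RR := (measurableTypeR R).
Notation N01 := (normal_prob (0 : R) 1).
Variables (m : nat) (Y Z : nat -> T -> RR).
Hypotheses (mY : forall i, measurable_fun setT (Y i))
  (mZ : forall i, measurable_fun setT (Z i)).
Hypothesis iid : forall A B : nat -> set RR, (forall i, measurable (A i)) ->
  (forall i, measurable (B i)) ->
  P [set w | forall i, (i < m)%N -> A i (Y i w) /\ B i (Z i w)] =
  \prod_(0 <= i < m) (N01 (A i) * N01 (B i)).

Let S j w : RR := (\sum_(i < j.+1) Y i w ^+ 2)%R.

(** The variable W = sum Y_i Z_i / sqrt (sum Y_i^2) over the indices up to [j]. The recursion keeps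
    it exactly normal and gives it a value where all the Y_i vanish; for [j = 0] it is Z_0 with the
    sign of Y_0. *)
Fixpoint chain_normal (j : nat) (w : T) : RR :=
  if j is j'.+1 then
    (rot_cos (S j' w) (Y j w) * chain_normal j' w + rot_sin (S j' w) (Y j w) * Z j w)%R
  else if (Y 0 w < 0)%R then (- Z 0 w)%R else Z 0 w.

Lemma chain_normalE j w :
  (Num.sqrt (\sum_(i < j.+1) Y i w ^+ 2) * chain_normal j w =
   \sum_(i < j.+1) Y i w * Z i w)%R.
Proof.
elim: j => [|j IH] /=.
  rewrite !big_ord_recl !big_ord0 !addr0 /= sqrtr_sqr.
  by case: ltP => Y0; [rewrite ltr0_norm // mulrNN|rewrite ger0_norm].
rewrite big_ord_recr [RHS]big_ord_recr /= sqrt_rot ?IH //.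
by apply: sumr_ge0 => i _; exact: sqr_ge0.
Qed.

Lemma measurable_sum_sqr j : measurable_fun setT (S j).
Proof. by apply: measurable_sum => i; apply: measurable_funX; exact: mY. Qed.

Lemma measurable_chain_normal j : measurable_fun setT (chain_normal j).
Proof.
elim: j => [|j IH] /=.
  apply: measurable_fun_ifT; [|apply: measurable_funN|]; try exact: mZ.
  by apply: measurable_fun_ltr => //; exact: mY.
have mSY : measurable_fun setT (fun w => (S j w, Y j.+1 w)) by apply: measurable_fun_pair; [exact: measurable_sum_sqr|exact: mY].
apply: measurable_funD; apply: measurable_funM => //; try exact: mZ.
- exact: (measurableT_comp measurable_rot_cos mSY).
- exact: (measurableT_comp measurable_rot_sin mSY).
Qed.

Let tail (j : nat) (A B : nat -> set RR) :=
  [set w | forall i, (j < i < m)%N -> A i (Y i w) /\ B i (Z i w)].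

Let mtail j A B : (forall i, measurable (A i)) -> (forall i, measurable (B i)) ->
  measurable (tail j A B).
Proof.
move=> mA mB.
rewrite (_ : tail j A B =
    \bigcap_i (if (j < i < m)%N then Y i @^-1` A i `&` Z i @^-1` B i else setT)); last first.
  apply/seteqP; split => w /= h i; first by move=> _; case: ifP => //; exact: h.
  by move=> im; move: (h i I); rewrite im.
apply: bigcapT_measurable => i; case: ifP => // _.
by apply: measurableI; apply: measurable_preimage.
Qed.

(** The rectangle on the pairs beyond [j] strengthens the induction: it supplies the independence of
    the next pair. For [j = m - 1] it is no constraint. *)
Lemma chain_law j (A B : set RR) (A_ B_ : nat -> set RR) : (j < m)%N ->
  measurable A -> measurable B ->
  (forall i, measurable (A_ i)) -> (forall i, measurable (B_ i)) ->
  P ([set w | A (S j w) /\ B (chain_normal j w)] `&` tail j A_ B_) =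
  sum_sqr_prob j A * N01 B * \prod_(j.+1 <= i < m) (N01 (A_ i) * N01 (B_ i)).
Proof.
move=> jm mA mB mA_ mB_.
elim: j A B A_ B_ jm mA mB mA_ mB_ => [|j IH] A B A_ B_ jm mA mB mA_ mB_.
  pose f (A0 : set RR) (A_ : nat -> set RR) i := if i == 0%N then A0 else A_ i.
  have mf A0 A1 : measurable A0 -> (forall i, measurable (A1 i)) -> forall i, measurable (f A0 A1 i).
    by move=> ? ? i; rewrite /f; case: eqP.
  have rect A0 B0 : measurable A0 -> measurable B0 ->
      P (Y 0%N @^-1` A0 `&` Z 0%N @^-1` B0 `&` tail 0 A_ B_) =
      N01 A0 * N01 B0 * \prod_(1 <= i < m) (N01 (A_ i) * N01 (B_ i)).
    move=> mA0 mB0.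
    transitivity (P [set w | forall i, (i < m)%N -> f A0 A_ i (Y i w) /\ f B0 B_ i (Z i w)]).
      congr (P _); apply/seteqP; split => w /=.
        by move=> [[h1 h2] h3] [|i] im //; exact: h3.
      move=> h; split; first exact: (h 0%N jm).
      by move=> [|i] // /andP[_ im]; exact: (h i.+1).
    rewrite iid; [|exact: mf|exact: mf].
    by rewrite big_ltn // (@eq_big_nat _ _ _ 1 m _ (fun i => N01 (A_ i) * N01 (B_ i))) // => -[].
  have PD : P (tail 0 A_ B_) = \prod_(1 <= i < m) (N01 (A_ i) * N01 (B_ i)).
    have := rect setT setT measurableT measurableT.
    by rewrite !preimage_setT !setTI !probability_setT !mul1e.
  pose C := [set z : RR * RR | A (z.1 ^+ 2)%R /\ B (if (z.1 < 0)%R then - z.2 else z.2)%R].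
  have mC : measurable C.
    apply: measurableI.
      exact: (measurable_preimage (measurableT_comp measurable_sqr measurable_fst) mA).
    have mg : measurable_fun setT (fun z : RR * RR => if (z.1 < 0)%R then - z.2 else z.2 : RR)%R.
      apply: measurable_fun_ifT => //; last by apply: measurable_funN.
      by apply: measurable_fun_ltr.
    exact: (measurable_preimage mg mB).
  have rect' A0 B0 : measurable A0 -> measurable B0 ->
      P (Y 0%N @^-1` A0 `&` Z 0%N @^-1` B0 `&` tail 0 A_ B_) =
      N01 A0 * N01 B0 * P (tail 0 A_ B_).
    by move=> mA0 mB0; rewrite rect // PD.
  rewrite -PD; transitivity (P ((fun w => (Y 0%N w, Z 0%N w)) @^-1` C `&` tail 0 A_ B_)).
    by congr (P (_ `&` _)); apply/seteqP; split => w; rewrite /S /C /= big_ord1.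
  apply: etrans.
    exact: (joint_law (mu1 := N01) (mu2 := N01) (mY 0%N) (mZ 0%N) (mtail 0%N mA_ mB_) rect' mC).
  congr (_ * _); apply: (etrans (product_probabilityE N01 N01 mC)).
  have mA2 := measurable_preimage measurable_sqr mA.
  transitivity (\int[N01]_x ((\1_((fun z : RR => z ^+ 2)%R @^-1` A) x)%:E * N01 B)); last first.
    rewrite ge0_integralZr //; last exact/measurable_EFinP/measurable_indic.
    by congr (_ * _); exact: integral_indicT.
  apply: eq_integral => y _.
  have [Ay|nAy] := pselect (A (y ^+ 2)%R); last first.
    rewrite indicE memNset // mul0e integral0_eq // => z _.
    by rewrite indicE memNset // => -[].
  rewrite indicE mem_set // mul1e.
  (* For fixed Y_0 the variable is Z_0 or its opposite, with the same law by symmetry. *)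
  case: (ltP y 0%R) => y0.
    have mBN := measurable_preimage (measurable_funN (@measurable_id _ RR setT)) mB.
    rewrite -(normal_prob_opp mB) -(integral_indicT N01 mBN).
    apply: eq_integral => z _; congr _%:E; rewrite !indicE; congr (_ %:R); congr nat_of_bool.
    by apply/idP/idP; rewrite !inE /C /= y0 // => -[].
  rewrite -(integral_indicT N01 mB).
  apply: eq_integral => z _; congr _%:E; rewrite !indicE; congr (_ %:R); congr nat_of_bool.
  by apply/idP/idP; rewrite !inE /C /= ltNge y0 // => -[].
(* A set inserted at index [j + 1] turns the tail after [j] into the pair [j + 1] followed by the
   tail after [j + 1]. *)
pose f (A0 : set RR) (A_ : nat -> set RR) i := if i == j.+1 then A0 else A_ i.
have mf A0 A1 : measurable A0 -> (forall i, measurable (A1 i)) -> forall i, measurable (f A0 A1 i).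
  by move=> ? ? i; rewrite /f; case: eqP.
have law4 A0 B0 A' B' : measurable A0 -> measurable B0 -> measurable A' -> measurable B' ->
    P ([set w | [/\ A0 (S j w), B0 (chain_normal j w), A' (Y j.+1 w) & B' (Z j.+1 w)]] `&` tail j.+1 A_ B_) =
    sum_sqr_prob j A0 * N01 B0 * (N01 A' * N01 B') * \prod_(j.+2 <= i < m) (N01 (A_ i) * N01 (B_ i)).
  move=> mA0 mB0 mA' mB'.
  transitivity (P ([set w | A0 (S j w) /\ B0 (chain_normal j w)] `&` tail j (f A' A_) (f B' B_))).
    congr (P _); apply/seteqP; split => w /=.
      move=> [[h1 h2 h3 h4] h5]; split => // i /andP[ji im]; rewrite /f.
      case: eqP => [->//|/eqP ij]; apply: h5.
      by rewrite im andbT ltn_neqAle eq_sym ij.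
    move=> [[h1 h2] h3]; split.
      by have := h3 j.+1; rewrite /f eqxx jm ltnSn => /(_ isT)[].
    move=> i /andP[ji im]; have := h3 i; rewrite /f (ltn_trans _ ji) // im => /(_ isT).
    by rewrite (gtn_eqF ji).
  rewrite IH //; [|exact: ltnW|exact: mf|exact: mf].
  rewrite big_ltn // (@eq_big_nat _ _ _ j.+2 m _ (fun i => N01 (A_ i) * N01 (B_ i))); last first.
    by move=> i /andP[ji _]; rewrite /f (gtn_eqF ji).
  by rewrite /f eqxx !muleA.
have PD : P (tail j.+1 A_ B_) = \prod_(j.+2 <= i < m) (N01 (A_ i) * N01 (B_ i)).
  have mT := @measurableT _ RR; have := law4 _ _ _ _ mT mT mT mT.
  rewrite !probability_setT !mul1e => H; rewrite -H; congr (P _).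
  by apply/seteqP; split => w /=; [move=> h; split|move=> [_ h]].
rewrite -PD -(@chain_step R _ T P (sum_sqr_prob j) (S j) (chain_normal j) (Y j.+1) (Z j.+1)) //.
- have SE w : S j.+1 w = (S j w + Y j.+1 w ^+ 2)%R by rewrite /S big_ord_recr.
  by congr (P (_ `&` _)); apply/funext => w /=; rewrite SE.
- exact: measurable_sum_sqr.
- exact: measurable_chain_normal.
- exact: mtail.
- by move=> A0 B0 A' B' mA0 mB0 mA' mB'; rewrite law4 // PD.
Qed.

End ChainLaw.

(** * The chi-square density *)

Section Chi2Density.
Context {R : realType}.
Notation RR := (measurableTypeR R).
Notation leb := (@lebesgue_measure R).
Notation N01 := (normal_prob (0 : R) 1).
Notation phi := (normal_pdf (0 : R) 1).

(** The chi-square density without its constant, which is recovered from the total mass. *)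
Definition chi2_kernel (m : nat) (x : R) : R :=
  if 0 < x then x `^ (m%:R / 2 - 1) * expR (- x / 2) else 0.

Lemma chi2_kernel_ge0 m x : 0 <= chi2_kernel m x.
Proof. by rewrite /chi2_kernel; case: ifP => // _; rewrite mulr_ge0 ?powR_ge0 ?expR_ge0. Qed.

Lemma measurable_chi2_kernel m : measurable_fun setT (chi2_kernel m : RR -> RR).
Proof.
apply: measurable_fun_ifT => //; first exact: measurable_fun_ltr.
apply: measurable_funM; first exact: measurable_powR.
by apply: (measurableT_comp (@measurable_expR R)); apply: measurable_funM => //; exact: measurable_funN.
Qed.

(** The constant [c] is extended real because it arises as an integral not known to be finite; total
    mass 1 excludes both 0 and +oo. *)
Lemma probability_density_scale (mu : probability RR R) (g : R -> R) (c : \bar R) :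
  (0 <= c)%E -> (forall x, 0 <= g x) -> measurable_fun setT (g : RR -> RR) ->
  (forall A, measurable A -> mu A = (c * \int[leb]_(x in A) (g x)%:E)%E) ->
  exists2 C : R, 0 < C &
    forall A, measurable A -> mu A = (\int[leb]_(x in A) (C * g x)%:E)%E.
Proof.
move=> c0 g0 mg H.
have := H _ measurableT; rewrite probability_setT.
have I0 : (0 <= \int[leb]_x (g x)%:E)%E by apply: integral_ge0 => x _; rewrite lee_fin.
case: c c0 H => [c| |//] c0 H e.
  exists c.
    rewrite lt_neqAle eq_sym; apply/andP; split; last by rewrite -lee_fin.
    by apply/eqP => c00; move: e; rewrite c00 mul0e => /eqP; rewrite eqe oner_eq0.
  move=> A mA; rewrite H // -ge0_integralZl //.
    by apply/measurable_EFinP; exact: measurable_funTS.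
  by move=> x _; rewrite lee_fin.
move: e I0; case: (\int[leb]_x (g x)%:E)%E => [r| |//].
  rewrite lee_fin le_eqVlt => e /orP[/eqP r0|r0].
    by move: e; rewrite -r0 mule0 => /eqP; rewrite eqe oner_eq0.
  by move: e; rewrite gt0_mulye ?lte_fin.
by rewrite mulyy.
Qed.

Definition sqnorm (z : RR * RR) : RR := z.1 ^+ 2 + z.2 ^+ 2.

Lemma measurable_sqnorm : measurable_fun setT sqnorm.
Proof. by apply: measurable_funD; apply: measurable_funX. Qed.

Definition disc_area (t : R) : \bar R :=
  (\int[leb]_x \int[leb]_y (\1_[set z | sqnorm z <= t] (x, y))%:E)%E.

Lemma measurable_disc t : measurable [set z | sqnorm z <= t].
Proof.
rewrite (_ : [set z | _] = sqnorm @^-1` `]-oo, t]); last by apply/seteqP; split => z /=; rewrite in_itv.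
exact: (measurable_preimage measurable_sqnorm).
Qed.

Lemma disc_area_scale (t : R) : 0 < t -> disc_area t = (t%:E * disc_area 1)%E.
Proof.
move=> t0.
pose s : R := Num.sqrt t; have s0 : 0 < s by rewrite sqrtr_gt0.
have st : s ^+ 2 = t by rewrite sqr_sqrtr // ltW.
have sn0 : s != 0 by rewrite gt_eqF.
pose F (z : RR * RR) : \bar R := (\1_[set z | sqnorm z <= t] z)%:E.
have mF : measurable_fun setT F.
  apply/measurable_EFinP/measurable_indic; exact: measurable_disc.
have F0 z : (0 <= F z)%E by rewrite lee_fin.
have E1 : disc_area 1 = (\int[leb]_x \int[leb]_y F (s * x + 0, s * y + 0)%R)%E.
  apply: eq_integral => x _; apply: eq_integral => y _; congr _%:E.
  rewrite !indicE; congr (_ %:R); congr nat_of_bool.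
  have E : sqnorm (s * x + 0, s * y + 0) = t * sqnorm (x, y).
    by rewrite /sqnorm /= !addr0 !exprMn st mulrDr.
  by apply/idP/idP; rewrite !inE /= E -[X in _ * _ <= X]mulr1 ler_pM2l.
rewrite E1.
pose G (x : RR) := (\int[leb]_y F (x, y))%E.
have mG : measurable_fun setT G.
  exact: (measurable_fun_fubini_tonelli_F (m2 := leb) _ mF F0).
have G0 x : (0 <= G x)%E by exact: integral_ge0.
have si0 : 0 <= s^-1 by rewrite invr_ge0 ltW.
pose H (x : RR) := ((s^-1)%:E * G x)%E.
have mH : measurable_fun setT H by exact: emeasurable_funM.
have H0 x : (0 <= H x)%E by rewrite mule_ge0.
transitivity (t%:E * \int[leb]_x H (s * x + 0)%R)%E; last first.
  congr (_ * _)%E; apply: eq_integral => x _; apply/esym.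
  apply: (ge0_integral_affine (f := fun y => F (s * x + 0, y)) 0 s0) => //.
  exact: measurableT_comp.
have HE : (\int[leb]_x H x = (s^-1)%:E * \int[leb]_x G x)%E by exact: ge0_integralZl.
rewrite (ge0_integral_affine 0 s0 mH H0) HE.
have K : t * s^-1 * s^-1 = 1 by rewrite -[in LHS]st; field.
change (\int[leb]_x G x = t%:E * ((s^-1)%:E * ((s^-1)%:E * \int[leb]_x G x)))%E.
move: (\int[leb]_x G x)%E => I0.
have K' : (t%:E * (s^-1)%:E * (s^-1)%:E = 1)%E by rewrite -K !EFinM.
by rewrite muleA muleA K' mul1e.
Qed.

(** The disc lies in the square of side 2. *)
Lemma disc_area1_fin : disc_area 1 \is a fin_num.
Proof.
rewrite ge0_fin_numE; last by apply: integral_ge0 => x _; apply: integral_ge0 => y _; rewrite lee_fin.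
have L : leb `[-1, 1] = 2%:E.
  rewrite lebesgue_measure_itv /= lte_fin ifT; last by lra.
  by rewrite -EFinB opprK (_ : 1 + 1 = 2).
have I1 : (\int[leb]_y (\1_(`[(-1)%R, 1%R] : set R) y)%:E = 2%:E)%E.
  by apply: (etrans (integral_indicT leb _)).
pose F (z : RR * RR) : \bar R := (\1_[set z | sqnorm z <= 1] z)%:E.
have mF : measurable_fun setT F.
  apply/measurable_EFinP/measurable_indic; exact: measurable_disc.
have F0 z : (0 <= F z)%E by rewrite lee_fin.
apply: (@le_lt_trans _ _ (\int[leb]_x ((\1_`[-1, 1] x)%:E * 2%:E))%E).
  apply: ge0_le_integral => //.
  - by move=> x _; apply: integral_ge0 => y _; rewrite lee_fin.
  - exact: (measurable_fun_fubini_tonelli_F (m2 := leb) _ mF F0).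
  - by apply: emeasurable_funM => //; apply/measurable_EFinP; exact: measurable_indic.
  move=> x Hx; apply: (@le_trans _ _ (\int[leb]_y ((\1_`[-1, 1] x)%:E * (\1_`[-1, 1] y)%:E))%E).
    apply: ge0_le_integral => //.
    - exact: (measurableT_comp mF).
    - by apply: emeasurable_funM => //; apply/measurable_EFinP; exact: measurable_indic.
    move=> y _; rewrite -EFinM lee_fin !indicE.
    case: (boolP (_ \in [set z | sqnorm z <= 1])) => [|_]; last by rewrite mulr_ge0.
    rewrite inE /sqnorm /= => xy.
    have x2 := sqr_ge0 x; have y2 := sqr_ge0 y.
    rewrite !mem_set ?mulr1 //= in_itv /= -ler_norml -(@expr_le1 _ 2) // real_normK ?num_real //; lra.
  rewrite ge0_integralZl //; last by apply/measurable_EFinP; exact: measurable_indic.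
  by rewrite I1.
rewrite ge0_integralZr //; last by apply/measurable_EFinP; exact: measurable_indic.
by rewrite I1 -EFinM ltry.
Qed.

End Chi2Density.

Section Chi2Base.
Context {R : realType}.
Notation RR := (measurableTypeR R).
Notation leb := (@lebesgue_measure R).
Notation N01 := (normal_prob (0 : R) 1).
Notation phi := (normal_pdf (0 : R) 1).

Let rho : {measure set RR -> \bar R} := image_measure (leb \x leb)%E (@measurable_sqnorm R).

Let rho_disc t : rho `]-oo, t]%classic = disc_area t.
Proof.
transitivity ((leb \x leb)%E [set z : RR * RR | sqnorm z <= t]).
  change ((leb \x leb)%E ((@sqnorm R) @^-1` `]-oo, t]%classic) = (leb \x leb)%E [set z : RR * RR | sqnorm z <= t]).
  by congr ((leb \x leb)%E _); apply/seteqP; split => z /=; rewrite in_itv.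
rewrite -(integral_indicT (leb \x leb)%E (@measurable_disc R t)).
by rewrite (indic_fubini_tonelli1 leb leb (@measurable_disc R t)).
Qed.

Let V : R := fine (@disc_area R 1).
Let VE : disc_area 1 = V%:E.
Proof. by rewrite fineK // disc_area1_fin. Qed.

Let V0 : 0 <= V.
Proof.
by rewrite fine_ge0 // integral_ge0 // => x _; rewrite integral_ge0 // => y _; rewrite lee_fin.
Qed.

Let rho_discE t : rho `]-oo, t]%classic = (Num.max t 0 * V)%:E.
Proof.
have [t0|t0] := ltP 0 t.
  by rewrite rho_disc disc_area_scale // VE EFinM.
rewrite mul0r.
(* For [t <= 0] the half-line is contained in those of positive end point, that is, in discs of
   arbitrarily small area. *)
apply/eqP; rewrite eq_le measure_ge0 andbT.
apply/lee_addgt0Pr => e e0; rewrite add0e.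
apply: (@le_trans _ _ (rho `]-oo, (e / (V + 1))%R]%classic)).
  apply: le_measure; rewrite ?inE //.
  move=> x /=; rewrite !in_itv /= => xt; rewrite (le_trans (le_trans xt t0)) // divr_ge0 ?ltW //.
  by rewrite ltr_wpDl.
have V1 : 0 < V + 1 by rewrite ltr_wpDl.
rewrite rho_disc disc_area_scale ?divr_gt0 // VE -EFinM lee_fin.
rewrite mulrAC ler_pdivrMr // ler_wpM2l ?ltW //; lra.
Qed.

(** Stands in for polar coordinates: by scaling, the disc of squared radius t has area t V, so the
    image of the planar measure under [sqnorm] agrees with V times Lebesgue measure on half-open
    intervals. *)
Lemma image_sqnormE A : measurable A -> rho A = (V%:E * leb (A `&` `]0%R, +oo[%classic))%E.
Proof.
move=> mA.
have m0 : measurable (`]0, +oo[ : set RR) by [].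
pose nu := mscale (NngNum V0) (mrestr leb m0).
change (rho A = nu A).
have itvE (a b : R) : a <= b -> rho `]a, b]%classic = ((Num.max b 0 - Num.max a 0) * V)%:E.
  move=> ab.
  rewrite (_ : `]a, b]%classic = `]-oo, b] `\` `]-oo, a]); last first.
    apply/seteqP; split => x /=; rewrite !in_itv /=.
      by move=> /andP[ax ->]; split => //; apply/negP; rewrite -ltNge.
    by move=> [-> /negP]; rewrite -ltNge => ->.
  have fin t : (rho `]-oo, t]%classic < +oo)%E by rewrite rho_discE ltry.
  have -> : (rho (`]-oo, b]%classic `\` `]-oo, a]%classic) =
      rho `]-oo, b]%classic - rho (`]-oo, b]%classic `&` `]-oo, a]%classic))%E.
    by apply: measureD => //; exact: fin.
  rewrite setIidr; last by move=> x /=; rewrite !in_itv /= => /le_trans; exact.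
  by rewrite !rho_discE -EFinB mulrBl.
apply: (@measure_unique _ R RR (@ocitv R) (fun n : nat => `](- n%:R)%R, n%:R]%classic) _ _ _ _ rho nu) => //.
- exact: ocitvI.
- by move=> i; exact: is_ocitv.
- apply/seteqP; split => x //= _; exists (Num.truncn `|x|).+1 => //=.
  rewrite in_itv /=; have := truncnS_gt `|x|; rewrite ltr_norml => /andP[-> /ltW ->] //.
- move=> _ [[a b]] _ <- /=.
  have [ab|ab] := leP a b; last first.
    have -> : `]a, b]%classic = set0.
      by apply/seteqP; split => x //=; rewrite in_itv /= => /andP[h1 h2]; lra.
    by rewrite (measure0 rho) (measure0 nu).
  rewrite itvE //.
  change (((Num.max b 0 - Num.max a 0) * V)%:E = (V%:E * leb (`]a, b]%classic `&` `]0%R, +oo[%classic))%E).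
  rewrite (_ : `]a, b] `&` `]0, +oo[ = `](Num.max a 0), b]%classic); last first.
    apply/seteqP; split => x /=; rewrite !in_itv /= gt_max andbT.
      by move=> [/andP[-> ->] ->].
    by move=> /andP[/andP[-> ->] ->].
  rewrite lebesgue_measure_itv /= lte_fin; case: ltP => h.
    rewrite max_l; first by rewrite -EFinB -EFinM mulrC.
    by apply: le_trans (ltW h); rewrite le_max lexx orbT.
  rewrite mule0 (_ : Num.max b 0 = Num.max a 0) ?subrr ?mul0r //.
  apply/eqP; rewrite eq_le; apply/andP; split.
    by rewrite ge_max h le_max lexx orbT.
  by rewrite ge_max !le_max ab lexx orbT.
- by move=> k; rewrite itvE ?ltry // ge0_cp ?ler0n.
Qed.

Lemma ge0_integral_sqnorm (h : R -> \bar R) :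
  measurable_fun setT (h : RR -> \bar R) -> (forall x, (0 <= h x)%E) ->
  (\int[leb]_x \int[leb]_y h (x ^+ 2 + y ^+ 2)%R =
   \int[leb]_x (h x * (V * \1_(`]0%R, +oo[ : set R) x)%:E))%E.
Proof.
move=> mh h0.
have m0 : measurable (`]0, +oo[ : set RR) by [].
have mhs := measurableT_comp mh (@measurable_sqnorm R).
have mi : measurable_fun setT (\1_(`]0%R, +oo[ : set R) : RR -> RR) by exact: measurable_indic.
transitivity (\int[(leb \x leb)%E]_z (h \o (@sqnorm R)) z)%E.
  exact/esym/(@fubini_tonelli1 _ _ RR RR R leb leb _ mhs (fun z => h0 _)).
transitivity (\int[rho]_z h z)%E.
  by apply/esym/(ge0_integral_pushforward (@measurable_sqnorm R)).
apply: ge0_integral_density => //.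
- by move=> x; rewrite mulr_ge0.
- exact: measurable_funM.
move=> A mA; rewrite image_sqnormE //.
under eq_integral do rewrite EFinM.
rewrite ge0_integralZl //; last by apply/measurable_EFinP; exact: measurable_funTS.
by congr (_ * _)%E; rewrite integral_indic // setIC.
Qed.

(* [V] is the area of the unit disc, whose value is not needed: the constant is
   pinned down by the total mass. *)
Lemma sum_sqr_prob1_density : exists2 C : R, 0 < C &
  forall A, measurable A -> sum_sqr_prob 1 A = (\int[leb]_(x in A) (C * chi2_kernel 2 x)%:E)%E.
Proof.
pose c := V * (Num.sqrt (2 * pi))^-1 ^+ 2.
have c0 : 0 <= c by rewrite mulr_ge0 // sqr_ge0.
apply: (@probability_density_scale _ _ _ c%:E) => //.
- by move=> x; exact: chi2_kernel_ge0.
- exact: measurable_chi2_kernel.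
move=> A mA.
have mA1 := measurable_preimage (@measurable_add_sqr R) mA.
transitivity (product_probability (sum_sqr_prob 0) N01 ((fun z : RR * RR => z.1 + z.2 ^+ 2)%R @^-1` A)) => //.
rewrite product_probabilityE //.
pose F (z : RR * RR) : \bar R := (\1_A (z.1 ^+ 2 + z.2 ^+ 2)%R)%:E.
pose k (s : RR) := (\int[N01]_y (\1_((fun z : RR * RR => z.1 + z.2 ^+ 2)%R @^-1` A) (s, y))%:E)%E.
have mk : measurable_fun setT k.
  apply: (@measurable_fun_fubini_tonelli_F _ _ RR RR R N01 (EFin \o \1_((fun z : RR * RR => z.1 + z.2 ^+ 2)%R @^-1` A))).
    by apply/measurable_EFinP; exact: measurable_indic.
  by move=> z; rewrite lee_fin.
have k0 s : (0 <= k s)%E by apply: integral_ge0 => y _; rewrite lee_fin.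
have mF : measurable_fun setT F.
  apply/measurable_EFinP; apply: (measurableT_comp (f := \1_A : RR -> RR)).
    exact: measurable_indic.
  exact: (@measurable_sqnorm R).
have F0 z : (0 <= F z)%E by rewrite lee_fin.
transitivity (\int[N01]_x (k \o (fun y : RR => y ^+ 2)%R) x)%E.
  exact: (ge0_integral_pushforward (@measurable_sqr R) N01 measurableT mk).
transitivity (\int[N01]_x \int[N01]_y F (x, y))%E.
  by apply: eq_integral => x _; apply: eq_integral => y _.
apply: (etrans (std_normal2E mF F0)).
pose h (t : R) : \bar R := ((\1_A t) * ((Num.sqrt (2 * pi))^-1 ^+ 2 * expR (- t / 2)))%:E.
have h0 t : (0 <= h t)%E by rewrite lee_fin mulr_ge0 // mulr_ge0 ?expR_ge0 ?sqr_ge0.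
have mh : measurable_fun setT (h : RR -> \bar R).
  apply/measurable_EFinP; apply: measurable_funM; first exact: measurable_indic.
  apply: measurable_funM => //.
  by apply: (measurableT_comp (@measurable_expR R)); apply: measurable_funM => //; exact: measurable_funN.
transitivity (\int[leb]_x \int[leb]_y h (x ^+ 2 + y ^+ 2)%R)%E.
  apply: eq_integral => x _; apply: eq_integral => y _ /=.
  rewrite /F /h -EFinM; congr (_ * _)%:E.
  rewrite !std_normal_pdfE mulrACA -expr2 -expRD; congr (_ * expR _).
  by rewrite -mulrDl opprD.
rewrite ge0_integral_sqnorm // -ge0_integralZl //; last 2 first.
- by apply/measurable_EFinP; apply: measurable_funTS; exact: measurable_chi2_kernel.
- by move=> x _; rewrite lee_fin chi2_kernel_ge0.
rewrite [RHS]integral_mkcond; apply: eq_integral => x _.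
rewrite patchE /h indicE /chi2_kernel; case: ifP => xA; last by rewrite mul0r mul0e.
rewrite mul1r -!EFinM; congr _%:E; rewrite indicE.
case: ltP => x0; last by rewrite memNset ?mulr0 //= in_itv /= andbT ltNge x0.
rewrite mem_set /= ?in_itv /= ?x0 // divff ?pnatr_eq0 // subrr powRr0 /c; ring.
Qed.

End Chi2Base.

Section Chi2Step.
Context {R : realType}.
Notation RR := (measurableTypeR R).
Notation leb := (@lebesgue_measure R).
Notation N01 := (normal_prob (0 : R) 1).
Notation phi := (normal_pdf (0 : R) 1).

Let bump (p : R) (x y : R) : R := if y ^+ 2 < x then (x - y ^+ 2) `^ p else 0.

Let measurable_bump p : measurable_fun setT (fun z : RR * RR => bump p z.1 z.2 : RR).
Proof.
apply: measurable_fun_ifT => //.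
  apply: measurable_fun_ltr => //.
  exact: (measurableT_comp (@measurable_sqr R) (measurable_snd : measurable_fun setT (@snd RR RR))).
apply: (measurableT_comp (measurable_powR p)).
apply: measurable_funB => //.
exact: (measurableT_comp (@measurable_sqr R) (measurable_snd : measurable_fun setT (@snd RR RR))).
Qed.

Let measurable_pairl (x : RR) : measurable_fun setT (fun y : RR => (x, y)).
Proof. by apply: measurable_fun_pair. Qed.

Let bump_ge0 p x y : 0 <= bump p x y.
Proof. by rewrite /bump; case: ifP => // _; exact: powR_ge0. Qed.

(** Substitution y = sqrt x y'. The integral on the right is a beta integral, left unevaluated. *)
Lemma integral_bump (p x : R) : 0 < x ->
  (\int[leb]_y (bump p x y)%:E = (x `^ (p + 2^-1))%:E * \int[leb]_y (bump p 1 y)%:E)%E.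
Proof.
move=> x0.
pose s : R := Num.sqrt x; have s0 : 0 < s by rewrite sqrtr_gt0.
have sx : s ^+ 2 = x by rewrite sqr_sqrtr // ltW.
have mb : measurable_fun setT (fun y : RR => (bump p x y)%:E).
  by apply/measurable_EFinP; exact: (measurableT_comp (measurable_bump p) (measurable_pairl _)).
have mb1 : measurable_fun setT (fun y : RR => (bump p 1 y)%:E).
  by apply/measurable_EFinP; exact: (measurableT_comp (measurable_bump p) (measurable_pairl _)).
have b0 (y : R) : (0 <= (bump p x y)%:E)%E by rewrite lee_fin bump_ge0.
have E : (\int[leb]_y (bump p x (s * y + 0))%:E = (x `^ p)%:E * \int[leb]_y (bump p 1 y)%:E)%E.
  rewrite -ge0_integralZl //; last by rewrite lee_fin powR_ge0.
    apply: eq_integral => y _; rewrite -EFinM; congr _%:E.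
    rewrite /bump addr0 exprMn sx -[X in (_ < X)]mulr1 ltr_pM2l //.
    case: ifP => y1; last by rewrite mulr0.
    by rewrite -{1}[x]mulr1 -mulrBr powRM ?ltW // subr_gt0.
  by move=> y _; rewrite lee_fin bump_ge0.
have E2 := ge0_integral_affine 0 s0 mb b0.
have : ((x `^ p)%:E * \int[leb]_y (bump p 1 y)%:E = (s^-1)%:E * \int[leb]_y (bump p x y)%:E)%E.
  by rewrite -E -E2.
move: (\int[leb]_y (bump p 1 y)%:E)%E (\int[leb]_y (bump p x y)%:E)%E => I J e.
rewrite powRD; last by rewrite (gt_eqF x0) implybT.
rewrite powR12_sqrt ?ltW // -/s mulrC EFinM -muleA e muleA -EFinM mulfV ?gt_eqF //.
by rewrite mul1e.
Qed.

(** Induction from two degrees of freedom. In the product of [chi2_kernel] at x - y^2 with the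
    normal density at y the exponentials combine to exp(-x/2), and integrating out y raises the
    power of x by 1/2, by [integral_bump]. *)
Lemma sum_sqr_prob_density j : (0 < j)%N -> exists2 C : R, 0 < C &
  forall A, measurable A ->
    sum_sqr_prob j A = (\int[leb]_(x in A) (C * chi2_kernel j.+1 x)%:E)%E.
Proof.
case: j => // j _; elim: j => [|j [C C0 IH]]; first exact: sum_sqr_prob1_density.
pose p : R := j.+2%:R / 2 - 1.
pose K := (\int[leb]_y (bump p 1 y)%:E)%E.
have K0 : (0 <= K)%E by apply: integral_ge0 => y _; rewrite lee_fin bump_ge0.
pose c := C * (Num.sqrt (2 * pi))^-1.
have c0 : 0 <= c by rewrite mulr_ge0 ?invr_ge0 // ltW.
apply: (@probability_density_scale _ _ _ (c%:E * K)%E).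
- by rewrite mule_ge0.
- by move=> x; exact: chi2_kernel_ge0.
- exact: measurable_chi2_kernel.
move=> A mA.
have mA1 := measurable_preimage (@measurable_add_sqr R) mA.
pose B := (fun z : RR * RR => z.1 + z.2 ^+ 2)%R @^-1` A.
transitivity (product_probability (sum_sqr_prob j.+1) N01 B) => //.
rewrite product_probabilityE //.
pose F (z : RR * RR) : \bar R := (\1_B z)%:E.
have mB : measurable_fun setT F by apply/measurable_EFinP; exact: measurable_indic.
have B0 z : (0 <= F z)%E by rewrite lee_fin.
apply: (etrans (@fubini_tonelli _ _ RR RR R (sum_sqr_prob j.+1) N01 F mB B0)).
pose Q (x y : R) : R := C * chi2_kernel j.+2 (x - y ^+ 2).
have Q0 x y : 0 <= Q x y by rewrite mulr_ge0 ?chi2_kernel_ge0 // ltW.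
have mQ : measurable_fun setT (fun z : RR * RR => Q z.1 z.2 : RR).
  apply: measurable_funM => //; apply: (measurableT_comp (measurable_chi2_kernel j.+2)).
  apply: measurable_funB => //.
  exact: (measurableT_comp (@measurable_sqr R) (measurable_snd : measurable_fun setT (@snd RR RR))).
have mphi : measurable_fun setT (phi : RR -> RR) by exact: measurable_normal_pdf.
have mi : measurable_fun setT (\1_A : RR -> RR) by exact: measurable_indic.
pose G (z : RR * RR) : \bar R := (\1_A z.1 * Q z.1 z.2 * phi z.2)%:E.
have mG : measurable_fun setT G.
  apply/measurable_EFinP; apply: measurable_funM; last exact: measurableT_comp.
  by apply: measurable_funM => //; exact: measurableT_comp.
have G0 z : (0 <= G z)%E.
  by rewrite lee_fin mulr_ge0 ?normal_pdf_ge0 // mulr_ge0.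
pose k (z : RR * RR) : \bar R := (\1_A z.1 * Q z.1 z.2)%:E.
have mk : measurable_fun setT k.
  by apply/measurable_EFinP; apply: measurable_funM => //; exact: measurableT_comp.
have k0 z : (0 <= k z)%E by rewrite lee_fin mulr_ge0.
have mky (y : RR) : measurable_fun setT (fun x => k (x, y)) by exact: (measurableT_comp mk).
have mkernel : measurable_fun setT (fun x : RR => C * chi2_kernel j.+2 x : RR).
  by apply: measurable_funM => //; exact: measurable_chi2_kernel.
have kernel0 x : 0 <= C * chi2_kernel j.+2 x by rewrite mulr_ge0 ?chi2_kernel_ge0 // ltW.
transitivity (\int[N01]_y \int[leb]_x k (x, y))%E.
  apply: eq_integral => y _.
  have my : measurable_fun setT (fun s : RR => F (s, y)).
    by apply: (measurableT_comp mB).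
  apply: (etrans (@ge0_integral_density _ RR R leb (sum_sqr_prob j.+1) _ kernel0 mkernel IH (fun s => F (s, y)) my (fun s => B0 (s, y)))).
  transitivity (\int[leb]_s k ((1 * s + y ^+ 2)%R, y))%E.
    apply: eq_integral => s _; rewrite /k /Q /= mul1r addrK -EFinM !indicE.
    by congr (_%:R * _)%:E; congr nat_of_bool; apply/idP/idP; rewrite !inE.
  by rewrite (ge0_integral_affine (y ^+ 2) ltr01 (mky y)) // invr1 mul1e.
transitivity (\int[leb]_y \int[leb]_x G (x, y))%E.
  rewrite ge0_integral_std_normal; last 2 first.
  - exact: (@measurable_fun_fubini_tonelli_G _ _ RR RR R leb k mk k0).
  - by move=> y; exact: integral_ge0.
  apply: eq_integral => y _; rewrite -ge0_integralZr //; last by rewrite lee_fin normal_pdf_ge0.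
apply: (etrans (esym (@fubini_tonelli _ _ RR RR R leb leb G mG G0))).
rewrite -ge0_integralZl //; last 3 first.
- by apply/measurable_EFinP; apply: measurable_funTS; exact: measurable_chi2_kernel.
- by move=> x _; rewrite lee_fin chi2_kernel_ge0.
- by rewrite mule_ge0.
rewrite [RHS]integral_mkcond; apply: eq_integral => x _.
rewrite patchE; case: ifP => xA; last first.
  by rewrite integral0_eq // => y _; rewrite /G /= indicE xA !mul0r.
have [x0|x0] := ltP 0 x; last first.
  rewrite /chi2_kernel ltNge x0 /= mule0 integral0_eq // => y _; rewrite /G /Q /chi2_kernel /=.
  by rewrite ltNge (_ : x - y ^+ 2 <= 0) ?mulr0 ?mul0r //= subr_le0 (le_trans x0) // sqr_ge0.
transitivity (\int[leb]_y ((c * expR (- x / 2))%:E * (bump p x y)%:E))%E.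
  apply: eq_integral => y _; rewrite /G /= indicE xA mul1r -EFinM; congr _%:E.
  rewrite /Q /chi2_kernel subr_gt0 /bump; case: ifP => yx; last by rewrite !mulr0 mul0r.
  have ee : expR (- (x - y ^+ 2) / 2) * expR (- y ^+ 2 / 2) = expR (- x / 2).
    by rewrite -expRD; congr expR; field.
  by rewrite std_normal_pdfE /c -ee -/p; ring.
rewrite ge0_integralZl //; last 3 first.
- by apply/measurable_EFinP; exact: (measurableT_comp (measurable_bump p) (measurable_pairl _)).
- by move=> y _; rewrite lee_fin bump_ge0.
- by rewrite lee_fin mulr_ge0 ?expR_ge0.
rewrite integral_bump // -/K /chi2_kernel x0.
have -> : p + 2^-1 = j.+3%:R / 2 - 1 by rewrite /p -(natr1 j.+2) ; field.
rewrite muleA -EFinM -muleA [in RHS](muleC K) muleA -EFinM; congr (_%:E * K)%E; ring.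
Qed.

End Chi2Step.

(** * Incomplete gamma integrals *)

Section Chi2Integrals.
Context {R : realType}.
Notation RR := (measurableTypeR R).
Notation leb := (@lebesgue_measure R).

Lemma powR_expR_cvg0 (m : nat) : (0 < m)%N ->
  (n.+1%:R `^ (m%:R / 2) * expR (- n.+1%:R / 2) : R) @[n --> \oo] --> (0 : R).
Proof.
move=> m0.
(* The term of degree m + 1 of the exponential series gives exp(-x/2) <= C / x^(m+1); with x^(m/2)
   <= x^m the product is at most C / x. *)
pose C : R := m.+1`!%:R * 2 ^+ m.+1.
have C0 : 0 <= C by rewrite mulr_ge0.
apply: (@squeeze_cvgr _ _ _ _ (fun=> 0) (fun n => C * (n.+1%:R)^-1)); last 2 first.
- exact: cvg_cst.
- by rewrite -[X in _ --> X](mulr0 C); apply: cvgMr; exact: cvg_harmonic.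
near=> n; rewrite mulr_ge0 ?powR_ge0 ?expR_ge0 //=.
set x : R := n.+1%:R.
have x1 : 1 <= x by rewrite ler1n.
have x0 : 0 < x by rewrite (lt_le_trans ltr01).
have xm : x `^ (m%:R / 2) <= x ^+ m.
  rewrite -(powR_mulrn m (ltW x0)). apply: (ler_powR x1).
  by rewrite ler_pdivrMr // ler_peMr // ?ler1n.
have ex : expR (- x / 2) <= C / x ^+ m.+1.
  have x20 : 0 <= x / 2 by rewrite divr_ge0 // ltW.
  have h := expR_ge1Dxn m x20.
  have xm0 : 0 < x ^+ m.+1 by rewrite exprn_gt0.
  have f0 : 0 < (m.+1)`!%:R :> R by rewrite ltr0n fact_gt0.
  have t0 : 0 < 2 ^+ m.+1 :> R by rewrite exprn_gt0.
  rewrite mulNr expRN ler_pdivlMr // mulrC ler_pdivrMr ?expR_gt0 //.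
  rewrite -ler_pdivrMl ?mulr_gt0 //.
  apply: le_trans h; rewrite expr_div_n ler_wpDl // le_eqVlt; apply/orP; left; apply/eqP.
  by rewrite /C invfM mulrAC -mulrA mulrC.
apply: (le_trans (ler_pM (powR_ge0 _ _) (expR_ge0 _) xm ex)).
by rewrite mulrCA ler_wpM2l // exprS invfM mulrCA mulfV ?mulr1 // expf_neq0 // gt_eqF.
Unshelve. all: by end_near. Qed.

Definition chi2_bdry (m : nat) (x : R) : R := x `^ (m%:R / 2) * expR (- x / 2).

(** Integration by parts with x^(m/2) and -2 exp(-x/2), away from 0, where x^(m/2) need not be
    differentiable; [chi2_bdry] is the boundary term. *)
Lemma chi2_kernel_parts (m : nat) (s t : R) : 0 < s -> s < t ->
  (\int[leb]_(x in `[s, t]) (chi2_kernel m.+2 x)%:E =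
   (2 * (chi2_bdry m s - chi2_bdry m t))%:E + m%:R%:E * \int[leb]_(x in `[s, t]) (chi2_kernel m x)%:E)%E.
Proof.
move=> s0 st.
pose a : R := m%:R / 2.
pose F (x : R) : R := x `^ a.
pose f (x : R) : R := a * x `^ (a - 1).
pose g (x : R) : R := expR (- x / 2).
pose G (x : R) : R := - 2 * expR (- x / 2).
have dF (x : R) : 0 < x -> is_derive x 1 F (f x) by move=> x0; exact: is_derive1_powR.
have df (x : R) : 0 < x -> derivable f x 1.
  by move=> x0; apply: derivableM => //; apply: derivable_powR; rewrite in_itv /= x0.
have dg (x : R) : is_derive x 1 g (- 2^-1 * g x).
  have h : is_derive x 1 (fun y : R => - y / 2 : R) (- 2^-1).
    have -> : (fun y : R => - y / 2) = (fun y => (- 2^-1) * y).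
      by apply/funext => y; rewrite mulNr mulrC -mulNr.
    by have := is_deriveZ (- 2^-1) (is_derive_id (x : R^o) (1 : R^o)); rewrite /GRing.scale /= mulr1.
  have e : is_derive (- x / 2) 1 (@expR R) (expR (- x / 2)) by exact: is_derive_expR.
  by have := @is_derive1_comp R (@expR R) (fun y => - y / 2) x _ _ e h; rewrite mulrC.
have dG (x : R) : is_derive x 1 G (g x).
  have := @is_deriveZ R R^o R^o g (- 2) x 1 _ (dg x).
  by rewrite /GRing.scale /= mulrA mulrNN divff ?mul1r.
have cont (h : R -> R) (a0 b0 : R) : (forall x, a0 <= x <= b0 -> derivable h x 1) ->
    {within `[a0, b0], continuous h}.
  move=> dh; apply: derivable_within_continuous => x; rewrite in_itv /=; exact: dh.
have cvgl (h : R -> R) (x : R) : derivable h x 1 -> h @ x^'+ --> h x /\ h @ x^'- --> h x.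
  move=> dh; have c : h @ x --> h x by apply: differentiable_continuous; exact/derivable1_diffP.
  by split; apply: cvg_trans c; apply: cvg_app; [exact: cvg_at_right_filter|exact: cvg_at_left_filter].
have t0 : 0 < t := lt_trans s0 st.
have pos x : s <= x <= t -> 0 < x by move=> /andP[/(lt_le_trans s0)].
have derF (x : R) : 0 < x -> derivable F x 1 by move=> x0; have [] := dF x x0.
have derG (x : R) : derivable G x 1 by have [] := dG x.
have derg (x : R) : derivable g x 1 by have [] := dg x.
have kern (n : nat) (x : R) : 0 < x -> chi2_kernel n x = x `^ (n%:R / 2 - 1) * g x.
  by move=> x0; rewrite /chi2_kernel x0.
have am : m.+2%:R / 2 - 1 = a by rewrite /a -(natr1 m.+1) -(natr1 m); field.
transitivity (\int[leb]_(x in `[s, t]) (F x * g x)%:E)%E.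
  apply: eq_integral => x; rewrite inE /= in_itv /= => xst.
  by rewrite kern ?pos // am.
have cf : {within `[s, t], continuous f} by apply: cont => x xst; apply/df/pos.
rewrite (@integration_by_parts R F G f g s t) //; first last.
- by move=> x _; rewrite derive1E; have [_ ->] := dG x.
- by split => [x _||]; [exact: derG|exact: (cvgl _ _ (derG _)).1|exact: (cvgl _ _ (derG _)).2].
- by apply: cont => x _; exact: derg.
- by move=> x; rewrite in_itv /= => /andP[sx _]; rewrite derive1E; have [_ ->] := dF x (lt_trans s0 sx).
- split => [x||]; [|exact: (cvgl _ _ (derF _ s0)).1|exact: (cvgl _ _ (derF _ t0)).2].
  by rewrite in_itv /= => /andP[sx _]; apply/derF/(lt_trans s0 sx).
have -> : F t * G t - F s * G s = 2 * (chi2_bdry m s - chi2_bdry m t).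
  by rewrite /F /G /chi2_bdry -/a; ring.
congr (_ + _)%E.
have E : (\int[leb]_(x in `[s, t]) (f x * G x)%:E = (- m%:R)%:E * \int[leb]_(x in `[s, t]) (x `^ (a - 1) * g x)%:E)%E.
  rewrite -integralZl //.
    apply: eq_integral => x _; rewrite -EFinM; congr _%:E.
    by rewrite /f /G -/(g x) /a; field.
  apply: continuous_compact_integrable; first exact: segment_compact.
  apply: cont => x xst; apply: derivableM; last exact: derg.
  by apply: derivable_powR; rewrite in_itv /= (pos x xst).
rewrite E EFinN mulNe oppeK; congr (_ * _)%E.
apply: eq_integral => x; rewrite inE /= in_itv /= => xst.
by rewrite kern ?pos.
Qed.

End Chi2Integrals.

Section Chi2Constants.
Context {R : realType}.
Notation RR := (measurableTypeR R).
Notation leb := (@lebesgue_measure R).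

Definition chi2_int (m : nat) (D : set R) : \bar R := (\int[leb]_(x in D) (chi2_kernel m x)%:E)%E.

Let mkern m (D : set R) : measurable_fun (D : set RR) (fun x => (chi2_kernel m x)%:E).
Proof. by apply/measurable_EFinP; apply: measurable_funTS; exact: measurable_chi2_kernel. Qed.

(** One exhaustion by segments for both domains: on ]0, +oo[ the lower boundary term tends to 0, on
    [t, +oo[ it is constant. *)
Let kint_parts_lim (m : nat) (s u : nat -> R) (D : set R) (p : R) : (0 < m)%N ->
  (forall n, 0 < s n) -> (forall n, s n < u n) ->
  (forall n, s n.+1 <= s n) -> (forall n, u n <= u n.+1) ->
  D = \bigcup_n [set` `[s n, u n]] ->
  chi2_bdry m (u n) @[n --> \oo] --> (0 : R) ->
  chi2_bdry m (s n) @[n --> \oo] --> (p : R) ->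
  chi2_int m.+2 D = ((2 * p)%:E + m%:R%:E * chi2_int m D)%E.
Proof.
move=> m0 s0 su sd ud -> cu cs.
have nd : nondecreasing_seq (fun n => [set` `[s n, u n]] : set RR).
  apply/nondecreasing_seqP => n; apply/subsetPset => x /=; rewrite !in_itv /= => /andP[h1 h2].
  by rewrite (le_trans (sd n)) // (le_trans h2).
have mI n : measurable ([set` `[s n, u n]] : set RR) by [].
have lim q : (\int[leb]_(x in [set` `[s n, u n]]) (chi2_kernel q x)%:E)%E @[n --> \oo] -->
    (\int[leb]_(x in \bigcup_n [set` `[s n, u n]]) (chi2_kernel q x)%:E)%E.
  apply: (@ge0_nondecreasing_set_cvg_integral _ RR R (fun n => [set` `[s n, u n]]) (fun x => (chi2_kernel q x)%:E) leb) => //.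
  - by move=> n x _; rewrite lee_fin chi2_kernel_ge0.
rewrite /chi2_int -(cvg_lim (@ereal_hausdorff R) (lim m.+2)); apply/cvg_lim => //.
rewrite (_ : (fun n => _) = (fun n => (2 * (chi2_bdry m (s n) - chi2_bdry m (u n)))%:E +
   m%:R%:E * \int[leb]_(x in `[s n, u n]) (chi2_kernel m x)%:E)%E); last first.
  by apply/funext => n; rewrite chi2_kernel_parts.
apply: cvgeD => //.
- apply: cvg_EFin; first exact: nearW.
  rewrite -[X in (2 * X)]subr0; apply: cvgMr; exact: cvgB.
- by apply: cvgeZl => //; exact: lim.
Qed.

Let kintT m : chi2_int m setT = chi2_int m `]0, +oo[.
Proof.
rewrite /chi2_int [RHS]integral_mkcond; apply: eq_integral => x _.
rewrite patchE /chi2_kernel; case: ltP => x0.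
  by rewrite mem_set //= in_itv /= x0.
by rewrite memNset //= in_itv /= andbT; apply/negP; rewrite -leNgt.
Qed.

Let bdry_shift m K : (0 < m)%N -> chi2_bdry m ((n + K).+1%:R : R) @[n --> \oo] --> (0 : R).
Proof.
move=> m0; have := @powR_expR_cvg0 R m m0.
by rewrite -(cvg_shiftn K).
Qed.

Lemma chi2_intT_rec m : (0 < m)%N -> chi2_int m.+2 setT = (m%:R%:E * chi2_int m setT)%E.
Proof.
move=> m0; rewrite !kintT.
(* The square makes the power m/2 of the lower end an integer power; n + 2 in place of n + 1 keeps
   the lower end strictly below the upper one already for n = 0. *)
rewrite (@kint_parts_lim m (fun n => n.+2%:R ^- 2) (fun n => n.+2%:R) _ 0) //.
- by rewrite mulr0 add0e.
- move=> n; apply: (@lt_le_trans _ _ 1); last by rewrite ler1n.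
  by rewrite invf_lt1 ?exprn_gt0 // exprn_egt1 // ltr1n.
- by move=> n; rewrite lef_pV2 ?posrE ?exprn_gt0 // lerXn2r ?nnegrE // ler_nat.
- by move=> n; rewrite ler_nat.
- apply/seteqP; split => x /=; last first.
    move=> [n _] /=; rewrite !in_itv /= andbT => /andP[+ _]; apply: lt_le_trans.
    by rewrite invr_gt0 exprn_gt0.
  rewrite in_itv /= andbT => x0.
  exists (Num.truncn x + Num.truncn x^-1)%N => //=; rewrite in_itv /=.
  have h1 := truncnS_gt x; have h2 := truncnS_gt x^-1.
  set n := (_ + _)%N.
  have n1 : x <= n.+2%:R by apply: le_trans (ltW h1) _; rewrite ler_nat ltnS; exact: leq_trans (leq_addr _ _) (leqnSn _).
  have n2 : x^-1 <= n.+2%:R by apply: le_trans (ltW h2) _; rewrite ler_nat ltnS; exact: leq_trans (leq_addl _ _) (leqnSn _).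
  rewrite n1 andbT -[leRHS]invrK lef_pV2 ?posrE ?invr_gt0 ?exprn_gt0 //.
  by apply: le_trans n2 _; rewrite expr2 ler_peMr // ler1n.
- by have := @bdry_shift m 1 m0; under eq_fun do rewrite addn1.
- apply: (@squeeze_cvgr _ _ _ _ (fun=> 0) (fun n => (n.+1%:R)^-1)); last 2 first.
  + exact: cvg_cst.
  + exact: cvg_harmonic.
  near=> n; rewrite /chi2_bdry mulr_ge0 ?powR_ge0 ?expR_ge0 //=.
  set x : R := n.+2%:R ^-1.
  have x0 : 0 < x by rewrite invr_gt0.
  have x1 : x <= 1 by rewrite invf_le1 // ler1n.
  have -> : n.+2%:R ^- 2 = x ^+ 2 by rewrite exprVn.
  have -> : (x ^+ 2) `^ (m%:R / 2) = x ^+ m.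
    rewrite -powR_mulrn ?ltW // -powRrM -powR_mulrn ?ltW //; by congr (_ `^ _); field.
    apply: (@le_trans _ _ (x ^+ m * 1)).
    apply: ler_wpM2l; first by rewrite exprn_ge0 // ltW.
    by rewrite -expR0 ler_expR mulNr oppr_le0 divr_ge0 // sqr_ge0.
  rewrite mulr1; apply: (@le_trans _ _ (x ^+ 1)).
    by apply: ler_wiXn2l => //; exact: ltW.
  by rewrite expr1 lef_pV2 ?posrE // ler_nat.
Unshelve. all: by end_near. Qed.

Lemma chi2_int_rec m t : (0 < m)%N -> 0 < t ->
  chi2_int m.+2 `[t, +oo[ = ((2 * chi2_bdry m t)%:E + m%:R%:E * chi2_int m `[t, +oo[)%E.
Proof.
move=> m0 t0; pose K := (Num.truncn t).+1.
have tK : t < K%:R by exact: truncnS_gt.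
apply: (@kint_parts_lim m (fun=> t) (fun n => (n + K).+1%:R) _ (chi2_bdry m t)) => //.
- by move=> n; apply: lt_le_trans tK _; rewrite ler_nat; exact: leqW (leq_addl _ _).
- by move=> n; rewrite ler_nat ltnS leq_add2r.
- apply/seteqP; split => x /=; last by move=> [n _] /=; rewrite !in_itv /= andbT => /andP[].
  rewrite in_itv /= andbT => tx; exists (Num.truncn x) => //=; rewrite in_itv /= tx /=.
  have h := truncnS_gt x; apply: le_trans (ltW h) _; rewrite ler_nat ltnS; exact: leq_addr.
- exact: bdry_shift.
- exact: cvg_cst.
Qed.

End Chi2Constants.

Section Chi2Law.
Context {R : realType}.
Notation RR := (measurableTypeR R).
Notation leb := (@lebesgue_measure R).

(** This is 2^(m/2) Gamma(m/2), as [Gamma_fun_half] shows. *)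
Definition chi2_mass (m : nat) : R := fine (chi2_int m (setT : set R)).

Let kernel0 m (x : R) : (0 <= (chi2_kernel m x)%:E)%E.
Proof. by rewrite lee_fin chi2_kernel_ge0. Qed.

Let mkern m : measurable_fun setT (fun x : RR => (chi2_kernel m x)%:E).
Proof. by apply/measurable_EFinP; exact: measurable_chi2_kernel. Qed.

Let mkernD m (D : set RR) : measurable_fun D (fun x : RR => (chi2_kernel m x)%:E).
Proof. exact: measurable_funTS. Qed.

Lemma sum_sqr_probE m : (1 < m)%N -> exists2 C : R, 0 < C &
  (forall A, measurable A -> sum_sqr_prob m.-1 A = C%:E * chi2_int m A)%E /\
  (chi2_int m (setT : set R) = C^-1%:E)%E.
Proof.
case: m => [|[|m]] // _.
have [C C0 H] := @sum_sqr_prob_density R m.+1 isT.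
have H' A : measurable A -> (sum_sqr_prob m.+1 A = C%:E * chi2_int m.+2 A)%E.
  by move=> mA; rewrite H // -ge0_integralZl // lee_fin ltW.
exists C => //; split => //.
have := H' _ (@measurableT _ RR).
rewrite probability_setT; move: (chi2_int _ _) => [r| |] //.
- move=> /eqP; rewrite -EFinM eqe => /eqP e; congr _%:E.
  by apply: (@mulfI _ C); rewrite ?gt_eqF // -e divff // gt_eqF.
- by rewrite gt0_muley ?lte_fin.
- by rewrite gt0_muleNy ?lte_fin.
Qed.

Lemma chi2_massE m : (0 < m)%N -> chi2_int m (setT : set R) = (chi2_mass m)%:E /\ 0 < chi2_mass m.
Proof.
have aux n : (1 < n)%N -> chi2_int n (setT : set R) = (chi2_mass n)%:E /\ 0 < chi2_mass n.
  by move=> n1; have [C C0 [_ E]] := sum_sqr_probE n1; rewrite /chi2_mass E /= invr_gt0.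
case: m => [|[|m]] // _; last exact: aux.
(* The densities start at two degrees of freedom; m = 1, which occurs as k - 2 when k = 3, is
   obtained by reading the recurrence backwards. *)
have [E J3] := aux 3%N isT.
move: E; rewrite (chi2_intT_rec (isT : (0 < 1)%N)) mul1e => E.
by rewrite {1 2}/chi2_mass E.
Qed.

Lemma chi2_mass_rec m : (0 < m)%N -> chi2_mass m.+2 = m%:R * chi2_mass m :> R.
Proof.
move=> m0; have := chi2_intT_rec (R := R) m0.
by rewrite (chi2_massE m0).1 (chi2_massE (isT : (0 < m.+2)%N)).1 -EFinM => -[].
Qed.

(** Substitution x = 2 t in the gamma integral. *)
Lemma Gamma_fun_half m : (0 < m)%N ->
  Gamma_fun (m%:R / 2 : R) = chi2_mass m / 2 `^ (m%:R / 2).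
Proof.
move=> m0.
have p0 : 0 < 2 `^ (m%:R / 2 - 1) :> R by rewrite powR_gt0.
have E := ge0_integral_affine (a := 2) 0 (ltr0n R 2 : 0 < 2) (mkern m) (kernel0 m).
rewrite /Gamma_fun /Rintegral.
have : ((2 `^ (m%:R / 2 - 1))%:E * \int[leb]_(t in `]0%R, +oo[) (t `^ (m%:R / 2 - 1) * expR (- t))%:E =
   (2^-1 * chi2_mass m)%:E)%E.
  rewrite EFinM -(chi2_massE m0).1 /chi2_int -E.
  rewrite integral_mkcond -ge0_integralZl //; last 2 first.
  - apply/(measurable_restrictT (fun x : RR => (x `^ (m%:R / 2 - 1) * expR (- x))%:E)) => //.
    apply/measurable_EFinP/measurable_funTS.
    apply: measurable_funM; first exact: measurable_powR.
    by apply: (measurableT_comp (@measurable_expR R)); exact: measurable_funN.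
  - by move=> x _; apply: erestrict_ge0 => y _; rewrite lee_fin mulr_ge0 ?powR_ge0 ?expR_ge0.
  apply: eq_integral => x _; rewrite patchE /chi2_kernel addr0.
  rewrite pmulr_rgt0 //; case: ltP => x0.
    rewrite mem_set /= ?in_itv /= ?x0 // -EFinM mulrA -powRM ?ltW //; congr (_ * expR _)%:E.
    by field.
  by rewrite memNset ?mule0 //= in_itv /= andbT; apply/negP; rewrite -leNgt.
have -> : 2 `^ (m%:R / 2) = 2 * 2 `^ (m%:R / 2 - 1) :> R.
  by rewrite mulr_powRB1 // divr_gt0 // ltr0n.
move: (integral _ _ _) => [r| |] //=.
- rewrite -EFinM => -[e]; apply: (@mulfI _ (2 `^ (m%:R / 2 - 1))); rewrite ?gt_eqF // e.
  by field; rewrite gt_eqF.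
- by rewrite gt0_muley ?lte_fin.
- by rewrite gt0_muleNy ?lte_fin.
Qed.

Lemma chi2_pdfE m (x : R) : (0 < m)%N -> chi2_pdf m x = (chi2_mass m)^-1 * chi2_kernel m x.
Proof.
move=> m0; have [_ J0] := chi2_massE m0.
rewrite /chi2_pdf /chi2_kernel Gamma_fun_half //; case: ifP => x0; last by rewrite mulr0.
have p0 : 0 < 2 `^ (m%:R / 2) :> R by rewrite powR_gt0.
by rewrite mulrCA mulfV ?gt_eqF // mulr1 mulrC.
Qed.

Lemma integral_chi2_pdf m (A : set R) : (0 < m)%N -> measurable A ->
  (\int[leb]_(x in A) (chi2_pdf m x)%:E = ((chi2_mass m)^-1)%:E * chi2_int m A)%E.
Proof.
move=> m0 mA; have [_ J0] := chi2_massE m0.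
rewrite /chi2_int -ge0_integralZl //; last by rewrite lee_fin invr_ge0 ltW.
by apply: eq_integral => x _; rewrite chi2_pdfE.
Qed.

Lemma sum_sqr_prob_pdf m (A : set R) : (1 < m)%N -> measurable A ->
  (sum_sqr_prob m.-1 A = \int[leb]_(x in A) (chi2_pdf m x)%:E)%E.
Proof.
move=> m1 mA; rewrite integral_chi2_pdf ?(ltnW m1) //.
have [C C0 [E EJ]] := sum_sqr_probE m1.
by rewrite E // /chi2_mass EJ /= invrK.
Qed.

Lemma chi2_upperE m (t : R) : (1 < m)%N ->
  (chi2_upper m t)%:E = sum_sqr_prob m.-1 `[t, +oo[%classic.
Proof.
move=> m1; rewrite /chi2_upper /Rintegral -sum_sqr_prob_pdf // fineK //.
exact: fin_num_measure.
Qed.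

Lemma chi2_upper_int m (t : R) : (0 < m)%N ->
  chi2_int m `[t, +oo[%classic = (chi2_mass m * chi2_upper m t)%:E.
Proof.
move=> m0; have [E J0] := chi2_massE m0.
have fin : chi2_int m `[t, +oo[%classic \is a fin_num.
  rewrite ge0_fin_numE; last exact: integral_ge0.
  apply: (@le_lt_trans _ _ (chi2_int m setT)); last by rewrite E ltry.
  by apply: ge0_subset_integral.
rewrite /chi2_upper /Rintegral integral_chi2_pdf //.
by rewrite EFinM [X in (_ * X)%E]fineK ?fin_numM // muleA -EFinM mulfV ?gt_eqF // mul1e.
Qed.

Lemma chi2_upper0 m : (0 < m)%N -> chi2_upper m (0 : R) = 1.
Proof.
move=> m0; have [E J0] := chi2_massE m0.
have : chi2_int m `[(0 : R), +oo[%classic = (chi2_mass m)%:E.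
  rewrite -E /chi2_int [LHS]integral_mkcond; apply: eq_integral => x _.
  rewrite patchE /chi2_kernel; case: ltP => x0; last by case: ifP.
  by rewrite mem_set //= in_itv /= ltW.
by rewrite chi2_upper_int // => -[e]; apply: (@mulfI _ (chi2_mass m)); rewrite ?gt_eqF // e mulr1.
Qed.

(** [2 * b * chi2_pdf m (b ^+ 2)] is the density at b of the root of a chi-square variable, and 1 /
    sqrt(2 pi) is the mean of the positive part of a standard normal one. *)
Definition crossing_rate (m : nat) (b : R) : R :=
  2 * b * chi2_pdf m (b ^+ 2) / Num.sqrt (2 * pi).

(** Since mass_k = (k - 2) mass_(k-2), dividing [chi2_int_rec] by mass_k shows that the two upper
    tails differ by 2 [chi2_bdry] / mass_k, the boundary term being that of k - 2. The gamma
    quotient trades mass_k for mass_(k-1), and the boundary term is b times the kernel with k - 1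
    degrees of freedom. *)
Lemma tube_coefE k (b : R) : (3 <= k)%N -> 0 < b ->
  Gamma_fun (k%:R / 2) / (Num.sqrt pi * Gamma_fun ((k%:R - 1) / 2)) *
  (chi2_upper k (b ^+ 2) - chi2_upper (k - 2) (b ^+ 2)) = crossing_rate k.-1 b.
Proof.
case: k => [|[|[|k]]] // _ b0.
rewrite subSS subSS subn0 /=.
have b20 : 0 < b ^+ 2 by rewrite exprn_gt0.
have -> : (k.+3%:R - 1) / 2 = k.+2%:R / 2 :> R by rewrite -(natr1 k.+2) addrK.
rewrite !Gamma_fun_half // /crossing_rate chi2_pdfE // /chi2_kernel b20.
have [_ J1] := @chi2_massE k.+1 isT.
have [_ J2] := @chi2_massE k.+2 isT.
have [_ J3] := @chi2_massE k.+3 isT.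
have Jr := @chi2_mass_rec k.+1 isT.
have := chi2_int_rec (isT : (0 < k.+1)%N) b20.
rewrite !chi2_upper_int // -!EFinM -EFinD => -[e].
have key (u3 u1 B I1 I3 r : R) : r != 0 -> I1 != 0 -> I3 = r * I1 ->
    I3 * u3 = 2 * B + r * (I1 * u1) -> u3 - u1 = 2 * B / I3.
  move=> r0 I0 I31 h; have I30 : I3 != 0 by rewrite I31 mulf_neq0.
  apply: (mulfI I30); rewrite mulrBr h [X in _ - X * _]I31; field.
  by rewrite I30.
have r0 : k.+1%:R != 0 :> R by rewrite pnatr_eq0.
have J10 := lt0r_neq0 J1.
have du := key _ _ _ _ _ _ r0 J10 Jr e; rewrite du.
rewrite /chi2_bdry.
have -> : Num.sqrt (2 * pi) = Num.sqrt 2 * Num.sqrt pi :> R by rewrite sqrtrM.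
have -> : (b ^+ 2) `^ (k.+1%:R / 2) = b * (b ^+ 2) `^ (k.+2%:R / 2 - 1) :> R.
  have -> : k.+1%:R / 2 = 2^-1 + (k.+2%:R / 2 - 1) :> R by rewrite -(natr1 k.+1); field.
  rewrite powRD; last by rewrite (gt_eqF b20) implybT.
  by rewrite powR12_sqrt ?ltW // sqrtr_sqr gtr0_norm.
have -> : 2 `^ (k.+3%:R / 2) = 2 `^ (k.+2%:R / 2) * Num.sqrt 2 :> R.
  have -> : k.+3%:R / 2 = k.+2%:R / 2 + 2^-1 :> R by rewrite -(natr1 k.+2); field.
  rewrite powRD ?powR12_sqrt //; by rewrite pnatr_eq0 /= implybT.
have s2 : Num.sqrt 2 != 0 :> R by rewrite gt_eqF // sqrtr_gt0.
have spi : Num.sqrt pi != 0 :> R by rewrite gt_eqF // sqrtr_gt0 pi_gt0.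
have p0 : 2 `^ (k.+2%:R / 2) != 0 :> R by rewrite gt_eqF // powR_gt0.
field.
by rewrite s2 spi p0 !gt_eqF.
Qed.

End Chi2Law.

(** * Crossing probability of two nearby directions *)

Section Tails.
Context {R : realType}.
Notation RR := (measurableTypeR R).
Notation leb := (@lebesgue_measure R).
Notation N01 := (normal_prob (0 : R) 1).
Notation phi := (normal_pdf (0 : R) 1).

Lemma is_derive_std_normal_pdf (x : R) : is_derive x 1 phi (- x * phi x).
Proof.
have -> : phi = (fun y => (Num.sqrt (2 * pi))^-1 * expR (- 2^-1 * (y * y))).
  by apply/funext => y; rewrite std_normal_pdfE; congr (_ * expR _); rewrite expr2; field.
have h : is_derive x 1 (fun y : R => - 2^-1 * (y * y)) (- x).
  have h1 := @is_deriveM R R^o id id x 1 1 1 (is_derive_id (x : R^o) (1 : R^o)) (is_derive_id (x : R^o) (1 : R^o)).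
  have := @is_deriveZ R R^o R^o _ (- 2^-1) x 1 _ h1.
  have -> : - x = - 2^-1 * (x * 1 + x * 1) by field.
  exact.
have e := @is_derive_expR R (- 2^-1 * (x * x)).
have := @is_deriveZ R R^o R^o _ (Num.sqrt (2 * pi))^-1 x 1 _ (@is_derive1_comp R (@expR R) (fun y => - 2^-1 * (y * y)) x _ _ e h).
by rewrite /GRing.scale /= (_ : _ * (_ * - x) = - x * ((Num.sqrt (2 * pi))^-1 * expR (- 2^-1 * (x * x)))) //; ring.
Qed.

Lemma std_normal_pdf_cvg0 : phi x @[x --> +oo%R] --> (0 : R).
Proof.
have -> : phi = (fun x => (Num.sqrt (2 * pi))^-1 * expR (- (2^-1 * x ^+ 2))).
  by apply/funext => y; rewrite std_normal_pdfE; congr (_ * expR _); field.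
rewrite -[X in _ --> X](mulr0 (Num.sqrt (2 * pi))^-1); apply: cvgMr.
apply: (cvg_comp (fun x : R => 2^-1 * x ^+ 2) (fun x => expR (- x))); last exact: cvgr_expR.
apply: gt0_cvgMry; [by rewrite invr_gt0|exact: cvgr_expr2].
Qed.

Lemma std_normal_first_moment (a : R) : 0 <= a ->
  (\int[leb]_(x in `[a, +oo[) (x * phi x)%:E = (phi a)%:E)%E.
Proof.
move=> a0.
have dphi x : derivable phi x 1 by have [] := is_derive_std_normal_pdf x.
have cphi : continuous phi by exact: continuous_normal_pdf (oner_neq0 R).
rewrite (@ge0_continuous_FTC2y R (fun x => x * phi x) (fun x => - phi x) a 0).
- by rewrite sub0e -EFinN opprK.
- by move=> x ax; rewrite mulr_ge0 ?normal_pdf_ge0 // (le_trans a0).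
- by apply: continuous_subspaceT => x; apply: cvgM; [exact: cvg_id|exact: cphi].
- by rewrite -[X in _ --> X]oppr0; apply: cvgN; exact: std_normal_pdf_cvg0.
- by move=> x _; apply: derivableN.
- by apply: cvgN; apply: cvg_at_right_filter; exact: cphi.
- move=> x _; rewrite derive1E; have [_ e] := is_deriveN (is_derive_std_normal_pdf x).
  by rewrite e mulNr opprK.
Qed.

Lemma std_normal_pos_part :
  (\int[N01]_x (Num.max x 0)%:E = ((Num.sqrt (2 * pi))^-1)%:E)%E.
Proof.
have mm : measurable_fun setT (fun x : RR => (Num.max x 0)%:E).
  by apply/measurable_EFinP; exact: measurable_maxr.
rewrite ge0_integral_std_normal //; last by move=> x; rewrite lee_fin le_max lexx orbT.
have := std_normal_first_moment (lexx 0).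
have -> : phi 0 = (Num.sqrt (2 * pi))^-1.
  by rewrite std_normal_pdfE expr0n /= oppr0 mul0r expR0 mulr1.
move=> <-.
rewrite [RHS]integral_mkcond; apply: eq_integral => x _.
rewrite patchE -EFinM; case: (leP 0 x) => x0.
  by rewrite mem_set //= in_itv /= x0.
by rewrite memNset ?mul0r //= in_itv /= andbT; apply/negP; rewrite -ltNge.
Qed.

(** The fourth power is meant for [crossing_bound], where a^2 has order 1/t and the tail becomes
    O(t^2). For x > a >= 1 the density is at most x phi(x), whose integral is explicit. *)
Lemma std_normal_tail (a : R) : 1 <= a ->
  (N01 [set x | (a < `|x|)%R] <= (16 / a ^+ 4)%:E)%E.
Proof.
move=> a1; have a0 : 0 < a by rewrite (lt_le_trans ltr01).
have mphi : measurable_fun setT (fun x : RR => (phi x)%:E).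
  by apply/measurable_EFinP; exact: measurable_normal_pdf.
have half : (N01 `]a, +oo[%classic <= (8 / a ^+ 4)%:E)%E.
  apply: (@le_trans _ _ (\int[leb]_(x in `[a, +oo[) (x * phi x)%:E)%E).
    apply: (@le_trans _ _ (\int[leb]_(x in `]a, +oo[) (x * phi x)%:E)%E).
      apply: ge0_le_integral => //.
      - by move=> x _; rewrite lee_fin normal_pdf_ge0.
      - exact: measurable_funTS.
      - apply/measurable_EFinP/measurable_funTS; apply: measurable_funM => //.
        exact: measurable_normal_pdf.
      - move=> x /=; rewrite in_itv /= andbT => ax.
        by rewrite lee_fin ler_peMl ?normal_pdf_ge0 // (le_trans a1) // ltW.
    apply: ge0_subset_integral => //.
    - apply/measurable_EFinP/measurable_funTS; apply: measurable_funM => //.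
      exact: measurable_normal_pdf.
    - move=> x /=; rewrite in_itv /= andbT => ax.
      by rewrite lee_fin mulr_ge0 ?normal_pdf_ge0 // (le_trans (ltW a0)).
    - by move=> x /=; rewrite !in_itv /= !andbT; exact: ltW.
  rewrite (std_normal_first_moment (ltW a0)) lee_fin std_normal_pdfE.
  have s1 : (Num.sqrt (2 * pi))^-1 <= 1 :> R.
    rewrite invf_le1 ?sqrtr_gt0 ?mulr_gt0 ?pi_gt0 //.
    rewrite -[leLHS]sqrtr1; apply: ler_wsqrtr.
    have := @pi_ge2 R; lra.
  apply: (@le_trans _ _ (1 * expR (- a ^+ 2 / 2))).
    by rewrite ler_wpM2r ?expR_ge0.
  have y0 : 0 <= a ^+ 2 / 2 by rewrite divr_ge0 // sqr_ge0.
  have h := expR_ge1Dxn 1 y0.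
  rewrite mul1r mulNr expRN ler_pdivlMr ?exprn_gt0 // mulrC ler_pdivrMr ?expR_gt0 //.
  apply: le_trans (_ : 8 * (1 + (a ^+ 2 / 2) ^+ 2 / 2) <= _); last first.
    by rewrite ler_pM2l //.
  have -> : a ^+ 4 = (a ^+ 2) ^+ 2 by rewrite -exprM.
  lra.
have mI : measurable (`]a, +oo[%classic : set R) by [].
have -> : [set x | a < `|x|] = `]a, +oo[%classic `|` [set x | `]a, +oo[%classic (- x)].
  by apply/seteqP; split => x /=; rewrite !in_itv /= !andbT ltr_normr; [move=> /orP|move=> /orP].
have mI' : measurable ([set x | `]a, +oo[%classic (- x)] : set RR).
  exact: (measurable_preimage (measurable_funN (@measurable_id _ RR setT)) mI).
apply: le_trans (measureU2 _ _ _) _ => //.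
have -> : 16 / a ^+ 4 = 8 / a ^+ 4 + 8 / a ^+ 4 by rewrite -mulrDl; congr (_ / _); ring.
rewrite EFinD; apply: leeD => //.
by rewrite [leLHS](normal_prob_opp mI).
Qed.

Lemma chi2_pdf_near (m : nat) (x e : R) : (0 < m)%N -> 0 < x -> 0 < e ->
  exists2 d : R, 0 < d & forall y, `|y - x| <= d -> chi2_pdf m y <= chi2_pdf m x + e.
Proof.
move=> m0 x0 e0; have [_ J0] := @chi2_massE R m m0.
(* The formula of the density without the test on the sign of y: continuous at [x], and an upper
   bound everywhere. *)
pose h (y : R) : R := (chi2_mass m)^-1 * (y `^ (m%:R / 2 - 1) * expR (- 2^-1 * y)).
have hx : chi2_pdf m x = h x.
  rewrite chi2_pdfE // /chi2_kernel x0 /h; by congr (_ * (_ * expR _)); field.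
have cp : {for x, continuous (@powR R ^~ (m%:R / 2 - 1))}.
  apply: differentiable_continuous; apply/derivable1_diffP/derivable_powR.
  by rewrite in_itv /= x0.
have ch : h @ x --> h x.
  apply: cvgMr; apply: cvgM; first exact: cp.
  apply: (cvg_comp (fun y => - 2^-1 * y) expR); last exact: continuous_expR.
  by apply: cvgMr; exact: cvg_id.
move/cvgrPdist_lt : ch => /(_ e e0) hnear.
have [d /= d0 hd] : exists2 d : R, 0 < d & forall y, `|x - y| < d -> `|h x - h y| < e.
  by move: hnear => /nbhs_normP [d /= d0 hd]; exists d.
exists (d / 2); first by rewrite divr_gt0.
move=> y yx.
have hy : `|h x - h y| < e.
  apply: hd; rewrite distrC (le_lt_trans yx) //; lra.
have py : chi2_pdf m y <= h y.
  rewrite chi2_pdfE // /chi2_kernel /h; apply: ler_wpM2l; first by rewrite invr_ge0 ltW.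
  case: ifP => _; last by rewrite mulr_ge0 ?powR_ge0 ?expR_ge0.
  by rewrite (_ : - y / 2 = - 2^-1 * y) //; field.
rewrite hx; apply: le_trans py _.
by move: hy; rewrite ltr_norml => /andP[h1 h2]; lra.
Qed.

End Tails.

Section Crossing.
Context d (T : measurableType d) (R : realType) (P : probability T R).
Notation RR := (measurableTypeR R).
Notation leb := (@lebesgue_measure R).
Notation N01 := (normal_prob (0 : R) 1).
Variables (n : nat) (Y Z : nat -> T -> RR).
Hypotheses (n0 : (0 < n)%N) (mY : forall i, measurable_fun setT (Y i))
  (mZ : forall i, measurable_fun setT (Z i)).
Hypothesis iid : forall A B : nat -> set RR, (forall i, measurable (A i)) ->
  (forall i, measurable (B i)) ->
  (P [set w | forall i, (i < n.+1)%N -> A i (Y i w) /\ B i (Z i w)] =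
  \prod_(0 <= i < n.+1) (N01 (A i) * N01 (B i)))%E.

Let S w : RR := \sum_(i < n.+1) Y i w ^+ 2.
Let W := chain_normal Y Z n.
Let mu : probability RR R := sum_sqr_prob n.

Let mS : measurable_fun setT S. Proof. exact: (measurable_sum_sqr mY n). Qed.
Let mW : measurable_fun setT W. Proof. exact: measurable_chain_normal. Qed.

Let law_SW (A B : set RR) : measurable A -> measurable B ->
  (P (S @^-1` A `&` W @^-1` B `&` setT) = mu A * N01 B * P setT)%E.
Proof.
move=> mA mB; have mT : measurable ([set: RR] : set RR) by [].
have := chain_law mY mZ iid (ltnSn n) mA mB (fun=> mT) (fun=> mT).
rewrite big_geq // mule1 => E; rewrite probability_setT mule1 -E.
congr (P _); rewrite setIT; apply/seteqP; split => w /=; last by case.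
by move=> h; split.
Qed.

Let law_Z (i : nat) (B : set RR) : (i < n.+1)%N -> measurable B ->
  P (Z i @^-1` B) = N01 B.
Proof.
move=> im mB; have mT : measurable ([set: RR] : set RR) by [].
pose B' (k : nat) : set RR := if k == i then B else setT.
have mB' k : measurable (B' k) by rewrite /B'; case: eqP.
transitivity (P [set w | forall k, (k < n.+1)%N -> [set: RR] (Y k w) /\ B' k (Z k w)]).
  congr (P _); apply/seteqP; split => w /=.
    by move=> h k _; split => //; rewrite /B'; case: eqP => [->|].
  by move=> /(_ i im)[_]; rewrite /B' eqxx.
rewrite (iid (fun=> mT) mB') big_mkord (bigD1 (Ordinal im)) //= big1.
  by rewrite probability_setT mul1e mule1 /B' eqxx.
move=> k ki; rewrite /B' (_ : (k == i :> nat) = false); first by rewrite !probability_setT mule1.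
by apply/negbTE; apply: contra ki => /eqP ki; apply/eqP/val_inj.
Qed.

Let law_W (B : set RR) : measurable B -> P (W @^-1` B) = N01 B.
Proof.
move=> mB; have := law_SW (@measurableT _ RR) mB.
by rewrite preimage_setT setTI setIT !probability_setT mul1e mule1.
Qed.

(** Expanding the squares gives S + 2 t sqrt S W + t^2 |Z|^2. Unless W or one of the n + 1 variables
    Z_i exceeds [a] in absolute value (the n + 2 tails), a crossing forces S into [b^2 - D(W), b^2[
    with D(W) <= c, where its density is at most [Q]. Independence of S and W bounds this
    probability by Q E[D(W)]. *)
Lemma crossing_estimate (b t a c Q : R) :
  0 < b -> 0 < t -> 1 <= a -> 0 <= Q ->
  2 * t * b * a + t ^+ 2 * n.+1%:R * a ^+ 2 <= c ->
  (forall x, `|x - b ^+ 2| <= c -> chi2_pdf n.+1 x <= Q) ->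
  (P [set w | (\sum_(i < n.+1) Y i w ^+ 2 < b ^+ 2)%R /\
              (b ^+ 2 <= \sum_(i < n.+1) (Y i w + t * Z i w) ^+ 2)%R] <=
   (Q * (2 * t * b * (Num.sqrt (2 * pi))^-1 + t ^+ 2 * n.+1%:R * a ^+ 2)
    + n.+2%:R * (16 / a ^+ 4))%:E)%E.
Proof.
move=> b0 t0 a1 Q0 hc hQ.
have a0 : 0 < a by rewrite (lt_le_trans ltr01).
pose D (w : R) : R := 2 * t * b * Num.max w 0 + t ^+ 2 * n.+1%:R * a ^+ 2.
have M0 (w : R) : 0 <= Num.max w 0 by rewrite le_max lexx orbT.
have tb0 : 0 <= 2 * t * b by rewrite !mulr_ge0 // ltW.
have ta0 : 0 <= t ^+ 2 * n.+1%:R * a ^+ 2 by rewrite mulr_ge0 ?sqr_ge0 // mulr_ge0 ?sqr_ge0.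
have D0 w : 0 <= D w by rewrite addr_ge0 // mulr_ge0.
pose C := [set z : RR * RR | `|z.2| <= a /\ b ^+ 2 - D z.2 <= z.1 < b ^+ 2].
pose tl : set RR := [set x | a < `|x|].
have mabs : measurable_fun setT (fun x : RR => `|x| : RR).
  by apply: measurableT_comp.
have mtl : measurable tl.
  rewrite (_ : tl = (fun x : RR => `|x| : RR) @^-1` `]a, +oo[%classic).
    exact: (measurable_preimage mabs).
  by apply/seteqP; split => x /=; rewrite in_itv /= andbT.
have mD : measurable_fun setT (D : RR -> RR).
  apply: measurable_funD => //; apply: measurable_funM => //.
  exact: measurable_maxr.
have mC : measurable C.
  have msnd : measurable_fun setT (@snd RR RR) by exact: measurable_snd.
  have mfst : measurable_fun setT (@fst RR RR) by exact: measurable_fst.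
  have mf1 : measurable_fun setT (fun z : RR * RR => z.1 + D z.2 : RR).
    by apply: measurable_funD => //; exact: (measurableT_comp mD msnd).
  rewrite (_ : C = (fun z : RR * RR => `|z.2| : RR) @^-1` `]-oo, a]%classic `&`
     ((fun z : RR * RR => z.1 + D z.2 : RR) @^-1` `[b ^+ 2, +oo[%classic `&`
     (@fst RR RR) @^-1` `]-oo, b ^+ 2[%classic)).
    apply: measurableI; first exact: (measurable_preimage (measurableT_comp mabs msnd)).
    by apply: measurableI; [exact: (measurable_preimage mf1)|exact: (measurable_preimage mfst)].
  apply/seteqP; split => z; rewrite /C /= !in_itv /= andbT lerBlDr.
    by move=> [-> /andP[-> ->]].
  by move=> [-> [-> ->]].
pose E1 := (fun w => (S w, W w)) @^-1` C.
pose E2 := W @^-1` tl.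
pose E3 := \big[setU/set0]_(i < n.+1) (Z i @^-1` tl).
have mE1 : measurable E1 by apply: (measurable_preimage (measurable_fun_pair mS mW)).
have mE2 : measurable E2 by exact: (measurable_preimage mW).
have mE3 : measurable E3 by apply: bigsetU_measurable => i _; exact: (measurable_preimage (mZ i)).
have sub : [set w | \sum_(i < n.+1) Y i w ^+ 2 < b ^+ 2 /\
              b ^+ 2 <= \sum_(i < n.+1) (Y i w + t * Z i w) ^+ 2] `<=` E1 `|` (E2 `|` E3).
  move=> w /= [h1 h2].
  have [h3|h3] := pselect (E3 w); first by right; right.
  have [h4|h4] := pselect (E2 w); first by right; left.
  left; have Wa : `|W w| <= a by move/negP: h4; rewrite /E2 /tl /= -leNgt.
  split => //=; rewrite h1 andbT.
  have Za (i : 'I_n.+1) : `|Z i w| <= a.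
    rewrite leNgt; apply/negP => Zi; apply: h3.
    by rewrite /E3 -(bigcup_mkord n.+1 (fun i => Z i @^-1` tl)); exists i => //=.
  have S0 : 0 <= S w by apply: sumr_ge0 => i _; exact: sqr_ge0.
  have Sb : Num.sqrt (S w) <= b.
    by rewrite -(ger0_norm (ltW b0)) -sqrtr_sqr; apply: ler_wsqrtr; exact: ltW.
  have e : \sum_(i < n.+1) (Y i w + t * Z i w) ^+ 2 =
      S w + 2 * t * (Num.sqrt (S w) * W w) + t ^+ 2 * \sum_(i < n.+1) Z i w ^+ 2.
    rewrite (chain_normalE Y Z n w) !mulr_sumr -!big_split /=.
    by apply: eq_bigr => i _; ring.
  have Z2 : \sum_(i < n.+1) Z i w ^+ 2 <= n.+1%:R * a ^+ 2.
    rewrite mulr_natl -[X in _ *+ X](card_ord n.+1) -sumr_const.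
    by apply: ler_sum => i _; rewrite -(real_normK (num_real _)) lerXn2r ?nnegrE // ltW.
  (* As S < b^2, the factor sqrt S can be enlarged to b once W is replaced by its positive part. *)
  have SW : Num.sqrt (S w) * W w <= b * Num.max (W w) 0.
    apply: (@le_trans _ _ (Num.sqrt (S w) * Num.max (W w) 0)).
      by rewrite ler_wpM2l ?sqrtr_ge0 // le_max lexx.
    by rewrite ler_wpM2r.
  move: h2; rewrite e /D => h2.
  have k1 : 2 * t * (Num.sqrt (S w) * W w) <= 2 * t * (b * Num.max (W w) 0).
    by rewrite ler_wpM2l // mulr_ge0 // ltW.
  have k2 : t ^+ 2 * \sum_(i < n.+1) Z i w ^+ 2 <= t ^+ 2 * (n.+1%:R * a ^+ 2).
    by rewrite ler_wpM2l // sqr_ge0.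
  lra.
have tail := std_normal_tail a1.
have P2 : (P E2 <= (16 / a ^+ 4)%:E)%E by rewrite /E2 law_W.
have P3 : (P E3 <= (n.+1%:R * (16 / a ^+ 4))%:E)%E.
  have mZi i : measurable (Z i @^-1` tl) by exact: (measurable_preimage (mZ i)).
  apply: (le_trans (@Boole_inequality _ _ _ P (fun i => Z i @^-1` tl) n.+1 _)) => //.
  apply: (@le_trans _ _ (\sum_(i < n.+1) (16 / a ^+ 4)%:E)%E).
    apply: lee_sum => i _; apply: le_trans tail.
    by have /eqP := law_Z (ltn_ord i) mtl; rewrite eq_le => /andP[].
  by rewrite sumEFin lee_fin sumr_const card_ord -[X in X <= _]mulr_natl.
have P1 : (P E1 <= (Q * (2 * t * b * (Num.sqrt (2 * pi))^-1 + t ^+ 2 * n.+1%:R * a ^+ 2))%:E)%E.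
  have := joint_law (mu1 := mu) (mu2 := N01) mS mW measurableT law_SW mC.
  rewrite setIT probability_setT mule1 => ->.
  rewrite product_probabilityE //.
  pose F (z : RR * RR) : \bar R := (\1_C z)%:E.
  have mF : measurable_fun setT F by apply/measurable_EFinP; exact: measurable_indic.
  have F0 z : (0 <= F z)%E by rewrite lee_fin.
  rewrite [leLHS](@fubini_tonelli _ _ RR RR R mu N01 F mF F0).
  apply: (@le_trans _ _ (\int[N01]_w (Q * D w)%:E)%E).
    apply: ge0_le_integral => //.
    - by move=> w _; exact: integral_ge0.
    - exact: (@measurable_fun_fubini_tonelli_G _ _ RR RR R mu F mF F0).
    - by apply/measurable_EFinP; exact: measurable_funM.
    move=> w _ /=.
    have [wa|wa] := leP `|w| a; last first.
      rewrite integral0_eq ?lee_fin ?mulr_ge0 // => s _.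
      by rewrite /F indicE memNset // => -[/=]; rewrite leNgt wa.
    have mI : measurable (`[(b ^+ 2 - D w), (b ^+ 2)[%classic : set RR) by [].
    have -> : (\int[mu]_s F (s, w) = mu `[(b ^+ 2 - D w)%R, (b ^+ 2)%R[%classic)%E.
      rewrite -(integral_indicT mu mI); apply: eq_integral => s _; congr _%:E.
      rewrite !indicE; congr (_ %:R); congr nat_of_bool.
      apply/idP/idP; rewrite !inE /C /= in_itv /=; first by case.
      by move=> h; split.
    rewrite [leLHS](sum_sqr_prob_pdf (m := n.+1)) //.
    have Dc : D w <= c.
      apply: le_trans hc; rewrite lerD2r; apply: ler_wpM2l => //.
      by rewrite ge_max (le_trans (ler_norm _) wa) ltW.
    apply: (@le_trans _ _ (\int[leb]_(s in `[(b ^+ 2 - D w)%R, (b ^+ 2)%R[) Q%:E)%E).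
      apply: ge0_le_integral => //.
      - by move=> s _; rewrite lee_fin chi2_pdfE // mulr_ge0 ?chi2_kernel_ge0 // invr_ge0 ltW // (chi2_massE _).2.
      - apply/measurable_EFinP/measurable_funTS.
        rewrite (_ : chi2_pdf n.+1 = (fun x => (chi2_mass n.+1)^-1 * chi2_kernel n.+1 x)).
          by apply: measurable_funM => //; exact: measurable_chi2_kernel.
        by apply/funext => x; rewrite chi2_pdfE.
      - move=> s /=; rewrite in_itv /= => /andP[s1 s2]; rewrite lee_fin; apply: hQ.
        rewrite ler_norml; apply/andP; split; lra.
    have L : (leb `[(b ^+ 2 - D w)%R, (b ^+ 2)%R[%classic <= (D w)%:E)%E.
      rewrite lebesgue_measure_itv /= lte_fin; case: ifP => _; last by rewrite lee_fin.
      by rewrite -EFinB lee_fin opprB addrCA subrr addr0.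
    rewrite integral_cst // EFinM.
    by apply: lee_wpmul2l => //; rewrite lee_fin.
  have mmax : measurable_fun setT (fun x : RR => (Num.max x 0)%:E).
    by apply/measurable_EFinP; exact: measurable_maxr.
  have -> : (\int[N01]_w (Q * D w)%:E = \int[N01]_w ((Q * (2 * t * b))%:E * (Num.max w 0)%:E
     + (Q * (t ^+ 2 * n.+1%:R * a ^+ 2))%:E))%E.
    by apply: eq_integral => w _; rewrite -EFinM -EFinD; congr _%:E; rewrite /D; ring.
  rewrite ge0_integralD //; last 3 first.
  - by move=> x _; rewrite mule_ge0 ?lee_fin // mulr_ge0.
  - by apply: emeasurable_funM.
  - by move=> x _; rewrite lee_fin mulr_ge0.
  rewrite ge0_integralZl //; last 2 first.
  - by move=> x _; rewrite lee_fin.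
  - by rewrite lee_fin mulr_ge0.
  rewrite std_normal_pos_part integral_cst // [X in (_ + _ * X)%E]probability_setT mule1.
  rewrite -EFinM -EFinD lee_fin le_eqVlt; apply/orP; left; apply/eqP; ring.
have mE : measurable [set w | \sum_(i < n.+1) Y i w ^+ 2 < b ^+ 2 /\
              b ^+ 2 <= \sum_(i < n.+1) (Y i w + t * Z i w) ^+ 2].
  have mS2 : measurable_fun setT (fun w => \sum_(i < n.+1) (Y i w + t * Z i w) ^+ 2 : RR).
    apply: measurable_sum => i; apply: measurable_funX; apply: measurable_funD; first exact: mY.
    by apply: measurable_funM => //; exact: mZ.
  rewrite (_ : [set w | _] = S @^-1` `]-oo, b ^+ 2[%classic `&`
    (fun w => \sum_(i < n.+1) (Y i w + t * Z i w) ^+ 2 : RR) @^-1` `[b ^+ 2, +oo[%classic).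
    by apply: measurableI; [exact: (measurable_preimage mS)|exact: (measurable_preimage mS2)].
  by apply/seteqP; split => w /=; rewrite !in_itv /= andbT.
apply: (@le_trans _ _ (P (E1 `|` (E2 `|` E3)))).
  by apply: le_measure => //; rewrite inE; do ?[exact: measurableU|apply: measurableU].
apply: le_trans (measureU2 _ _ _) _ => //; first exact: measurableU.
rewrite EFinD; apply: leeD => //.
apply: le_trans (measureU2 _ _ _) _ => //.
have -> : n.+2%:R * (16 / a ^+ 4) = 16 / a ^+ 4 + n.+1%:R * (16 / a ^+ 4) by rewrite -(natr1 n.+1); ring.
by rewrite EFinD; apply: leeD.
Qed.

End Crossing.

Section CrossingRate.
Context {R : realType}.

(** [delta] comes before the probability space and the variables: the estimate is uniform over all
    pairs of directions. The oscillation of the density, the second-order term and the tails each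
    cost at most (e/4) t. *)
Lemma crossing_bound (n : nat) (b e : R) : (0 < n)%N -> 0 < b -> 0 < e ->
  exists2 delta : R, 0 < delta & forall t, 0 < t -> t <= delta ->
  forall d (T : measurableType d) (P : probability T R) (Y Z : nat -> T -> measurableTypeR R),
  (forall i, measurable_fun setT (Y i)) -> (forall i, measurable_fun setT (Z i)) ->
  (forall A B : nat -> set (measurableTypeR R), (forall i, measurable (A i)) ->
    (forall i, measurable (B i)) ->
    (P [set w | forall i, (i < n.+1)%N -> A i (Y i w) /\ B i (Z i w)] =
    \prod_(0 <= i < n.+1) (normal_prob (0 : R) 1 (A i) * normal_prob (0 : R) 1 (B i)))%E) ->
  (P [set w | (\sum_(i < n.+1) Y i w ^+ 2 < b ^+ 2)%R /\
              (b ^+ 2 <= \sum_(i < n.+1) (Y i w + t * Z i w) ^+ 2)%R] <=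
   ((crossing_rate n.+1 b + e) * t)%:E)%E.
Proof.
move=> n0 b0 e0.
have b20 : 0 < b ^+ 2 by rewrite exprn_gt0.
pose e1 := e / (8 * b); have e10 : 0 < e1 by rewrite divr_gt0 // mulr_gt0.
have [c c0 hc] := chi2_pdf_near (isT : (0 < n.+1)%N) b20 e10.
pose q := chi2_pdf n.+1 (b ^+ 2).
have q0 : 0 <= q.
  by rewrite /q chi2_pdfE // mulr_ge0 ?chi2_kernel_ge0 // invr_ge0 ltW // (chi2_massE _).2.
pose Q := q + e1; have Q0 : 0 < Q by rewrite ltr_wpDl.
pose k : R := n.+1%:R; have k0 : 0 < k by rewrite ltr0n.
pose eta := e / (4 * Q * k); have eta0 : 0 < eta by rewrite divr_gt0 // !mulr_gt0.
(* With a^2 = eta / t: [d1] gives a >= 1, [d2] and [d3] bound each of the two summands of the window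
   by c/2, and [d4] bounds the tails by (e/4) t. Above, [e1] and [eta] are tuned so that e1 (2 b)
   and Q k eta both equal e/4. *)
pose d1 := eta; pose d2 := c ^+ 2 / (16 * b ^+ 2 * eta).
pose d3 := c / (2 * k * eta); pose d4 := e * eta ^+ 2 / (64 * (k + 1)).
have d20 : 0 < d2.
  by apply: divr_gt0; [rewrite exprn_gt0|apply: mulr_gt0 => //; apply: mulr_gt0].
have d30 : 0 < d3 by apply: divr_gt0 => //; apply: mulr_gt0 => //; apply: mulr_gt0.
have d40 : 0 < d4.
  by apply: divr_gt0; apply: mulr_gt0 => //; [rewrite exprn_gt0|rewrite addr_gt0].
exists (Num.min (Num.min d1 d2) (Num.min d3 d4)); first by rewrite !lt_min eta0 d20 d30.
move=> t t0; rewrite !le_min => /andP[/andP[td1 td2] /andP[td3 td4]].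
move=> d T P Y Z mY mZ iid.
pose a := Num.sqrt (eta / t).
have et0 : 0 < eta / t by rewrite divr_gt0.
have a2 : a ^+ 2 = eta / t by rewrite sqr_sqrtr // ltW.
have a1 : 1 <= a by rewrite -sqrtr1; apply: ler_wsqrtr; rewrite ler_pdivlMr // mul1r.
have a0 : 0 < a by rewrite (lt_le_trans ltr01).
have tka : t ^+ 2 * k * a ^+ 2 = t * (k * eta) by rewrite a2; field; rewrite gt_eqF.
have h3 : t * (k * eta) <= c / 2.
  apply: (@le_trans _ _ (d3 * (k * eta))); first by rewrite ler_pM2r // mulr_gt0.
  by rewrite /d3 le_eqVlt; apply/orP; left; apply/eqP; field; rewrite !gt_eqF.
have h2 : 2 * t * b * a <= c / 2.
  have ta : (t * a) ^+ 2 = t * eta by rewrite exprMn a2; field; rewrite gt_eqF.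
  have tac : t * a <= c / (4 * b).
    have ta0 : 0 <= t * a by rewrite ltW // mulr_gt0.
    have cb0 : 0 <= c / (4 * b) by rewrite ltW // divr_gt0 // mulr_gt0.
    have : (t * a) ^+ 2 <= (c / (4 * b)) ^+ 2.
      rewrite ta; apply: (@le_trans _ _ (d2 * eta)); first by rewrite ler_pM2r.
      by rewrite /d2 le_eqVlt; apply/orP; left; apply/eqP; field; rewrite !gt_eqF.
    by rewrite ler_pXn2r.
  have -> : 2 * t * b * a = 2 * b * (t * a) by ring.
  apply: (@le_trans _ _ (2 * b * (c / (4 * b)))); first by rewrite ler_pM2l // mulr_gt0.
  by rewrite le_eqVlt; apply/orP; left; apply/eqP; field; rewrite gt_eqF.
have hc' : 2 * t * b * a + t ^+ 2 * n.+1%:R * a ^+ 2 <= c.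
  by rewrite -/k tka; lra.
apply: (le_trans (crossing_estimate n0 mY mZ iid b0 t0 a1 (ltW Q0) hc' hc)).
rewrite lee_fin -/k tka -(natr1 n.+1) -/k /crossing_rate -/q.
set s := Num.sqrt (2 * pi).
have s1 : 1 <= s.
  rewrite -sqrtr1; apply: ler_wsqrtr; have := @pi_ge2 R; lra.
have s0 : 0 < s by rewrite (lt_le_trans ltr01).
have a4 : a ^+ 4 = (eta / t) ^+ 2 by rewrite -a2 -exprM.
have p1 : e1 * (2 * b) / s <= e / 4.
  rewrite ler_pdivrMr // (_ : e1 * (2 * b) = e / 4); last by rewrite /e1; field; rewrite gt_eqF.
  by rewrite ler_peMr // divr_ge0 // ltW.
have p2 : Q * (k * eta) = e / 4 by rewrite /eta; field; rewrite !gt_eqF.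
have p3 : (k + 1) * (16 / a ^+ 4) <= e / 4 * t.
  rewrite a4 (_ : _ * (16 / _) = 16 * (k + 1) / eta ^+ 2 * t * t); last first.
    by field; rewrite !gt_eqF.
  rewrite ler_pM2r //.
  apply: (@le_trans _ _ (16 * (k + 1) / eta ^+ 2 * d4)).
    by rewrite ler_wpM2l // divr_ge0 ?sqr_ge0 // mulr_ge0 // addr_ge0 // ltW.
  rewrite /d4 le_eqVlt; apply/orP; left; apply/eqP; field.
  by rewrite !gt_eqF // addr_gt0.
apply: le_trans (lerD (lexx _) p3) _.
have -> : Q * (2 * t * b / s + t * (k * eta)) =
    t * (2 * b * q / s) + t * (e1 * (2 * b) / s) + t * (Q * (k * eta)).
  by rewrite /Q; field; rewrite gt_eqF.
rewrite p2.
have p1t : t * (e1 * (2 * b) / s) <= t * (e / 4) by rewrite ler_pM2l.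
have -> : (2 * b * q / s + e) * t = t * (2 * b * q / s) + e * t by ring.
have et : 0 < e * t by rewrite mulr_gt0.
lra.
Qed.

End CrossingRate.

(** * Scalar products and blocks of a tensor product *)

Section Edot.
Context {R : realType}.
Implicit Types n : nat.

Lemma edotC n (u v : 'cV[R]_n) : edot u v = edot v u.
Proof. by apply: eq_bigr => i _; rewrite mulrC. Qed.

Lemma edotDr n (w u v : 'cV[R]_n) : edot w (u + v) = edot w u + edot w v.
Proof. by rewrite /edot -big_split; apply: eq_bigr => i _; rewrite mxE mulrDr. Qed.

Lemma edotZr n (a : R) (w u : 'cV[R]_n) : edot w (a *: u) = a * edot w u.
Proof. by rewrite /edot mulr_sumr; apply: eq_bigr => i _; rewrite mxE mulrCA. Qed.

Lemma edotNr n (w u : 'cV[R]_n) : edot w (- u) = - edot w u.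
Proof. by rewrite -scaleN1r edotZr mulN1r. Qed.

Lemma edotDl n (w u v : 'cV[R]_n) : edot (u + v) w = edot u w + edot v w.
Proof. by rewrite edotC edotDr !(edotC w). Qed.

Lemma edotZl n (a : R) (w u : 'cV[R]_n) : edot (a *: u) w = a * edot u w.
Proof. by rewrite edotC edotZr (edotC w). Qed.

Lemma edotNl n (w u : 'cV[R]_n) : edot (- u) w = - edot u w.
Proof. by rewrite edotC edotNr (edotC w). Qed.

Lemma edot_ge0 n (u : 'cV[R]_n) : 0 <= edot u u.
Proof. by apply: sumr_ge0 => i _; rewrite -expr2 sqr_ge0. Qed.

Lemma enorm_ge0 n (u : 'cV[R]_n) : 0 <= enorm u.
Proof. exact: sqrtr_ge0. Qed.

Lemma enorm_sqr n (u : 'cV[R]_n) : enorm u ^+ 2 = edot u u.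
Proof. by rewrite sqr_sqrtr // edot_ge0. Qed.

Lemma sphereP n (u : 'cV[R]_n) : sphere n u <-> edot u u = 1.
Proof.
rewrite /sphere /= -enorm_sqr; split => [->|e]; first by rewrite expr1n.
by apply/eqP; rewrite -(@eqrXn2 _ 2) ?enorm_ge0 // e expr1n.
Qed.

Lemma edot_eq0 n (u : 'cV[R]_n) : edot u u = 0 -> u = 0.
Proof.
move=> e; apply/colP => i; rewrite mxE; apply/eqP.
have /eqP := e; rewrite psumr_eq0 => [/allP /(_ i)|j _]; last by rewrite -expr2 sqr_ge0.
by rewrite mem_index_enum => /(_ isT) /=; rewrite -expr2 sqrf_eq0.
Qed.

Lemma edot_tens m p (h h' : 'cV[R]_m) (u u' : 'cV[R]_p) :
  edot (h *t u : 'cV[R]_(m * p)) (h' *t u' : 'cV[R]_(m * p)) = edot h h' * edot u u'.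
Proof.
rewrite /edot mulr_sum; apply: eq_bigr => k _; rewrite !mxE.
by rewrite !(ord1 (mxtens_unindex _).1) !(ord1 (mxtens_unindex _).2) mulrACA.
Qed.

(* The [i]-th block of a vector of R^m (x) R^p, contracted with [u]. *)
Definition block_dot m p (v : 'cV[R]_(m * p)) (u : 'cV[R]_p) (i : nat) : R :=
  edot v ((\col_(j < m) (j == i :> nat)%:R) *t u : 'cV[R]_(m * p)).

Definition block_sqnorm m p (v : 'cV[R]_(m * p)) (u : 'cV[R]_p) : R :=
  \sum_(i < m) block_dot v u i ^+ 2.

Lemma tensDr m p (h : 'cV[R]_m) (u u' : 'cV[R]_p) (a a' : R) :
  (h *t (a *: u + a' *: u')) = a *: (h *t u) + a' *: (h *t u') :> 'cV[R]_(m * p).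
Proof. by apply/matrixP => i j; rewrite !mxE; ring. Qed.

Lemma edot_tensE m p (v : 'cV[R]_(m * p)) (h : 'cV[R]_m) (u : 'cV[R]_p) :
  edot v (h *t u : 'cV[R]_(m * p)) = \sum_(i < m) h i 0 * block_dot v u i.
Proof.
rewrite /block_dot /edot; under [RHS]eq_bigr do rewrite mulr_sumr.
rewrite exchange_big /=; apply: eq_bigr => k _.
rewrite mxE !(ord1 (mxtens_unindex _).1) !(ord1 (mxtens_unindex _).2).
rewrite (bigD1 (mxtens_unindex k).1) //= big1 ?addr0; last first.
  move=> i ik; rewrite !mxE (_ : (_ == _ :> nat) = false) ?mul0r ?mulr0 //.
  by apply/negbTE; apply: contra ik => /eqP ik; apply/eqP/val_inj.
rewrite !mxE eqxx mul1r !(ord1 (mxtens_unindex _).2); ring.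
Qed.

Lemma block_dot_lin m p (v : 'cV[R]_(m * p)) (u u' : 'cV[R]_p) (a a' : R) i :
  block_dot v (a *: u + a' *: u') i = a * block_dot v u i + a' * block_dot v u' i.
Proof. by rewrite /block_dot tensDr edotDr !edotZr. Qed.

Lemma block_sqnorm_ge0 m p (v : 'cV[R]_(m * p)) (u : 'cV[R]_p) : 0 <= block_sqnorm v u.
Proof. by apply: sumr_ge0 => i _; exact: sqr_ge0. Qed.

Lemma block_sqnormE m p (v : 'cV[R]_(m * p)) (u : 'cV[R]_p) :
  block_sqnorm v u = edot (\col_(i < m) block_dot v u i) (\col_(i < m) block_dot v u i).
Proof. by apply: eq_bigr => i _; rewrite !mxE expr2. Qed.

Lemma edot_CS n (u v : 'cV[R]_n) : edot u v ^+ 2 <= edot u u * edot v v.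
Proof.
have [u0|u0] := eqVneq (edot u u) 0.
  have -> := edot_eq0 u0; rewrite (_ : edot 0 v = 0) ?expr0n ?mulr_ge0 ?edot_ge0 //.
  by rewrite /edot big1 // => i _; rewrite mxE mul0r.
have up : 0 < edot u u by rewrite lt_neqAle eq_sym u0 edot_ge0.
have := edot_ge0 (v - (edot u v / edot u u) *: u).
rewrite edotDl !edotDr !edotNl !edotNr !edotZl !edotZr (edotC v u) => h.
have := mulr_ge0 (ltW up) h; rewrite -[edot u v ^+ 2 <= _]subr_ge0.
by congr (0 <= _); field.
Qed.

Lemma edot_tens_le m p (v : 'cV[R]_(m * p)) (h : 'cV[R]_m) (u : 'cV[R]_p) :
  sphere m h -> edot v (h *t u : 'cV[R]_(m * p)) <= Num.sqrt (block_sqnorm v u).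
Proof.
move=> /sphereP h1.
have -> : edot v (h *t u : 'cV[R]_(m * p)) = edot h (\col_(i < m) block_dot v u i).
  by rewrite edot_tensE; apply: eq_bigr => i _; rewrite mxE.
apply: le_trans (ler_norm _) _; rewrite -sqrtr_sqr; apply: ler_wsqrtr.
by apply: le_trans (edot_CS _ _) _; rewrite h1 mul1r block_sqnormE.
Qed.

Lemma edot_tens_attained m p (v : 'cV[R]_(m.+1 * p)) (u : 'cV[R]_p) :
  exists2 h, sphere m.+1 h &
    edot v (h *t u : 'cV[R]_(m.+1 * p)) = Num.sqrt (block_sqnorm v u).
Proof.
pose y : 'cV[R]_m.+1 := \col_(i < m.+1) block_dot v u i.
have E (h : 'cV[R]_m.+1) : edot v (h *t u : 'cV[R]_(m.+1 * p)) = edot h y.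
  by rewrite edot_tensE; apply: eq_bigr => i _; rewrite mxE.
rewrite block_sqnormE -/y -/(enorm y).
have [y0|y0] := eqVneq (enorm y) 0.
  exists (delta_mx 0 0); first by apply/sphereP; rewrite edot_delta mxE !eqxx.
  rewrite E y0 (_ : y = 0); last by apply: edot_eq0; rewrite -enorm_sqr y0 expr0n.
  by rewrite /edot big1 // => i _; rewrite [X in _ * X]mxE mulr0.
exists ((enorm y)^-1 *: y).
  apply/sphereP; rewrite edotZl edotZr -enorm_sqr; field.
  exact: y0.
by rewrite E edotZl -enorm_sqr; field.
Qed.

End Edot.

(** A normalised quarter turn of the first two coordinates of [u]; if both vanish, the first
    coordinate vector is already orthogonal to [u]. *)
Lemma exists_orthonormal_pair (R : realType) p (u : 'cV[R]_p) : (1 < p)%N ->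
  edot u u = 1 -> exists u', edot u' u' = 1 /\ edot u u' = 0.
Proof.
case: p u => [|[|p]] // u _ u1.
pose i0 : 'I_p.+2 := ord0; pose i1 : 'I_p.+2 := lift ord0 ord0.
have i01 : i1 != i0 by [].
have E (a b : R) (v : 'cV[R]_p.+2) :
    edot v (a *: delta_mx i0 0 + b *: delta_mx i1 0) = a * v i0 0 + b * v i1 0.
  by rewrite edotDr !edotZr !edot_delta.
have [r0|r0] := eqVneq (u i0 0 ^+ 2 + u i1 0 ^+ 2) 0.
  exists (delta_mx i0 0); rewrite !edot_delta mxE !eqxx; split => //.
  have := sqr_ge0 (u i0 0); have := sqr_ge0 (u i1 0) => h1 h0.
  by apply/eqP; rewrite -sqrf_eq0; apply/eqP; lra.
have rp : 0 < u i0 0 ^+ 2 + u i1 0 ^+ 2.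
  by rewrite lt_neqAle eq_sym r0 addr_ge0 // sqr_ge0.
pose r := Num.sqrt (u i0 0 ^+ 2 + u i1 0 ^+ 2).
have r2 : r ^+ 2 = u i0 0 ^+ 2 + u i1 0 ^+ 2 by rewrite sqr_sqrtr // ltW.
have rn : r != 0 by rewrite gt_eqF // sqrtr_gt0.
exists ((- u i1 0 / r) *: delta_mx i0 0 + (u i0 0 / r) *: delta_mx i1 0).
rewrite !E; split; last by field.
rewrite !mxE !eqxx /= !mulr0 !mulr1 addr0 add0r.
have -> : - u i1 0 / r * (- u i1 0 / r) + u i0 0 / r * (u i0 0 / r) =
    (u i0 0 ^+ 2 + u i1 0 ^+ 2) / r ^+ 2 by field.
by rewrite r2 divff.
Qed.

Lemma big_nat_pairs (A : Type) (idx : A) (op : Monoid.com_law idx) (F : nat -> A) m :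
  \big[op/idx]_(0 <= a < m * 2) F a = \big[op/idx]_(0 <= i < m) op (F i.*2) (F i.*2.+1).
Proof.
elim: m => [|m IH]; first by rewrite mul0n !big_geq.
rewrite mulSn add2n [RHS]big_nat_recr //= -IH.
by rewrite big_nat_recr //= big_nat_recr //= muln2 Monoid.mulmA.
Qed.

Section BlockLaw.
Context d (T : measurableType d) (R : realType) (P : probability T R).
Notation RR := (measurableTypeR R).
Notation N01 := (normal_prob (0 : R) 1).
Variables (n p : nat) (xi : T -> 'cV[R]_(n.+1 * p)).
Hypotheses (n0 : (0 < n)%N) (p1 : (1 < p)%N) (hxi : std_normal_vector P xi).

Lemma measurable_edot (v : 'cV[R]_(n.+1 * p)) :
  measurable_fun setT (fun w => edot (xi w) v : RR).
Proof.
by apply: measurable_sum => i; apply: measurable_funM => //; exact: hxi.1.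
Qed.

Lemma measurable_block_dot u i : measurable_fun setT (fun w => block_dot (xi w) u i : RR).
Proof. exact: measurable_edot. Qed.

Lemma measurable_block_sqnorm u : measurable_fun setT (fun w => block_sqnorm (xi w) u : RR).
Proof. by apply: measurable_sum => i; apply: measurable_funX; exact: measurable_block_dot. Qed.

(** The tensors of the coordinate vectors e_i with [u] and [u'], interleaved at the indices 2 i and
    2 i + 1, form an orthonormal family; its 2 (n + 1) members fit in dimension (n + 1) p because p
    >= 2. *)
Lemma block_dot_iid (u u' : 'cV[R]_p) : edot u u = 1 -> edot u' u' = 1 -> edot u u' = 0 ->
  forall A B : nat -> set RR, (forall i, measurable (A i)) -> (forall i, measurable (B i)) ->
  (P [set w | forall i, (i < n.+1)%N -> A i (block_dot (xi w) u i) /\ B i (block_dot (xi w) u' i)] =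
  \prod_(0 <= i < n.+1) (N01 (A i) * N01 (B i)))%E.
Proof.
move=> u1 u'1 uu' A B mA mB.
have hq : (n.+1 * 2 <= n.+1 * p)%N by rewrite leq_mul2l p1 orbT.
pose e (i : nat) : 'cV[R]_n.+1 := \col_j (j == i :> nat)%:R.
pose f (a : nat) : 'cV[R]_p := if odd a then u' else u.
pose v (a : 'I_(n.+1 * 2)) : 'cV[R]_(n.+1 * p) := e a./2 *t f a.
have half_lt (a : 'I_(n.+1 * 2)) : (a./2 < n.+1)%N.
  by rewrite ltn_half_double -muln2.
have vv a b : edot (v a) (v b) = (a == b)%:R.
  rewrite edot_tens.
  have -> : edot (e a./2) (e b./2) = (a./2 == b./2)%:R.
    rewrite /edot (bigD1 (Ordinal (half_lt a))) //= !mxE eqxx mul1r big1 ?addr0 // => i ia.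
    rewrite !mxE (_ : (i == a./2 :> nat) = false) ?mul0r //.
    by apply/negbTE; apply: contra ia => /eqP ia; apply/eqP/val_inj.
  have -> : edot (f a) (f b) = (odd a == odd b)%:R.
    by rewrite /f; case: (odd a); case: (odd b); rewrite ?u1 ?u'1 ?uu' ?(edotC u') ?uu'.
  rewrite -natrM mulnb; congr (_ %:R); congr nat_of_bool.
  apply/andP/eqP => [[/eqP h1 /eqP h2]|->]; last by rewrite !eqxx.
  by apply: val_inj => /=; rewrite -(odd_double_half a) -(odd_double_half b) h1 h2.
have [meta law] := std_normal_orthonormal hq vv hxi.
pose C (a : nat) : set RR := if odd a then B a./2 else A a./2.
have mC a : measurable (C a) by rewrite /C; case: odd.
have := law (fun a : 'I_(n.+1 * 2) => C a) (fun a => mC a).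
rewrite -(big_mkord xpredT (fun a => N01 (C a))) big_nat_pairs => E.
transitivity (\prod_(0 <= i < n.+1) (N01 (C i.*2) * N01 (C i.*2.+1)))%E; last first.
  by apply: eq_big_nat => i _; rewrite /C /= odd_double /= doubleK uphalf_double.
rewrite -[RHS]E; congr (P _); apply/seteqP; split => w /= h.
  move=> a; rewrite mxE /v /f /C.
  by have [] := h _ (half_lt a); case: (odd a).
move=> i im.
have lt0 : (i.*2 < n.+1 * 2)%N by rewrite muln2 ltn_double.
have lt1 : (i.*2.+1 < n.+1 * 2)%N by rewrite muln2 ltn_Sdouble.
split.
  by have := h (Ordinal lt0); rewrite mxE /v /f /C /= odd_double doubleK.
by have := h (Ordinal lt1); rewrite mxE /v /f /C /= odd_double /= uphalf_double.
Qed.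

(** An auxiliary orthogonal direction provides the second sequence that [chain_law] expects; W is
    then left unconstrained. *)
Lemma block_sqnorm_law (u : 'cV[R]_p) (t : R) : edot u u = 1 ->
  P [set w | t <= block_sqnorm (xi w) u] = (chi2_upper n.+1 t)%:E.
Proof.
move=> u1; have [u' [u'1 uu']] := exists_orthonormal_pair p1 u1.
have mT : measurable ([set: RR] : set RR) by [].
have mI : measurable (`[t, +oo[%classic : set RR) by [].
have iid := block_dot_iid u1 u'1 uu'.
have := chain_law (measurable_block_dot u) (measurable_block_dot u') iid (ltnSn n) mI mT (fun=> mT) (fun=> mT).
rewrite big_geq // mule1 probability_setT mule1 chi2_upperE // => <-.
congr (P _); apply/seteqP; split => w /=; rewrite in_itv /= andbT; last by case=> [[]].
by move=> h; split.
Qed.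

End BlockLaw.

(** With v = a u + s u' and t = s / a, the blocks of [v] are a (Y + t Z). Since 0 < a <= 1, the
    event for [v] implies |Y + t Z| >= b, which is the event of [crossing_bound]. *)
Lemma block_crossing (R : realType) (n p : nat) (b e : R) :
  (0 < n)%N -> (1 < p)%N -> 0 < b -> 0 < e ->
  exists2 delta : R, 0 < delta &
  forall d (T : measurableType d) (P : probability T R) (xi : T -> 'cV[R]_(n.+1 * p)),
  std_normal_vector P xi ->
  forall u v : 'cV[R]_p, edot u u = 1 -> edot v v = 1 -> enorm (u - v) < delta ->
  (P ([set w | (b ^+ 2 <= block_sqnorm (xi w) v)%R] `\`
      [set w | (b ^+ 2 <= block_sqnorm (xi w) u)%R]) <=
   ((crossing_rate n.+1 b + e) * enorm (u - v))%:E)%E.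
Proof.
move=> n0 p1 b0 e0.
have e20 : 0 < e / 2 by rewrite divr_gt0.
have [c c0 hc] := crossing_bound n0 b0 e20.
set r := crossing_rate n.+1 b in hc *.
have r0 : 0 <= r.
  rewrite /r /crossing_rate chi2_pdfE // divr_ge0 ?sqrtr_ge0 // mulr_ge0 //.
    by rewrite mulr_ge0 // ltW.
  by rewrite mulr_ge0 ?chi2_kernel_ge0 // invr_ge0 ltW // (chi2_massE _).2.
have re0 : 0 < r + e by rewrite ltr_wpDl.
(* Chosen so that (r + e) (1 - k/2) = r + e/2: half of [e] pays for replacing t by the chord,
   through t (1 - k/2) <= |u - v|. *)
pose k := e / (r + e).
have k0 : 0 < k by rewrite divr_gt0.
have k1 : k <= 1 by rewrite ler_pdivrMr // mul1r ler_wpDl.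
(* As k <= 1, t is at most twice the chord, whence c / 2. *)
exists (Num.min (c / 2) k); first by rewrite lt_min k0 andbT divr_gt0.
move=> d T P xi hxi u v u1 v1; set D := enorm (u - v); rewrite lt_min => /andP[Dc Dk].
have D0 : 0 <= D by exact: enorm_ge0.
pose a := edot u v.
have D2 : D ^+ 2 = 2 - 2 * a.
  by rewrite enorm_sqr edotDl !edotDr !edotNl !edotNr u1 v1 (edotC v) -/a; ring.
have D21 : D ^+ 2 <= k * D.
  by rewrite expr2 ler_wpM2r // ltW.
have Dk' : D ^+ 2 <= k.
  by apply: le_trans D21 _; rewrite ler_piMr // ltW // (lt_le_trans Dk).
have a_gt : 1 - k / 2 <= a by lra.
have a0 : 0 < a by lra.
have a1 : a ^+ 2 <= 1 by have := edot_CS u v; rewrite u1 v1 mulr1.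
pose s2 := 1 - a ^+ 2.
(* Parallel directions leave no [u']; as a > 0 they coincide and the difference of events is
   empty. *)
have [s20|s2n] := eqVneq s2 0.
  have vau : v = a *: u.
    apply/eqP; rewrite -subr_eq0; apply/eqP/edot_eq0.
    rewrite edotDl !edotDr !edotNl !edotNr !edotZl !edotZr u1 v1 (edotC v) -/a.
    by rewrite /s2 in s20; lra.
  have a1' : a = 1.
    by apply/eqP; rewrite -(@eqrXn2 _ 2) // ?ltW // expr1n; apply/eqP; rewrite /s2 in s20; lra.
  rewrite vau a1' scale1r setDv measure0 lee_fin mulr_ge0 // ltW //.
have s20 : 0 < s2 by rewrite lt_neqAle eq_sym s2n subr_ge0.
pose s := Num.sqrt s2; have s0 : 0 < s by rewrite sqrtr_gt0.
have ss : s ^+ 2 = s2 by rewrite sqr_sqrtr // ltW.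
pose u' := s^-1 *: (v - a *: u).
have uu' : edot u u' = 0.
  by rewrite edotZr edotDr edotNr edotZr u1 -/a mulr1 subrr mulr0.
have u'1 : edot u' u' = 1.
  rewrite edotZl edotZr edotDl !edotDr !edotNl !edotNr !edotZl !edotZr u1 v1 (edotC v) -/a.
  have -> : 1 + - (a * a) + (- (a * a) + - - (a * (a * 1))) = s ^+ 2 by rewrite ss /s2; ring.
  by field; rewrite gt_eqF.
have vE : v = a *: u + s *: u'.
  by rewrite /u' scalerA mulfV ?gt_eqF // scale1r addrC subrK.
pose t := s / a.
have t0 : 0 < t by rewrite divr_gt0.
have sD : s <= D.
  have : s ^+ 2 <= D ^+ 2 by rewrite ss /s2 D2; have := sqr_ge0 (1 - a); lra.
  by rewrite ler_pXn2r ?nnegrE // ltW.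
have tD : t * (1 - k / 2) <= D.
  apply: le_trans sD; rewrite -[leRHS](divfK (lt0r_neq0 a0)) -/t.
  by rewrite ler_pM2l.
have tc : t <= c by nra.
apply: le_trans (_ : ((r + e / 2) * t)%:E <= _)%E; last first.
  rewrite lee_fin.
  have -> : r + e / 2 = (r + e) * (1 - k / 2) by rewrite /k; field; rewrite gt_eqF.
  by rewrite -mulrA ler_pM2l // mulrC.
have iid := block_dot_iid p1 hxi u1 u'1 uu'.
have mY := measurable_block_dot hxi u; have mZ := measurable_block_dot hxi u'.
apply: le_trans (hc t t0 tc d T P (fun i w => block_dot (xi w) u i) (fun i w => block_dot (xi w) u' i) mY mZ iid).
have mv := measurable_block_sqnorm hxi v; have mu := measurable_block_sqnorm hxi u.
have lin w i : block_dot (xi w) v i = a * (block_dot (xi w) u i + t * block_dot (xi w) u' i).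
  by rewrite {1}vE block_dot_lin /t; field; rewrite gt_eqF.
have mE (f : T -> measurableTypeR R) (x : R) : measurable_fun setT f -> measurable [set w | x <= f w].
  move=> mf; rewrite (_ : [set w | _] = f @^-1` `[x, +oo[%classic).
    exact: (measurable_preimage mf).
  by apply/seteqP; split => w /=; rewrite in_itv /= andbT.
apply: le_measure; rewrite ?inE.
- by apply: measurableD; exact: mE.
- have mS2 : measurable_fun setT (fun w => \sum_(i < n.+1) (block_dot (xi w) u i + t * block_dot (xi w) u' i) ^+ 2 : measurableTypeR R).
    apply: measurable_sum => i; apply: measurable_funX; apply: measurable_funD; first exact: mY.
    by apply: measurable_funM => //; exact: mZ.
  rewrite (_ : [set w | _] = [set w | b ^+ 2 <= \sum_(i < n.+1) (block_dot (xi w) u i + t * block_dot (xi w) u' i) ^+ 2] `\`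
     [set w | b ^+ 2 <= block_sqnorm (xi w) u]).
    by apply: measurableD; exact: mE.
  apply/seteqP; split => w /=.
    by move=> [h1 h2]; split => //; apply/negP; rewrite -ltNge.
  by move=> [h1 /negP]; rewrite -ltNge.
move=> w /= [h1 /negP]; rewrite -ltNge => h2; split => //.
apply: le_trans h1 _; rewrite /block_sqnorm.
by apply: ler_sum => i _; rewrite lin exprMn ler_piMl // sqr_ge0.
Qed.

(** * Unions of events along a graph *)

Section Merging.
Context d (T : measurableType d) (R : realType) (P : probability T R).
Let pr (A : set T) : R := fine (P A).

Lemma fine_probability (A : set T) : measurable A -> P A = (pr A)%:E.
Proof. by move=> mA; rewrite /pr fineK // fin_num_measure. Qed.


Lemma pr_setU (A B : set T) : measurable A -> measurable B ->
  pr (A `|` B) = pr A + pr B - pr (A `&` B).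
Proof.
move=> mA mB; have mI := measurableI _ _ mA mB; have mU := measurableU _ _ mA mB.
apply: EFin_inj; rewrite EFinB EFinD -!fine_probability //.
by apply: measureUfinl => //; apply: le_lt_trans (probability_le1 P mA) _; rewrite ltry.
Qed.

Lemma pr_setDI (A B : set T) : measurable A -> measurable B ->
  pr A = pr (A `\` B) + pr (A `&` B).
Proof.
move=> mA mB; have mI := measurableI _ _ mA mB; have mD := measurableD mA mB.
by apply: EFin_inj; rewrite EFinD -!fine_probability //; exact: measureDI.
Qed.

Lemma pr_le (A B : set T) : measurable A -> measurable B -> A `<=` B -> pr A <= pr B.
Proof.
by move=> mA mB AB; rewrite -lee_fin -!fine_probability // le_measure ?inE.
Qed.

Lemma pr_merge (A B A' B' : set T) (p0 : R) :
  measurable A -> measurable B -> measurable A' -> measurable B' ->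
  A' `<=` A -> B' `<=` B -> pr B' = p0 ->
  pr (A `|` B) - p0 <= (pr A - p0) + (pr B - p0) + pr (B' `\` A').
Proof.
move=> mA mB mA' mB' AA BB B'0; rewrite pr_setU //.
have := pr_setDI mB' mA'; rewrite B'0.
have : pr (B' `&` A') <= pr (A `&` B).
  by apply: pr_le; [exact: measurableI..|move=> w [/BB ? /AA ?]].
lra.
Qed.

Section Graph.
Variables (V : choiceType) (E : V -> set T) (p0 : R) (s : seq V).
Hypotheses (mE : forall x, x \in s -> measurable (E x))
  (p0_ge0 : 0 <= p0) (prE : forall x, x \in s -> pr (E x) = p0).

Let U (l : V -> V) (c : V) := \big[setU/set0]_(x <- s | l x == c) E x.

(** The value 0 for labels that no point carries matters: a merge empties one class, whose term must
    vanish and not become - p0. *)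
Let excess (l : V -> V) (c : V) : R := if has (fun x => l x == c) s then pr (U l c) - p0 else 0.

Lemma measurable_labelled l c : measurable (U l c).
Proof.
by rewrite /U big_seq_cond; apply: bigsetU_measurable => x /andP[xs _]; exact: mE.
Qed.

Lemma sub_labelled l c x : x \in s -> l x = c -> E x `<=` U l c.
Proof. by move=> xs lx w Ew; rewrite /U -bigcup_seq_cond; exists x => //=; rewrite xs lx eqxx. Qed.

(* Union-find: each edge either merges two classes, at a cost bounded by
   [pr_merge], or lies inside a class and adds a nonnegative term on the right. *)
Lemma graph_excess (es : seq (V * V)) (g : V * V -> R) :
  (forall e, e \in es -> [/\ e.1 \in s, e.2 \in s & pr (E e.2 `\` E e.1) <= g e]) ->
  exists l : V -> V, [/\ forall x, x \in s -> l x \in s, forall e, e \in es -> l e.1 = l e.2 &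
    \sum_(c <- undup s) excess l c <= \sum_(e <- es) g e].
Proof.
elim: es => [|e es IH] hes.
  exists id; split => //; rewrite big_nil big_seq big1 // => c; rewrite mem_undup => cs.
  rewrite /excess; case: ifP => // _; apply/eqP; rewrite subr_eq0; apply/eqP.
  rewrite -(prE cs); congr (pr _); apply/seteqP; split; last exact: sub_labelled.
  by rewrite /U -bigcup_seq_cond => w [x /= /andP[_ /eqP <-]].
have [l [ls le lsum]] := IH (fun e0 he => hes e0 (mem_behead (s := e :: es) he)).
have [e1s e2s eg] := hes e (mem_head _ _).
have g0 : 0 <= g e by rewrite (le_trans _ eg) // fine_ge0.
have [lee|lne] := eqVneq (l e.1) (l e.2).
  exists l; split => // [e'|]; first by rewrite inE => /predU1P[->|/le].
  by rewrite big_cons ler_wpDl.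
pose l' x := if l x == l e.2 then l e.1 else l x.
have l'E1 x : (l' x == l e.1) = (l x == l e.1) || (l x == l e.2).
  by rewrite /l'; case: (eqVneq (l x) (l e.2)) => [->|]; rewrite ?eqxx ?orbT ?orbF.
have l'E2 x : (l' x == l e.2) = false.
  rewrite /l'; case: (eqVneq (l x) (l e.2)) => [_|/negbTE//].
  exact/negbTE.
have l'E3 c x : c != l e.1 -> c != l e.2 -> (l' x == c) = (l x == c).
  move=> c1 c2; rewrite /l'; case: (eqVneq (l x) (l e.2)) => [->|//].
  by rewrite ![_ == c]eq_sym (negbTE c1) (negbTE c2).
exists l'; split.
- by move=> x xs; rewrite /l'; case: ifP => _; exact: ls.
- move=> e'; rewrite inE => /predU1P[->|/le]; last by rewrite /l' => ->.
  by rewrite /l' eqxx (negbTE lne).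
rewrite big_cons.
have S1 : l e.1 \in undup s by rewrite mem_undup ls.
have S2 : l e.2 \in undup s by rewrite mem_undup ls.
have D F : \sum_(c <- undup s) F c = F (l e.1) + (F (l e.2) +
    \sum_(c <- undup s | (c != l e.1) && (c != l e.2)) F c) :> R.
  rewrite (bigD1_seq (l e.1)) ?undup_uniq //=; congr (_ + _).
  transitivity (\sum_(c <- [seq c <- undup s | c != l e.1]) F c).
    by rewrite big_filter.
  rewrite (bigD1_seq (l e.2)) /=; first by rewrite big_filter_cond.
    by rewrite mem_filter eq_sym lne.
  by rewrite filter_uniq ?undup_uniq.
move: lsum; rewrite !D.
have -> : excess l' (l e.2) = 0.
  rewrite /excess (_ : has _ s = false) //; apply/hasPn => x _; by rewrite l'E2.
have -> : \sum_(c <- undup s | (c != l e.1) && (c != l e.2)) excess l' c =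
          \sum_(c <- undup s | (c != l e.1) && (c != l e.2)) excess l c.
  apply: eq_bigr => c /andP[c1 c2]; rewrite /excess /U.
  rewrite (eq_has (a2 := fun x => l x == c)); last by move=> x; rewrite l'E3.
  by rewrite (eq_bigl (fun x => l x == c)) // => x; rewrite l'E3.
suff : excess l' (l e.1) <= excess l (l e.1) + excess l (l e.2) + g e by lra.
rewrite /excess !ifT; try (by apply/hasP; exists e.1 => //; rewrite ?l'E1 eqxx);
  try (by apply/hasP; exists e.2 => //; rewrite eqxx).
apply: le_trans (_ : _ <= (pr (U l (l e.1)) - p0) + (pr (U l (l e.2)) - p0) + pr (E e.2 `\` E e.1)) _; last first.
  by rewrite lerD2l.
have -> : U l' (l e.1) = U l (l e.1) `|` U l (l e.2).
  rewrite /U (eq_bigl _ _ l'E1) -!bigcup_seq_cond; apply/seteqP; split => w.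
    by move=> [x /= /andP[xs /orP[h|h]] Ew]; [left|right]; exists x => //=; rewrite xs h.
  by move=> [|] [x /= /andP[xs h] Ew]; exists x => //=; rewrite xs h ?orbT.
apply: pr_merge => //; try exact: measurable_labelled; try exact: mE; try exact: prE.
- exact: sub_labelled.
- exact: sub_labelled.
Qed.

(** The number of connected components enters as a bound on the number of values of any labelling
    constant along the edges; it is applied to the labelling of [graph_excess]. Each class
    contributes p0 and its excess. *)
Lemma graph_bound (es : seq (V * V)) (g : V * V -> R) (n : nat) :
  (forall e, e \in es -> [/\ e.1 \in s, e.2 \in s & pr (E e.2 `\` E e.1) <= g e]) ->
  (forall l : V -> V, (forall e, e \in es -> l e.1 = l e.2) -> (size (undup (map l s)) <= n)%N) ->
  pr (\big[setU/set0]_(x <- s) E x) <= n%:R * p0 + \sum_(e <- es) g e.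
Proof.
move=> hes hn; have [l [ls le lsum]] := graph_excess hes.
apply: le_trans (_ : \sum_(c <- undup (map l s)) pr (U l c) <= _).
  have mU (r : seq V) : measurable (\big[setU/set0]_(c <- r) U l c).
    by apply: bigsetU_measurable => c _; exact: measurable_labelled.
  apply: le_trans (_ : pr (\big[setU/set0]_(c <- undup (map l s)) U l c) <= _).
    apply: pr_le => //.
      by rewrite big_seq; apply: bigsetU_measurable => x xs; exact: mE.
    rewrite -!bigcup_seq => w [x /= xs Ex]; exists (l x) => /=.
      by rewrite mem_undup map_f.
    exact: (sub_labelled xs).
  elim: (undup _) => [|c r IH]; first by rewrite !big_nil /pr measure0.
  rewrite !big_cons pr_setU //; last exact: measurable_labelled.
  have : 0 <= pr (U l c `&` \big[setU/set0]_(c0 <- r) U l c0) by rewrite fine_ge0.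
  lra.
have -> : \sum_(c <- undup (map l s)) pr (U l c) =
    (size (undup (map l s)))%:R * p0 + \sum_(c <- undup s) excess l c.
  have -> : \sum_(c <- undup s) excess l c = \sum_(c <- undup (map l s)) (pr (U l c) - p0).
    rewrite -[LHS]big_mkcond /= -big_filter; apply: perm_big; apply: uniq_perm; rewrite ?filter_uniq ?undup_uniq // => c.
    rewrite mem_filter !mem_undup; apply/idP/idP.
      by move=> /andP[/hasP[x xs /eqP <-] _]; exact: map_f.
    move=> /mapP[x xs ->]; rewrite ls // andbT; apply/hasP; by exists x.
  rewrite big_split /= sumrN big_const_seq count_predT iter_addr_0 -mulr_natl; ring.
by apply: lerD => //; rewrite ler_wpM2r // ler_nat hn.
Qed.

End Graph.

End Merging.

(** * Sampling the curve *)

Lemma within_continuousP (R : realType) (V : normedModType R) (X : set R) (psi : R -> V) :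
  {within X, continuous psi} -> forall x e, X x -> 0 < e ->
  exists2 r, 0 < r & forall y, X y -> `|x - y| < r -> `|psi x - psi y| < e.
Proof.
move=> /subspace_continuousP cpsi x e Xx e0.
have /cvgrPdist_lt /(_ e e0) := cpsi x Xx.
move=> /nbhs_ballP[r /= r0 h].
by exists r => // y Xy xy; exact: h.
Qed.

Lemma compact_modulus (R : realType) (V : normedModType R) (X : set R) (psi : R -> V)
    (a b e : R) :
  {within X, continuous psi} -> `[a, b] `<=` X -> 0 < e ->
  exists2 r, 0 < r & forall x y, x \in `[a, b] -> y \in `[a, b] -> `|x - y| < r ->
    `|psi x - psi y| < e.
Proof.
move=> cpsi abX e0.
have e20 : 0 < e / 2 by rewrite divr_gt0.
have /compact_near_coveringP cov := @segment_compact R a b.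
have [] := cov R (0^'+) (fun r x => x \in `[a, b] -> forall y, y \in `[a, b] ->
  `|x - y| < r -> `|psi x - psi y| < e) _.
  move=> x abx; have Xx := abX x abx.
  have [r r0 hr] := within_continuousP cpsi Xx e20.
  have r20 : 0 < r / 2 by rewrite divr_gt0.
  exists (ball x (r / 2), [set i | i < r / 2]).
    by split; [exact: nbhsx_ballx|exact: nbhs_right_lt].
  move=> [x' i] /= [xx' ir] abx' y aby x'y.
  have := hr x' (abX x' abx'); have := hr y (abX y aby).
  have -> : x - y = (x - x') + (x' - y) by ring.
  have := ler_normD (x - x') (x' - y); move: xx'; rewrite /ball /= => xx' tri h1 h2.
  have -> : psi x' - psi y = - (psi x - psi x') + (psi x - psi y).
    by rewrite opprB addrA subrK.
  apply: le_lt_trans (ler_normD _ _) _; rewrite normrN (splitr e).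
  by apply: ltrD; [apply: h2|apply: h1]; lra.
move=> r /= r0 hr; exists (r / 2); first by rewrite divr_gt0.
move=> x y abx aby xy; apply: (hr (r / 2)) => //=; rewrite ?divr_gt0 //.
by rewrite sub0r normrN gtr0_norm ?divr_gt0 // ltr_pdivrMr //; lra.
Qed.

Lemma enorm_le (R : realType) n (v : 'cV[R]_n) : enorm v <= n%:R * `|v|.
Proof.
have hv i : `|v i 0| <= `|v|.
  rewrite [leRHS]mx_normrE; apply: (le_bigmax _ (fun i => `|v i.1 i.2|) (i, 0)).
have n0 : 0 <= n%:R * `|v| by rewrite mulr_ge0.
rewrite -(@ler_pXn2r _ 2) ?nnegrE ?enorm_ge0 // enorm_sqr.
apply: le_trans (_ : \sum_(i < n) `|v| ^+ 2 <= _).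
  by apply: ler_sum => i _; rewrite -expr2 -real_normK ?num_real // ler_pXn2r ?nnegrE.
rewrite sumr_const card_ord exprMn -[leLHS]mulr_natl ler_wpM2r ?sqr_ge0 //.
by rewrite -natrX ler_nat; case: n {v hv n0} => // n; rewrite expnS expn1 leq_pmull.
Qed.

Lemma exists_mesh (R : realType) (a b r : R) : 0 < r ->
  exists G : seq R, {in G, forall z, a <= z <= b} /\
    forall x y, a <= x -> x <= y -> y <= b -> {in G, forall z, ~ x < z < y} -> `|x - y| < r.
Proof.
move=> r0; have r20 : 0 < r / 2 by rewrite divr_gt0.
pose g (i : nat) : R := a + i%:R * (r / 2).
pose N := (Num.trunc ((b - a) / (r / 2))).+2.
exists [seq z <- [seq g i | i <- iota 0 N] | a <= z <= b]; split.
  by move=> z; rewrite mem_filter => /andP[].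
move=> x y ax xy yb hG; rewrite distrC ger0_norm ?subr_ge0 // ltNge; apply/negP => rxy.
have q0 : 0 <= (x - a) / (r / 2) by rewrite divr_ge0 ?subr_ge0 // ltW.
have q1 : (x - a) / (r / 2) <= (b - a) / (r / 2).
  by rewrite ler_pM2r ?invr_gt0 // lerB // (le_trans xy).
have /andP[i1 i2] := truncn_itv q0.
set i := Num.trunc _ in i1 i2.
have iN : (i.+1 < N)%N.
  by rewrite !ltnS; exact: le_truncn.
have gi1 : x < g i.+1 by rewrite /g -ltrBlDl -ltr_pdivrMr.
have gi2 : g i.+1 <= x + r / 2.
  rewrite ler_pdivlMr // in i1; rewrite /g -natr1 mulrDl mul1r; lra.
apply: (hG (g i.+1)); last by apply/andP; split => //; lra.
rewrite mem_filter; apply/andP; split; first by apply/andP; split; lra.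
by rewrite map_f // mem_iota.
Qed.

Lemma consecutive_sorted (R : realDomainType) (s : seq R) (e : R * R) :
  sorted <=%R s -> e \in zip s (behead s) ->
  [/\ e.1 \in s, e.2 \in s, e.1 <= e.2 & {in s, forall z, ~ e.1 < z < e.2}].
Proof.
elim: s => [|x [|y s] IH] //= /andP[xy ys].
rewrite inE => /predU1P[->|/(IH ys)[e1 e2 e12 hz]] /=.
  rewrite !inE !eqxx orbT; split => // z; rewrite !inE => /or3P[/eqP->|/eqP->|zs]; rewrite ?ltxx ?andbF //.
  have /allP/(_ z zs) := order_path_min le_trans ys.
  by rewrite leNgt => /negbTE ->; rewrite andbF.
split => //; [by rewrite inE e1 orbT|by rewrite inE e2 orbT|].
move=> z; rewrite inE => /predU1P[->|/hz//].
have xe : x <= e.1.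
  move: e1; rewrite inE => /predU1P[->//|e1s]; apply: le_trans xy _.
  by have /allP/(_ _ e1s) := order_path_min le_trans ys.
by rewrite ltNge xe.
Qed.

(** A mesh is put on [a, b] for every pair of points of [F] with [a, b] inside [X]. A consecutive
    pair without gap lies in one such segment, since the points of [F] belong to the sample and none
    can fall strictly between; the modulus of continuity of that compact segment then applies. *)
Lemma exists_refinement (R : realType) (V : normedModType R) (X : set R) (psi : R -> V)
    (e : R) (F : seq R) :
  {within X, continuous psi} -> 0 < e -> {in F, forall x, X x} ->
  exists s : seq R, [/\ sorted <=%R s, {subset F <= s}, {in s, forall x, X x} &
    {in zip s (behead s), forall q, `[q.1, q.2] `<=` X -> `|psi q.1 - psi q.2| < e}].
Proof.
move=> cpsi e0 FX.
have /choice[G hG] (ab : R * R) : exists G : seq R,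
    {in G, forall z, `[ab.1, ab.2] `<=` X /\ ab.1 <= z <= ab.2} /\
    (`[ab.1, ab.2] `<=` X -> forall x y, ab.1 <= x -> x <= y -> y <= ab.2 ->
      {in G, forall z, ~ x < z < y} -> `|psi x - psi y| < e).
  have [abX|nX] := pselect (`[ab.1, ab.2] `<=` X); last by exists [::].
  have [r r0 hr] := compact_modulus cpsi abX e0.
  have [G [G1 G2]] := exists_mesh ab.1 ab.2 r0.
  exists G; split => [z /G1//|_ x y ax xy yb hz]; apply: hr; last exact: G2.
    by rewrite in_itv /= ax (le_trans xy).
  by rewrite in_itv /= yb (le_trans ax).
pose s := sort <=%R (F ++ flatten [seq G ab | ab <- [seq (a, b) | a <- F, b <- F]]).
have Fs : {subset F <= s} by move=> x xF; rewrite mem_sort mem_cat xF.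
have Gs a b : a \in F -> b \in F -> {subset G (a, b) <= s}.
  move=> aF bF z zG; rewrite mem_sort mem_cat; apply/orP; right; apply/flatten_mapP.
  by exists (a, b) => //; apply/allpairsP; exists (a, b).
have sE z : z \in s -> z \in F \/ exists a b, [/\ a \in F, b \in F, z \in G (a, b),
    `[a, b] `<=` X & a <= z <= b].
  rewrite mem_sort mem_cat => /orP[|/flatten_mapP[ab]]; first by left.
  move=> /allpairsP[[a b] /= [aF bF ->]] zG; right; exists a, b.
  by have [/(_ z zG)[/= ? ?] _] := hG (a, b).
have ss : sorted <=%R s by exact: sort_le_sorted.
exists s; split => //.
  move=> z /sE[/FX//|[a [b [_ _ _ abX abz]]]]; apply: abX => /=.
  by rewrite in_itv.
move=> q qs qX; have [q1 q2 q12 hz] := consecutive_sorted ss qs.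
have main a b : a \in F -> b \in F -> `[a, b] `<=` X -> a <= q.1 -> q.2 <= b ->
    `|psi q.1 - psi q.2| < e.
  move=> aF bF abX aq qb; apply: ((hG (a, b)).2 abX) => //= z zG.
  by apply: hz; exact: (Gs a b).
have q2case : q.2 \in F -> `|psi q.1 - psi q.2| < e.
  move=> q2F; have [q1F|[a [b [aF bF _ abX /andP[aq qb]]]]] := sE _ q1.
    exact: (main q.1 q.2).
  have [q2b|bq2] := leP q.2 b; first exact: (main a b).
  have [q1b|bq1] := eqVneq q.1 b.
    by apply: (main q.1 q.2) => //; rewrite q1b.
  by exfalso; apply: (hz b); [exact: Fs|rewrite bq2 andbT lt_neqAle bq1].
have [//|[a [b [aF bF _ abX /andP[aq qb]]]]] := sE _ q2.
have [aq1|q1a] := leP a q.1; first exact: (main a b).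
have [q2a|aq2] := eqVneq q.2 a; first by apply: q2case; rewrite q2a.
by exfalso; apply: (hz a); [exact: Fs|rewrite q1a lt_neqAle eq_sym aq2].
Qed.

(** The sample points from x to y form a chain of consecutive pairs without gap, along which the
    label is carried. *)
Lemma sorted_label_const (R : realDomainType) (L : eqType) (X : set R) (l : R -> L) (s : seq R) :
  sorted <=%R s ->
  {in zip s (behead s), forall q, `[q.1, q.2] `<=` X -> l q.1 = l q.2} ->
  {in s &, forall x y, x <= y -> `[x, y] `<=` X -> l x = l y}.
Proof.
elim: s => [|a [|b s] IH] //= => [_ _ x y|/andP[ab bs] h].
  by rewrite !inE => /eqP-> /eqP->.
have hb x : x \in b :: s -> b <= x.
  rewrite inE => /predU1P[->//|xs].
  by have /allP/(_ _ xs) := order_path_min le_trans bs.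
have {}IH := IH bs (fun q qs => h q (mem_behead (s := (a, b) :: _) qs)).
move=> x y; rewrite [x \in _]inE [y \in _]inE => /predU1P[->|xs] /predU1P[->//|ys] xy xyX.
  have by_ := hb y ys.
  rewrite (h (a, b)) ?mem_head //=; last first.
    by move=> z /= /[!in_itv] /= /andP[az zb]; apply: xyX => /=; rewrite in_itv /= az (le_trans zb).
  apply: IH => //; first exact: mem_head.
  by move=> z /= /[!in_itv] /= /andP[bz zy]; apply: xyX => /=; rewrite in_itv /= zy (le_trans ab).
  by rewrite (@le_anti _ _ x a) // xy (le_trans ab) // hb.
exact: IH.
Qed.

(** * Connected components of the closed curve *)

Section Components.
Context {R : realType} {V : normedModType R}.
Variables (X : set R) (psi : R -> V) (js : seq (interval R)).
Hypotheses (XE : X = [set x | exists2 J, J \in js & x \in J])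
  (cpsi : {within X, continuous psi}).

Let Gam := closure (psi @` X).
(** Finitely many closed connected pieces covering [Gam]. Which of them meet decides the components:
    images of separate intervals may touch in the closure. *)
Let C (J : interval R) := closure (psi @` [set x | x \in J]).

Let subX J x : J \in js -> x \in J -> X x.
Proof. by move=> Jjs xJ; rewrite XE; exists J. Qed.

Let C_sub J : J \in js -> C J `<=` Gam.
Proof. by move=> Jjs; apply: closure_subset => _ [x /= xJ <-]; exists x => //; exact: (subX Jjs). Qed.

Let C_mem J x : x \in J -> C J (psi x).
Proof. by move=> xJ; apply: subset_closure; exists x. Qed.

Let C_connected J : J \in js -> connected (C J).
Proof.
move=> Jjs; apply: connected_closure; apply: connected_continuous_connected.
  by apply/connected_intervalP; exact: interval_is_interval.
by apply: continuous_subspaceW cpsi => x /= xJ; exact: (subX Jjs).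
Qed.

Let C_component J x y : J \in js -> C J x -> C J y ->
  connected_component Gam x y.
Proof.
by move=> Jjs Cx Cy; apply: (connected_component_max Cx (C_sub Jjs) (C_connected Jjs)).
Qed.

Let Gam_cover : Gam `<=` \big[setU/set0]_(J <- js) C J.
Proof.
have cl : closed (\big[setU/set0]_(J <- js) C J).
  by apply: closed_bigsetU => J _; exact: closed_closure.
rewrite ((closure_id _).1 cl).
apply: closure_subset => _ [x + <-]; rewrite {1}XE => -[J Jjs xJ].
by rewrite -bigcup_seq; exists J => //; exact: C_mem.
Qed.

(** Ensures that [fset_set] in [n_components] sees the actual family and not its default, the empty
    set. Each component contains a whole nonempty piece. *)
Lemma finite_components : finite_set [set connected_component Gam u | u in Gam].
Proof.
have rep J : exists u : V, C J !=set0 -> C J u.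
  by have [[u Cu]|nC] := pselect (C J !=set0); [exists u|exists 0].
have {rep}[rep hrep] := choice rep.
apply: (@sub_finite_set _ _ [set connected_component Gam (rep J) | J in [set` js]]).
  move=> _ [u /Gam_cover + <-]; rewrite -bigcup_seq => -[J /= Jjs Cu].
  exists J => //; apply: same_connected_component; apply: (C_component Jjs) => //.
  by apply: hrep; exists u.
exact/finite_image/finite_seq.
Qed.

Let touching (q : interval R * interval R) := `[< C q.1 `&` C q.2 !=set0 >].

(** The order of choices matters: the jumps, whose number is bounded independently of [eta]; the
    points [F], one in each nonempty interval together with the ends of the jumps; any sample
    containing [F]. A compatible labelling is constant on each piece and across touching pieces,
    hence on each component of [Gam]. *)
Lemma label_components (eta : R) : 0 < eta ->
  exists jumps : seq (R * R), [/\ (size jumps <= size js * size js)%N,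
    {in jumps, forall q, [/\ X q.1, X q.2 & `|psi q.1 - psi q.2| < eta]} &
    exists2 F : seq R, {in F, forall x, X x} &
    forall s : seq R, sorted <=%R s -> {subset F <= s} -> {in s, forall x, X x} ->
    {in jumps, forall q, q.1 \in s /\ q.2 \in s} /\
    forall l : R -> R, {in zip s (behead s), forall q, `[q.1, q.2] `<=` X -> l q.1 = l q.2} ->
    {in jumps, forall q, l q.1 = l q.2} ->
    (size (undup (map l s)) <= n_components Gam)%N].
Proof.
move=> eta0; have eta20 : 0 < eta / 2 by rewrite divr_gt0.
have /choice[jmp hjmp] (q : interval R * interval R) : exists ab : R * R, touching q ->
    [/\ ab.1 \in q.1, ab.2 \in q.2 & `|psi ab.1 - psi ab.2| < eta].
  have [tq|//] := boolP (touching q); last by exists (0, 0).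
  move: tq => /asboolP[z [z1 z2]].
  have [_ [[x /= x1 <-] bx]] := z1 _ (nbhsx_ballx z _ eta20).
  have [_ [[y /= y2 <-] by_]] := z2 _ (nbhsx_ballx z _ eta20).
  exists (x, y) => _; split => //=; rewrite (splitr eta).
  have -> : psi x - psi y = - (z - psi x) + (z - psi y) by rewrite opprB addrA subrK.
  by apply: le_lt_trans (ler_normD _ _) _; rewrite normrN; apply: ltrD; [move: bx|move: by_]; rewrite -ball_normE.
have /choice[rep hrep] (J : interval R) : exists x : R, (exists y, y \in J) -> x \in J.
  by have [[y yJ]|nJ] := pselect (exists y, y \in J); [exists y|exists 0 => yJ; case: nJ].
pose pairs := [seq q <- [seq (J, K) | J <- js, K <- js] | touching q].
have pairsP q : q \in pairs -> [/\ touching q, q.1 \in js & q.2 \in js].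
  by rewrite mem_filter => /andP[tq /allpairsP[[J K] /= [? ? qE]]]; subst q.
exists (map jmp pairs); split.
- by rewrite size_map size_filter (leq_trans (count_size _ _)) // size_allpairs.
- move=> _ /mapP[q /pairsP[tq q1 q2] ->]; have [h1 h2 h3] := hjmp q tq; split => //.
    exact: (subX q1).
  exact: (subX q2).
pose ne (J : interval R) := `[< exists y : R, y \in J >].
exists (map rep [seq J <- js | ne J] ++ map fst (map jmp pairs) ++ map snd (map jmp pairs)).
  move=> x; rewrite !mem_cat => /or3P[/mapP[J + ->]|/mapP[_ /mapP[q /pairsP[tq q1 q2] ->] ->]|
      /mapP[_ /mapP[q /pairsP[tq q1 q2] ->] ->]].
  - by rewrite mem_filter => /andP[/asboolP nJ Jjs]; apply: (subX Jjs); exact: hrep.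
  - by have [h1 _ _] := hjmp q tq; exact: (subX q1).
  - by have [_ h2 _] := hjmp q tq; exact: (subX q2).
move=> s ss Fs sX.
have js_s : {in map jmp pairs, forall q, q.1 \in s /\ q.2 \in s}.
  by move=> q qj; split; apply: Fs; rewrite !mem_cat map_f ?orbT.
split => // l lc lj.
have lJ J x y : J \in js -> x \in J -> y \in J -> x \in s -> y \in s -> l x = l y.
  move=> Jjs; wlog xy : x y / x <= y => [wl xJ yJ xs ys|xJ yJ xs ys].
    by have [xy|/ltW yx] := leP x y; [exact: wl|exact/esym/wl].
  apply: (sorted_label_const ss lc) => // z /=; rewrite in_itv /= => xzy.
  apply: (subX Jjs); exact: (interval_is_interval xJ yJ).
have reps J x : J \in js -> x \in J -> rep J \in J /\ rep J \in s.
  move=> Jjs xJ; have nJ : exists y, y \in J by exists x.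
  split; first exact: hrep.
  by apply: Fs; rewrite mem_cat map_f // mem_filter Jjs andbT; exact/asboolP.
pose lam J := l (rep J).
have lam_touch J K : J \in js -> K \in js -> touching (J, K) -> lam J = lam K.
  move=> Jjs Kjs tJK; have [h1 h2 _] := hjmp _ tJK.
  have qp : jmp (J, K) \in map jmp pairs.
    by apply: map_f; rewrite mem_filter tJK; apply/allpairsP; exists (J, K).
  have [s1 s2] := js_s _ qp; have [r1 r2] := reps _ _ Jjs h1; have [r3 r4] := reps _ _ Kjs h2.
  by rewrite /lam (lJ J _ (jmp (J, K)).1) // lj // (lJ K _ (jmp (J, K)).2).
have lam_comp J K x y : J \in js -> K \in js -> C J x -> C K y ->
    connected_component Gam x y -> lam J = lam K.
  move=> Jjs Kjs Cx Cy xy; apply/eqP/negPn/negP => nJK.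
  (* The pieces labelled like [J] against the others. Both unions are closed, they are disjoint
     because touching pieces share their label, and they cover [Gam]; a connected component cannot
     meet both. *)
  pose A := \big[setU/set0]_(I <- [seq I <- js | lam I == lam J]) C I.
  pose B := \big[setU/set0]_(I <- [seq I <- js | lam I != lam J]) C I.
  have cA : closed A by apply: closed_bigsetU => I _; exact: closed_closure.
  have cB : closed B by apply: closed_bigsetU => I _; exact: closed_closure.
  have AB z : A z -> B z -> False.
    rewrite /A /B -!bigcup_seq => -[I /= + CI] [I' /= + CI'].
    rewrite !mem_filter => /andP[/eqP lI Ijs] /andP[lI' I'js].
    by case/negP: lI'; rewrite -lI (lam_touch I' I) //; apply/asboolP; exists z.
  have ABG z : Gam z -> A z \/ B z.
    move=> /Gam_cover; rewrite -bigcup_seq => -[I /= Ijs CI].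
    have [lI|lI] := boolP (lam I == lam J); [left|right];
      by rewrite /A /B -bigcup_seq; exists I => //=; rewrite mem_filter lI.
  pose K0 := connected_component Gam x.
  have K0G : K0 `<=` Gam := @connected_component_sub _ _ _.
  have K0x : K0 x by apply: connected_component_refl; exact: (C_sub Jjs).
  have Ax : A x by rewrite /A -bigcup_seq; exists J => //=; rewrite mem_filter eqxx.
  have By : B y.
    by rewrite /B -bigcup_seq; exists K => //=; rewrite mem_filter eq_sym nJK.
  have : K0 `&` A = K0.
    apply: (@component_connected _ Gam x).
    - by exists x.
    - exists (~` B); first exact: closed_openC.
      apply/seteqP; split => z [K0z]; first by move=> Az; split => // /(AB z Az).
      by move=> nBz; split => //; case: (ABG z (K0G z K0z)).
    - by exists A.
  by move=> /seteqP[_ /(_ y xy)[_ Ay]]; exact: (AB y Ay By).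
have sJ x : x \in s -> exists2 J, J \in js & x \in J.
  by move=> /sX; rewrite XE.
have l_comp x y : x \in s -> y \in s -> connected_component Gam (psi x) (psi y) -> l x = l y.
  move=> xs ys xy; have [J Jjs xJ] := sJ x xs; have [K Kjs yK] := sJ y ys.
  have [r1 r2] := reps _ _ Jjs xJ; have [r3 r4] := reps _ _ Kjs yK.
  rewrite (lJ J x (rep J)) // (lJ K y (rep K)) //.
  by apply: (lam_comp J K _ _ Jjs Kjs _ _ xy); exact: C_mem.
(* A sample point for each label; sending it to its component is injective on labels, which gives
   the count. *)
pose r c := nth 0 s (index c (map l s)).
have rs c : c \in map l s -> r c \in s by rewrite -index_mem size_map => ?; exact: mem_nth.
have lr c : c \in map l s -> l (r c) = c.
  by move=> cs; rewrite /r -(nth_map _ 0) ?nth_index // -(size_map l) index_mem.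
rewrite -(size_map (fun c => connected_component Gam (psi (r c)))).
apply: uniq_leq_size.
  rewrite map_inj_in_uniq ?undup_uniq // => c c'; rewrite !mem_undup => cs c's E.
  rewrite -(lr c) // -(lr c') //; apply: l_comp; rewrite ?rs // E.
  apply: connected_component_refl; apply: subset_closure; exists (r c') => //.
  exact/sX/rs.
move=> _ /mapP[c + ->]; rewrite mem_undup => cs.
rewrite -[_ \in _]/(_ \in fset_set _) in_fset_set; last exact: finite_components.
rewrite inE; exists (psi (r c)) => //; apply: subset_closure; exists (r c) => //.
exact/sX/rs.
Qed.

Lemma n_components_gt0 : X !=set0 -> (0 < n_components Gam)%N.
Proof.
move=> [x Xx]; rewrite /n_components cardfs_gt0; apply/fset0Pn.
exists (connected_component Gam (psi x)); rewrite in_fset_set; last exact: finite_components.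
by rewrite inE; exists (psi x) => //; apply: subset_closure; exists x.
Qed.

End Components.

Lemma enorm_distC (R : realType) n (u v : 'cV[R]_n) : enorm (u - v) = enorm (v - u).
Proof. by rewrite -opprB /enorm edotNl edotNr opprK. Qed.

Lemma curve_length_ge (R : realType) p (X : set R) (psi : R -> 'cV[R]_p) (L : R) s :
  curve_length X psi = L%:E -> sorted <=%R s ->
  \sum_(q <- zip s (behead s) | `[< `[q.1, q.2] `<=` X >]) enorm (psi q.1 - psi q.2) <= L.
Proof.
move=> LE ss; rewrite -lee_fin -LE; apply: ereal_sup_ubound; exists s => //.
by congr (_%:E); apply: eq_bigr => q _; rewrite enorm_distC.
Qed.

Section FiniteUnion.
Context d (T : measurableType d) (R : realType) (P : probability T R) (p : nat).
Variables (X : set R) (psi : R -> 'cV[R]_p) (E : R -> set T) (p0 rho delta L : R).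
Hypotheses (hX : finite_union_of_intervals X) (cpsi : {within X, continuous psi})
  (p0_ge0 : 0 <= p0) (rho0 : 0 <= rho) (delta0 : 0 < delta)
  (mE : forall x, X x -> measurable (E x)) (PE : forall x, X x -> P (E x) = p0%:E)
  (hE : forall x y, X x -> X y -> enorm (psi x - psi y) < delta ->
    (P (E y `\` E x) <= (rho * enorm (psi x - psi y))%:E)%E)
  (LE : curve_length X psi = L%:E).

Lemma finite_union_bound (F : seq R) : {in F, forall x, X x} ->
  fine (P (\big[setU/set0]_(x <- F) E x)) <=
  (n_components (closure (psi @` X)))%:R * p0 + rho * L.
Proof.
move=> FX; apply/ler_addgt0Pr => eta0 eta00.
have [js XE] := hX.
(* Compares the Euclidean norm with the library norm; the added 1 keeps it positive for p = 0. *)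
pose C : R := p%:R + 1; have C0 : 0 < C by rewrite ltr_wpDl.
have enC (v : 'cV[R]_p) : enorm v <= C * `|v|.
  by apply: le_trans (enorm_le v) _; rewrite ler_wpM2r // lerDl.
pose N : R := (size js * size js)%:R.
have K0 : 0 < N * (rho * C) + 1 by rewrite ltr_wpDl // !mulr_ge0 // ltW.
have e0 : 0 < delta / C by rewrite divr_gt0.
(* The first bound makes the jumps short enough for [hE], the second makes their total cost at most
   [eta0]; the bound [N] on their number does not depend on [eta]. *)
pose eta := Num.min (delta / C) (eta0 / (N * (rho * C) + 1)).
have eta_gt0 : 0 < eta by rewrite lt_min e0 divr_gt0.
have small (v : 'cV[R]_p) : `|v| < delta / C -> enorm v < delta.
  by rewrite ltr_pdivlMr // mulrC => h; apply: le_lt_trans (enC v) h.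
have [jumps [Nj hj [F0 F0X hF0]]] := label_components XE cpsi eta_gt0.
have FF0X : {in F ++ F0, forall x, X x}.
  by move=> x; rewrite mem_cat => /orP[/FX|/F0X].
have [s [ss sF sX hs]] := exists_refinement cpsi e0 FF0X.
have F0s : {subset F0 <= s} by move=> x xF; apply: sF; rewrite mem_cat xF orbT.
have [js_s lab] := hF0 s ss F0s sX.
pose zs := [seq q <- zip s (behead s) | `[< `[q.1, q.2] `<=` X >]].
pose g (q : R * R) := rho * enorm (psi q.1 - psi q.2).
have prE A : measurable A -> P A = (fine (P A))%:E by exact: fine_probability.
have hes q : q \in zs ++ jumps ->
    [/\ q.1 \in s, q.2 \in s & fine (P (E q.2 `\` E q.1)) <= g q].
  move=> qq; have [q1 q2 qd] : [/\ q.1 \in s, q.2 \in s & `|psi q.1 - psi q.2| < delta / C].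
    move: qq; rewrite mem_cat => /orP[|qj].
      rewrite mem_filter => /andP[/asboolP qX qz]; have [? ? _ _] := consecutive_sorted ss qz.
      by split => //; exact: hs.
    have [? ?] := js_s q qj; have [_ _ hq] := hj q qj; split => //.
    by apply: lt_le_trans hq _; rewrite ge_min lexx.
  have [Xq1 Xq2] := (sX _ q1, sX _ q2).
  split => //; rewrite -lee_fin -prE; first by apply: hE => //; exact: small.
  by apply: measurableD; exact: mE.
have := @graph_bound _ _ _ P _ E p0 s (fun x xs => mE (sX x xs)) p0_ge0 _ (zs ++ jumps) g
  (n_components (closure (psi @` X))) hes _.
rewrite big_cat /= => gb.
apply: le_trans (_ : fine (P (\big[setU/set0]_(x <- s) E x)) <= _).
  rewrite -lee_fin -!prE.
  - apply: le_measure; rewrite ?inE.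
    + by rewrite big_seq; apply: bigsetU_measurable => x /FX /mE.
    + by rewrite big_seq; apply: bigsetU_measurable => x /sX /mE.
    rewrite -!bigcup_seq => w [x /= xF Ex]; exists x => //=.
    by apply: sF; rewrite mem_cat xF.
  - by rewrite big_seq; apply: bigsetU_measurable => x /sX /mE.
  - by rewrite big_seq; apply: bigsetU_measurable => x /FX /mE.
apply: le_trans (gb _ _) _.
- by move=> x /sX /PE ->.
- move=> l hl; apply: lab => q qq; last by apply: hl; rewrite mem_cat qq orbT.
  by move=> qX; apply: hl; rewrite mem_cat mem_filter qq andbT; apply/orP; left; exact/asboolP.
rewrite -addrA lerD2l; apply: lerD.
  rewrite /g -mulr_sumr ler_wpM2l // big_filter; exact: curve_length_ge LE ss.
apply: le_trans (_ : \sum_(q <- jumps) (rho * C * eta) <= _).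
  rewrite big_seq [leRHS]big_seq; apply: ler_sum => q /hj[_ _ hq].
  rewrite /g -mulrA ler_wpM2l // (le_trans (enC _)) // ler_wpM2l ?ltW //.
rewrite big_const_seq count_predT iter_addr_0 -mulr_natl.
apply: le_trans (_ : N * (rho * C * eta) <= _).
  by rewrite ler_wpM2r ?ler_nat // !mulr_ge0 // ltW.
rewrite mulrA; apply: le_trans (_ : (N * (rho * C) + 1) * eta <= _).
  by rewrite ler_wpM2r ?lerDl // ltW.
by rewrite -ler_pdivlMl // mulrC ge_min lexx orbT.
Qed.

End FiniteUnion.

(** * Passage to the limit *)

(** For each rational q and each k, a point of [X] within 1/(k+1) of q is kept whenever there is
    one. Rational points of [X] would not do: an interval of [X] may be reduced to an irrational
    point. *)
Lemma dense_sequence (R : realType) (X : set R) : X !=set0 ->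
  exists2 Q : nat -> R, forall n, X (Q n) &
    forall x e, X x -> 0 < e -> exists n, `|x - Q n| < e.
Proof.
move=> [x0 Xx0].
have /choice[g hg] (qk : rat * nat) : exists y, X y /\
    ((exists2 x, X x & `|x - ratr qk.1| < qk.2.+1%:R^-1) -> `|y - ratr qk.1| < qk.2.+1%:R^-1).
  by have [[y Xy hy]|nx] := pselect (exists2 x, X x & `|x - ratr qk.1| < qk.2.+1%:R^-1);
    [exists y|exists x0].
pose Q n := if choice.unpickle n is Some qk then g qk else x0.
exists Q; first by move=> n; rewrite /Q; case: choice.unpickle => // qk; exact: (hg qk).1.
move=> x e Xx e0; pose k := Num.trunc (2 / e).
have ek : k.+1%:R^-1 < e / 2 :> R.
  have /andP[_ h] := truncn_itv (ltW (divr_gt0 (ltr0n R 2) e0)).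
  by rewrite -[e / 2]invf_div ltf_pV2 ?posrE ?divr_gt0.
have k0 : (0 : R) < k.+1%:R^-1 by rewrite invr_gt0.
have hk q := (hg (q, k)).2; rewrite /= in hk.
set r : R := k.+1%:R^-1 in ek k0 hk.
have xx : x - r < x + r by lra.
have [q] := rat_in_itvoo xx.
rewrite in_itv /= => /andP[q1 q2].
have xq : `|x - ratr q| < r by rewrite ltr_norml; apply/andP; split; lra.
exists (choice.pickle (q, k)); rewrite /Q choice.pickleK.
have yq := hk q (ex_intro2 _ _ x Xx xq).
have -> : x - g (q, k) = (x - ratr q) - (g (q, k) - ratr q) by ring.
apply: le_lt_trans (ler_normB _ _) _; lra.
Qed.

Section Limits.
Context {R : realType}.
Implicit Types m : nat.

Lemma chi2_upper_ge0 m (t : R) : (1 < m)%N -> 0 <= chi2_upper m t.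
Proof. by move=> m1; rewrite -lee_fin chi2_upperE. Qed.

Lemma le_chi2_upper m (s t : R) : (1 < m)%N -> s <= t -> chi2_upper m t <= chi2_upper m s.
Proof.
move=> m1 st; rewrite -lee_fin !chi2_upperE //; apply: le_measure; rewrite ?inE //.
by move=> x /=; rewrite !in_itv /= !andbT; exact: le_trans.
Qed.

(** Continuity from above of the law along the half-lines [t - 1/(n+1), +oo[, whose intersection is
    [t, +oo[; monotonicity covers every s >= t - r. *)
Lemma chi2_upper_near m (t e : R) : (1 < m)%N -> 0 < e ->
  exists2 r, 0 < r & forall s, t - r <= s -> chi2_upper m s <= chi2_upper m t + e.
Proof.
move=> m1 e0.
pose F (n : nat) : set (measurableTypeR R) := `[t - n.+1%:R^-1, +oo[%classic.
have FE : \bigcap_n F n = `[t, +oo[%classic.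
  apply/seteqP; split => x /=.
    move=> h; rewrite in_itv /= andbT; apply/ler_addgt0Pr => r r0.
    pose k := Num.trunc r^-1.
    have rk : k.+1%:R^-1 < r :> R.
      have /andP[_ hk] : k%:R <= r^-1 < k.+1%:R by apply: truncn_itv; rewrite invr_ge0 ltW.
      by rewrite -[r]invrK ltf_pV2 ?posrE ?invr_gt0.
    have := h k I; rewrite /F /= in_itv /= andbT; move: rk; move: (k.+1%:R^-1) => q; lra.
  rewrite in_itv /= andbT => tx n _; rewrite /F /= in_itv /= andbT; apply: le_trans tx.
  by rewrite gerBl invr_ge0.
have mF n : measurable (F n) by exact: measurable_itv.
have : (sum_sqr_prob m.-1 \o F) x @[x --> \oo] --> (sum_sqr_prob m.-1 (\bigcap_n F n) : \bar R).
  apply: nonincreasing_cvg_mu => //.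
  - by apply: le_lt_trans (probability_le1 _ (mF 0%N)) _; rewrite ltry.
  - by rewrite FE.
  - move=> i j ij; apply/subsetPset => x; rewrite /F /= !in_itv /= !andbT.
    by apply: le_trans; rewrite lerB // lef_pV2 ?posrE // ler_nat.
rewrite FE -chi2_upperE // => cv.
have {}cv : chi2_upper m (t - n.+1%:R^-1) @[n --> \oo] --> chi2_upper m t.
  have E : sum_sqr_prob m.-1 \o F = (fun n => (chi2_upper m (t - n.+1%:R^-1))%:E) :> (nat -> \bar R).
    by apply/funext => n; rewrite chi2_upperE.
  by rewrite E in cv; exact: (fine_cvg cv).
have /cvgrPdist_lt /(_ e e0) [N _ hN] := cv.
exists N.+1%:R^-1; first by rewrite invr_gt0.
move=> s /(le_chi2_upper m1) h; apply: le_trans h _.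
have := hN N (leqnn N); rewrite /= ltr_norml; move: (N.+1%:R^-1) => q /andP[]; lra.
Qed.

End Limits.

Section Bounds.
Context {R : realType}.

Lemma crossing_rate_gt0 m (b : R) : (0 < m)%N -> 0 < b -> 0 < crossing_rate m b.
Proof.
move=> m0 b0; have b20 : 0 < b ^+ 2 by rewrite exprn_gt0.
rewrite /crossing_rate chi2_pdfE // /chi2_kernel b20.
have pi20 : 0 < 2 * pi :> R by rewrite pmulr_rgt0 // pi_gt0.
have J0 := (@chi2_massE R m m0).2.
rewrite divr_gt0 ?sqrtr_gt0 // pmulr_rgt0; first by rewrite pmulr_rgt0 ?invr_gt0 // pmulr_rgt0 ?expR_gt0 ?powR_gt0.
by rewrite pmulr_rgt0.
Qed.

Lemma chi2_pdf_ge0 m (x : R) : (0 < m)%N -> 0 <= chi2_pdf m x.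
Proof.
move=> m0; rewrite chi2_pdfE // mulr_ge0 ?chi2_kernel_ge0 // invr_ge0 ltW //.
exact: (chi2_massE m0).2.
Qed.

(** Lets the level increase to [b]: b^2 - b'^2 <= 2 b (b - b') transfers the neighbourhoods of b^2
    from [chi2_upper_near] and [chi2_pdf_near]. The denominators [c + 1] and [K * L + 1] avoid
    dividing by 0. *)
Lemma tube_bound_near m (b c L e : R) : (1 < m)%N -> 0 < b -> 0 <= c -> 0 <= L -> 0 < e ->
  exists2 r, 0 < r & forall b', 0 < b' -> b - r <= b' -> b' <= b ->
  c * chi2_upper m (b' ^+ 2) + crossing_rate m b' * L <=
  c * chi2_upper m (b ^+ 2) + crossing_rate m b * L + e.
Proof.
move=> m1 b0 c0 L0 e0; have b20 : 0 < b ^+ 2 by rewrite exprn_gt0.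
have e20 : 0 < e / 2 by rewrite divr_gt0.
have cc : 0 < c + 1 by rewrite ltr_wpDl.
have [r1 r10 h1] := chi2_upper_near (b ^+ 2) m1 (divr_gt0 e20 cc).
pose K : R := 2 * b / Num.sqrt (2 * pi).
have K0 : 0 < K by rewrite divr_gt0 ?sqrtr_gt0 ?pmulr_rgt0 // pi_gt0.
have KL : 0 < K * L + 1 by rewrite ltr_wpDl // mulr_ge0 // ltW.
have [r2 r20 h2] := chi2_pdf_near (ltnW m1) b20 (divr_gt0 e20 KL).
have bb : 0 < 2 * b by rewrite pmulr_rgt0.
exists (Num.min (r1 / (2 * b)) (r2 / (2 * b))); first by rewrite lt_min !divr_gt0.
move=> b' b'0; rewrite lerBlDl -lerBlDr le_min => /andP[hr1 hr2] b'b.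
rewrite ler_pdivlMr // in hr1; rewrite ler_pdivlMr // in hr2.
have d0 : 0 <= b ^+ 2 - b' ^+ 2 by rewrite subr_ge0 ler_pXn2r ?nnegrE // ltW.
have d1 : b ^+ 2 - b' ^+ 2 <= (b - b') * (2 * b).
  rewrite subr_sqr ler_wpM2l ?subr_ge0 //; lra.
have {}h1 : chi2_upper m (b' ^+ 2) <= chi2_upper m (b ^+ 2) + e / 2 / (c + 1).
  by apply: h1; lra.
have {}h2 : chi2_pdf m (b' ^+ 2) <= chi2_pdf m (b ^+ 2) + e / 2 / (K * L + 1).
  by apply: h2; rewrite distrC ger0_norm //; lra.
have p0 := chi2_pdf_ge0 (b' ^+ 2) (ltnW m1).
have c1 : c * chi2_upper m (b' ^+ 2) <= c * chi2_upper m (b ^+ 2) + e / 2.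
  apply: le_trans (ler_wpM2l c0 h1) _; rewrite mulrDr lerD2l mulrCA ler_piMr ?(ltW e20) //.
  by rewrite ler_pdivrMr // mul1r lerDl.
have c2 : crossing_rate m b' * L <= crossing_rate m b * L + e / 2.
  apply: le_trans (_ : K * (chi2_pdf m (b ^+ 2) + e / 2 / (K * L + 1)) * L <= _).
    apply: ler_wpM2r => //; rewrite /crossing_rate mulrAC /K.
    apply: ler_pM => //; first by rewrite divr_ge0 ?sqrtr_ge0 // mulr_ge0 // ltW.
    by rewrite ler_wpM2r ?invr_ge0 ?sqrtr_ge0 // ler_wpM2l.
  have -> : K * (chi2_pdf m (b ^+ 2) + e / 2 / (K * L + 1)) * L =
     crossing_rate m b * L + e / 2 * (K * L / (K * L + 1)).
    rewrite /crossing_rate /K; ring.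
  rewrite lerD2l ler_piMr ?(ltW e20) // ler_pdivrMr // mul1r lerDl //.
lra.
Qed.

End Bounds.

Section UnionBound.
Context d (T : measurableType d) (R : realType) (P : probability T R).
Variables (n p : nat) (xi : T -> 'cV[R]_(n.+1 * p)) (X : set R) (psi : R -> 'cV[R]_p) (L b : R).
Hypotheses (n0 : (0 < n)%N) (p1 : (1 < p)%N) (hxi : std_normal_vector P xi)
  (hX : finite_union_of_intervals X) (hpsi : forall x, X x -> sphere p (psi x))
  (cpsi : {within X, continuous psi}) (LE : curve_length X psi = L%:E) (b0 : 0 < b).

Let E x := [set w | b ^+ 2 <= block_sqnorm (xi w) (psi x)].

Lemma measurable_block_ge u (t : R) : measurable [set w | t <= block_sqnorm (xi w) u].
Proof.
rewrite (_ : [set w | _] = (fun w => block_sqnorm (xi w) u : measurableTypeR R) @^-1` `[t, +oo[%classic).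
  exact: (measurable_preimage (measurable_block_sqnorm hxi u)).
by apply/seteqP; split => w /=; rewrite in_itv /= andbT.
Qed.

Lemma curve_length_real_ge0 : 0 <= L.
Proof.
by apply: le_trans (curve_length_ge LE (_ : sorted <=%R [::])) => //; rewrite big_nil.
Qed.

(** The bound for finite families is independent of the family, so continuity from below applies.
    The slack [e / (L + 1)] in the rate costs at most [e] after multiplication by L. *)
Lemma countable_union_bound (Q : nat -> R) : (forall i, X (Q i)) ->
  (P (\bigcup_i E (Q i)) <=
   ((n_components (closure (psi @` X)))%:R * chi2_upper n.+1 (b ^+ 2) +
    crossing_rate n.+1 b * L)%:E)%E.
Proof.
move=> QX; have mE x : measurable (E x) by exact: measurable_block_ge.
set chi := n_components _; set p0 := chi2_upper _ _; set rho := crossing_rate _ _.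
have rho0 : 0 < rho by exact: crossing_rate_gt0.
have PE x : X x -> P (E x) = p0%:E.
  by move=> Xx; apply: block_sqnorm_law => //; apply/sphereP/hpsi.
have fin F : {in F, forall x, X x} ->
    fine (P (\big[setU/set0]_(x <- F) E x)) <= chi%:R * p0 + rho * L.
  move=> FX; apply/ler_addgt0Pr => e e0.
  have L10 : 0 < L + 1 by rewrite ltr_wpDl // curve_length_real_ge0.
  have e'0 : 0 < e / (L + 1) by rewrite divr_gt0.
  have [delta delta0 hd] := block_crossing n0 p1 b0 e'0.
  apply: le_trans (finite_union_bound hX cpsi (chi2_upper_ge0 _ (_ : 1 < n.+1)%N)
    (_ : 0 <= rho + e / (L + 1)) delta0 (fun x _ => mE x) PE _ LE FX) _ => //.
  - by rewrite addr_ge0 // ltW.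
  - by move=> x y Xx Xy xy; apply: hd => //; apply/sphereP/hpsi.
  rewrite mulrDl addrA lerD2l mulrAC ler_pdivrMr // ler_wpM2l ?(ltW e0) //.
  by rewrite lerDl.
pose F k := \big[setU/set0]_(i < k.+1) E (Q i).
have mF k : measurable (F k) by apply: bigsetU_measurable => i _.
have mU : measurable (\bigcup_i E (Q i)) by apply: bigcup_measurable => i _.
have cv : (P \o F) k @[k --> \oo] --> P (\bigcup_i E (Q i)).
  have UF : \bigcup_k F k = \bigcup_i E (Q i) by exact: bigcup_bigsetU_bigcup.
  rewrite -UF in mU *; apply: nondecreasing_cvg_mu => //.
  - move=> i j ij; apply/subsetPset; by apply: (@subset_bigsetU _ (fun i => E (Q i))).
rewrite -(cvg_lim _ cv) //; apply: lime_le; first by apply/cvg_ex; exists (P (\bigcup_i E (Q i))).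
near=> k; rewrite /= (fine_probability P (mF k)) lee_fin.
rewrite /F -(big_mkord xpredT (fun i => E (Q i))) -(big_map Q xpredT E); apply: fin.
by move=> x /mapP[i _ ->].
Unshelve. all: by end_near. Qed.

End UnionBound.

(** * The supremum over M through a dense sequence *)

Lemma continuous_bigsum (R : realType) (U : topologicalType) (I : Type) (r : seq I) (F : I -> U -> R) :
  (forall i, continuous (F i)) -> continuous (fun u => \sum_(i <- r) F i u).
Proof.
move=> cF; elim: r => [|i r IH] u.
  by rewrite (_ : (fun _ => _) = fun=> 0); [exact: cvg_cst|apply/funext => v; rewrite big_nil].
rewrite (_ : (fun _ => _) = fun v => F i v + \sum_(j <- r) F j v); last first.
  by apply/funext => v; rewrite big_cons.
by apply: continuousD; [exact: cF|exact: IH].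
Qed.

Lemma continuous_edot (R : realType) n (v : 'cV[R]_n) : continuous (fun u : 'cV[R]_n => edot v u).
Proof.
apply: continuous_bigsum => i u; apply: continuousM; first exact: cst_continuous.
exact: coord_continuous.
Qed.

Lemma continuous_edot_diag (R : realType) n : continuous (fun u : 'cV[R]_n => edot u u).
Proof. by apply: continuous_bigsum => i u; apply: continuousM; exact: coord_continuous. Qed.

Lemma continuous_block_sqnorm (R : realType) m p (v : 'cV[R]_(m * p)) :
  continuous (fun u : 'cV[R]_p => block_sqnorm v u).
Proof.
have c i : continuous (fun u : 'cV[R]_p => block_dot v u i).
  apply: continuous_bigsum => k u; apply: continuousM; first exact: cst_continuous.
  rewrite (_ : (fun _ => _) = fun w : 'cV[R]_p => (\col_(j < m) (j == i :> nat)%:R : 'cV[R]_m) (mxtens_unindex k).1 0 *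
     w (mxtens_unindex k).2 0); last first.
    apply/funext => w; rewrite [LHS]mxE.
    by rewrite !(ord1 (mxtens_unindex _).1) !(ord1 (mxtens_unindex _).2).
  by apply: continuousM; [exact: cst_continuous|exact: coord_continuous].
by apply: continuous_bigsum => i u; apply: (continuousM (c i u) (c i u)).
Qed.

Section Supremum.
Context {R : realType}.
Variables (n p : nat) (X : set R) (psi : R -> 'cV[R]_p).
Hypotheses (X0 : X !=set0) (hpsi : forall x, X x -> sphere p (psi x))
  (cpsi : {within X, continuous psi}).

Let values (v : 'cV[R]_(n.+1 * p)) := [set edot v u | u in M_set n.+2 X psi].

(** A half-space is closed, so a bound on the tensors passes to their closure. *)
Lemma M_set_edot_le v (c : R) :
  (forall x h, X x -> sphere n.+1 h -> edot v (h *t psi x : 'cV[R]_(n.+1 * p)) <= c) -> ubound (values v) c.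
Proof.
move=> hc _ [u + <-]; have cl : closed [set u | edot v u <= c].
  exact: (preimage_closed (D := [set x | x <= c]) (fun u _ => @continuous_edot _ _ v u) (@closed_le _ c)).
suff : M_set n.+2 X psi `<=` [set u | edot v u <= c] by apply.
rewrite ((closure_id _).1 cl); apply: closure_subset => _ [x [h [Xx hh ->]]]; exact: hc.
Qed.

(** Real [sup] has its meaning only on nonempty bounded sets; Cauchy-Schwarz provides the bound. *)
Lemma M_set_values_sup v : has_sup (values v).
Proof.
have [x Xx] := X0; split.
  have [h hh _] := edot_tens_attained v (psi x).
  exists (edot v (h *t psi x : 'cV[R]_(n.+1 * p))), (h *t psi x) => //.
  by apply: subset_closure; exists x, h.
exists (Num.sqrt (edot v v)); apply: M_set_edot_le => y h Xy /sphereP h1.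
have /sphereP y1 := hpsi Xy; apply: le_trans (ler_norm _) _.
rewrite -sqrtr_sqr; apply: ler_wsqrtr; apply: le_trans (edot_CS _ _) _.
by rewrite edot_tens h1 y1 !mulr1.
Qed.

Lemma sup_M_ge v x : X x -> Num.sqrt (block_sqnorm v (psi x)) <= sup (values v).
Proof.
move=> Xx; have [h hh <-] := edot_tens_attained v (psi x).
apply: ub_le_sup; first by have [] := M_set_values_sup v.
by exists (h *t psi x) => //; apply: subset_closure; exists x, h.
Qed.

Lemma lt_sup_M v c : c < sup (values v) ->
  exists2 x, X x & c < Num.sqrt (block_sqnorm v (psi x)).
Proof.
move=> hc; apply: contrapT => nx.
move: hc; rewrite ltNge => /negP; apply; apply: ge_sup; first by have [] := M_set_values_sup v.
apply: M_set_edot_le => x h Xx hh; apply: le_trans (edot_tens_le _ _ hh) _.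
by rewrite leNgt; apply/negP => hx; apply: nx; exists x.
Qed.

(** A dense sequence need not attain the supremum, hence the levels b' < b. A value above b' at some
    x persists, by continuity, at a nearby Q i. *)
Lemma sup_M_geP v (Q : nat -> R) (b : R) : (forall i, X (Q i)) ->
  (forall x e, X x -> 0 < e -> exists i, `|x - Q i| < e) -> 0 < b ->
  b <= sup (values v) <->
  forall b', 0 < b' -> b' < b -> exists i, b' ^+ 2 <= block_sqnorm v (psi (Q i)).
Proof.
move=> QX Qd b0; split => [bs b' b'0 b'b|h].
  have [x Xx] := lt_sup_M (lt_le_trans b'b bs).
  rewrite -ltr_sqr ?nnegrE ?sqrtr_ge0 ?(ltW b'0) // sqr_sqrtr ?block_sqnorm_ge0 // => hx.
  have cb : {within X, continuous (block_sqnorm v \o psi)}.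
    by apply: within_continuous_comp cpsi => u _; exact: continuous_block_sqnorm.
  have e0 : 0 < block_sqnorm v (psi x) - b' ^+ 2 by rewrite subr_gt0.
  have [r r0 hr] := within_continuousP cb Xx e0.
  have [i xi] := Qd x r Xx r0; exists i.
  have := hr (Q i) (QX i) xi; rewrite /= ltr_norml => /andP[_]; lra.
apply/ler_addgt0Pr => e e0.
pose b' := Num.max (b / 2) (b - e).
have b'0 : 0 < b' by rewrite lt_max divr_gt0.
have b'b : b' < b by rewrite gt_max; apply/andP; split; lra.
have [i hi] := h b' b'0 b'b.
have := sup_M_ge v (QX i); have : b' <= Num.sqrt (block_sqnorm v (psi (Q i))).
  by rewrite -(ger0_norm (ltW b'0)) -sqrtr_sqr; exact: ler_wsqrtr.
have : b - e <= b' by rewrite le_max lexx orbT.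
lra.
Qed.

End Supremum.

(** A boundary point gives an injection of [0, 1[ into [Gamma_set], which lies in the sphere. The
    sphere is empty for p = 0 and has two points for p = 1, too few for the distinct images of 0,
    1/2 and 1/3. *)
Lemma curve_boundary_dim (R : realType) p (X : set R) (psi : R -> 'cV[R]_p) :
  (forall x, X x -> sphere p (psi x)) -> curve_boundary (Gamma_set X psi) !=set0 ->
  (1 < p)%N /\ X !=set0.
Proof.
move=> hpsi [u [U [phi [_ _ _ [_ phiG [g [_ phiK]]]]]]].
have GS : Gamma_set X psi `<=` [set u | edot u u = 1].
  have cl : closed [set u : 'cV[R]_p | edot u u = 1].
    exact: (preimage_closed (f := fun u : 'cV[R]_p => edot u u) (D := [set x | x = 1]) (fun u _ => @continuous_edot_diag _ _ u) (@closed_eq _ 1)).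
  rewrite ((closure_id _).1 cl); apply: closure_subset => _ [x Xx <-].
  exact/sphereP/hpsi.
have phiS t : t \in (`[0, 1[ : interval R) -> Gamma_set X psi (phi t).
  move=> t01; have : (phi @` `[0, 1[) (phi t) by exists t.
  by rewrite phiG => -[].
have phi_inj s t : s \in (`[0, 1[ : interval R) -> t \in (`[0, 1[ : interval R) -> phi s = phi t -> s = t.
  by move=> s01 t01 st; rewrite -(phiK s) ?inE // -(phiK t) ?inE // st.
have i0 : (0 : R) \in (`[0, 1[ : interval R) by rewrite in_itv /= lexx ltr01.
have i2 : (2^-1 : R) \in (`[0, 1[ : interval R).
  by rewrite in_itv /=; apply/andP; split; lra.
have i3 : (3^-1 : R) \in (`[0, 1[ : interval R).
  by rewrite in_itv /=; apply/andP; split; lra.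
have X0 : X !=set0.
  have [|] := pselect (X !=set0) => // /set0P/negP/negPn/eqP X0.
  have := phiS 0 i0; rewrite /Gamma_set X0 image_set0 closure0 //.
split => //; rewrite ltnNge; apply/negP => p_le1.
have [p0|p1] : p = 0%N \/ p = 1%N by case: (p) p_le1 => [|[]]; [left|right|].
  subst p; have [x Xx] := X0; have /sphereP := hpsi x Xx; rewrite /edot big_ord0 => /eqP.
  by rewrite eq_sym oner_eq0.
subst p.
have pm t : t \in (`[0, 1[ : interval R) -> (phi t 0 0 == 1) || (phi t 0 0 == -1).
  by move=> /phiS /GS /=; rewrite /edot big_ord1 -expr2 => /eqP; rewrite sqrf_eq1.
have eqv (v w : 'cV[R]_1) : v 0 0 = w 0 0 -> v = w.
  by move=> vw; apply/colP => i; rewrite (ord1 i).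
have inj s t : s \in (`[0, 1[ : interval R) -> t \in (`[0, 1[ : interval R) ->
    (phi s 0 0 == 1) = (phi t 0 0 == 1) -> s = t.
  move=> s01 t01 st; apply: phi_inj => //; apply: eqv.
  have := pm t t01; have := pm s s01; rewrite st.
  by case: (phi t 0 0 =P 1) st => [-> /eqP -> //|_ _ /= /eqP -> /eqP ->].
move: (inj _ _ i0 i2) (inj _ _ i0 i3) (inj _ _ i2 i3).
by do 3!case: (_ == 1) => //; lra.
Qed.

Theorem theorem4p2 (R : realType) (d : measure_display) (T : measurableType d)
    (P : probability T R) (k p : nat) (hk : (3 <= k)%N)
    (X : set R) (hX : finite_union_of_intervals X)
    (f : R -> 'cV[R]_p) (Sigma Shalf : 'M[R]_p)
    (hSigma : posdef Sigma) (hShalf : Shalf^T *m Shalf = Sigma)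
    (xi : T -> 'cV[R]_(k.-1 * p)) (hxi : std_normal_vector P xi) :
  let psi := regression_direction Shalf f in
  let Gam := Gamma_set X psi in
  let M := M_set k X psi in
  (forall x, X x -> sphere p (psi x)) ->
  {in X &, injective psi} ->
  piecewise_C2 X psi ->
  (~ exists x x' : R, [/\ X x, X x' & psi x = - psi x']) ->
  (closed_piecewise_C2_manifold k.-1 M \/
   C2_manifold_with_piecewise_C2_boundary k.-1 M) ->
  curve_boundary Gam !=set0 ->
  forall b : R, 0 <= b ->
    (P [set w | (b <= sup [set edot (xi w) u | u in M])%R] <=
     P_tube k (curve_length X psi) (n_components Gam) b)%E.
Proof.
case: k hk xi hxi => [|[|[|n]]] // _ xi hxi psi Gam M hpsi _ [cpsi _] _ _ hbd b b0.
have [p1 X0] := curve_boundary_dim hpsi hbd.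
have [js XE] := hX.
have chi_gt0 : (0 < n_components Gam)%N := n_components_gt0 XE cpsi X0.
set L := curve_length X psi; set chi := n_components Gam in chi_gt0 *.
have m1 : (1 < n.+2)%N by [].
(* At b = 0 all upper tails are 1: the length term is 0, even for an infinite length, and the number
   of components, at least 1, bounds any probability. *)
have [->|b_gt0] := eqVneq b 0.
  rewrite /P_tube expr0n /= !chi2_upper0 // subrr mule0 add0e.
  rewrite (_ : [set w | _] = setT) ?probability_setT.
    by rewrite lee_fin mulr1 ler1n.
  apply/seteqP; split => // w _ /=; have [x Xx] := X0.
  by apply: le_trans (sup_M_ge X0 hpsi (xi w) Xx); exact: sqrtr_ge0.
have {}b_gt0 : 0 < b by rewrite lt_neqAle eq_sym b_gt0.
have rate0 : 0 < crossing_rate n.+2 b by exact: crossing_rate_gt0.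
rewrite /P_tube muleAC -EFinM tube_coefE //= subSS subn0.
have [Q QX Qd] := dense_sequence X0.
pose E b' i := [set w | b' ^+ 2 <= block_sqnorm (xi w) (psi (Q i))].
have mE b' : measurable (\bigcup_i E b' i).
  by apply: bigcup_measurable => i _; exact: (measurable_block_ge hxi).
(* Countably many levels suffice, which makes the event measurable; N + 2 in place of N + 1 keeps
   the level positive for N = 0. *)
have supE : [set w | b <= sup [set edot (xi w) u | u in M]] =
    \bigcap_N \bigcup_i E (b - b / N.+2%:R) i.
  apply/seteqP; split => w /=.
    move=> /(sup_M_geP X0 hpsi cpsi _ QX Qd b_gt0) h N _.
    have bN : 0 < b - b / N.+2%:R by rewrite subr_gt0 ltr_pdivrMr // ltr_pMr // ltr1n.
    have [|i hi] := h _ bN; last by exists i.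
    by rewrite gtrBl divr_gt0.
  move=> h; apply/(sup_M_geP X0 hpsi cpsi _ QX Qd b_gt0) => b' b'0 b'b.
  have bb' : 0 < b - b' by rewrite subr_gt0.
  pose N := Num.trunc (b / (b - b')).
  have /andP[_ hN] : N%:R <= b / (b - b') < N.+1%:R by apply: truncn_itv; rewrite divr_ge0 // ltW.
  have [i _ hi] := h N I; exists i; apply: le_trans hi.
  have N2 : b / N.+2%:R <= b - b'.
    rewrite ler_pdivrMr // mulrC -ler_pdivrMr //; apply: le_trans (ltW hN) _.
    by rewrite ler_nat.
  have b'N : b' <= b - b / N.+2%:R by move: N2; move: (b / _) => q; lra.
  by rewrite ler_pXn2r // nnegrE ?(le_trans _ b'N) // ltW.
have mS : measurable [set w | b <= sup [set edot (xi w) u | u in M]].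
  by rewrite supE; apply: bigcap_measurable => // N _; exact: mE.
have Lge0 : (0 <= L)%E.
  by apply: ereal_sup_ubound; exists [::] => //; rewrite big_nil.
case LE : L Lge0 => [l| |] // l0.
  rewrite -EFinM -EFinD addrC; apply/lee_addgt0Pr => e e0.
  have [r r0 hr] := tube_bound_near m1 b_gt0 (ler0n R chi) l0 e0.
  (* The bound [b / 2] keeps the lowered level positive, as [countable_union_bound] requires. *)
  pose b' := Num.max (b / 2) (b - r).
  have b'0 : 0 < b' by rewrite lt_max divr_gt0.
  have b'b : b' < b by rewrite gt_max; apply/andP; split; lra.
  apply: le_trans (_ : P (\bigcup_i E b' i) <= _)%E.
    apply: le_measure; rewrite ?inE // => w /=.
    by move=> /(sup_M_geP X0 hpsi cpsi _ QX Qd b_gt0) /(_ b' b'0 b'b) [i hi]; exists i.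
  apply: le_trans (countable_union_bound _ p1 hxi hX hpsi cpsi LE b'0 QX) _ => //.
  rewrite -EFinD lee_fin; apply: hr => //; last exact: ltW.
  by rewrite le_max lexx orbT.
(* Infinite length: the coefficient is positive, so the right-hand side is +oo. *)
rewrite gt0_muley ?lte_fin // addye //; exact: leey.
Qed.
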